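(* Let $\mathfrak p=(p_d)_{d\ge1}$, $p_d\in\mathcal P_d(\mathbb R)$, be a sequence of polynomials with infinitesimal distribution $(\mu,\mu')$. Then the infinitesimal $R$-transform $R^{inf}_{\mu,\mu'}$ satisfies $$\widehat R_{\mathfrak p}(z)=R^{inf}_{\mu,\mu'}(z)-(H_\mu\circ K_\mu)(z)\cdot K_\mu'(z)=R^{inf}_{\mu,\mu'}(z)-\frac{K_\mu''(z)}{2K_\mu'(z)}-\frac1z.$$
   Context: $\mathcal P_d(\mathbb R)$ is the set of monic real polynomials of degree $d$ with only real roots. For $p_d\in\mathcal P_d(\mathbb R)$ with roots $\lambda_1,\dots,\lambda_d$ (with multiplicity), $m_n(p_d)=\frac1d\sum_k\lambda_k^n$. Write $p_d(x)=\sum_{k=0}^d x^{d-k}(-1)^k\binom dk\mathsf e_k(p_d)$. The finite-free cumulants are $\kappa_n(p_d)=\frac{(-d)^{n-1}}{(n-1)!}\sum_{\pi\in P(n)}(-1)^{|\pi|-1}(|\pi|-1)!\prod_{V\in\pi}\mathsf e_{|V|}(p_d)$, $1\le n\le d$, with $P(n)$ the set of partitions of $[n]=\{1,\dots,n\}$ and $|\pi|$ the number of blocks. A sequence $\mathfrak p$ has infinitesimal distribution $(\mu,\mu')$ if $\mu$ is a probability distribution on $\mathbb R$ with finite moments $m_n(\mu)$ of all orders, $m_n(p_d)\to m_n(\mu)$ for all $n\ge0$, the limits $m_n'(\mathfrak p)=\lim_{d\to\infty}d\,(m_n(p_d)-m_n(\mu))$ exist for all $n\ge1$, and $\mu':\mathbb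 R[x]\to\mathbb R$ is the linear functional with $\mu'(1)=0$, $\mu'(x^n)=m_n'(\mathfrak p)$. Write $m_n(\mu')=\mu'(x^n)$. The cumulant fluctuations of such $\mathfrak p$ are the numbers $\widehat r_n(\mathfrak p)$ with $\kappa_n(p_d)=r_n(\mu)+\frac1d\widehat r_n(\mathfrak p)+o(1/d)$ as $d\to\infty$ (they always exist). $NC(n)$ is the set of non-crossing partitions of $[n]$; for a sequence $(u_n)$, $u_\pi=\prod_{V\in\pi}u_{|V|}$, $u_{\pi\setminus V}=\prod_{W\in\pi,W\ne V}u_{|W|}$ and $u_\sigma=\prod_c u_{|c|}$ over cycles $c$ (fixed points included) of a permutation $\sigma$. Free cumulants $r_n(\mu)$ are defined recursively by $m_n(\mu)=\sum_{\pi\in NC(n)}r_\pi(\mu)$; infinitesimal free cumulants $r_n'(\mu,\mu')$ recursively by $m_n(\mu')=\sum_{\pi\in NC(n)}\sum_{V\in\pi}r'_{|V|}(\mu,\mu')\,r_{\pi\setminus V}(\mu)$. Formal power series (identities, compositions, derivatives are formal): $K_\mu(z)=\frac1z+\sum_{n\ge1}r_n(\mu)z^{n-1}$; $R^{inf}_{\mu,\mu'}(z)=\sum_{n\ge1}r_n'(\mu,\mu')z^{n-1}$; $\widehat R_{\mathfrak p}(z)=\sum_{n\ge1}\widehat r_n(\mathfrak p)z^{n-1}$; $H_\mu(z)=\sum_{n\ge2}h_n(\mu)z^{-n-1}$ with $h_n(\mu)=\frac n2\sum_{t+s=n,\ \sigma\in S_{NC}(t,s)}\frac{r_\sigma(\mu)}{ts}$,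 the sum over ordered pairs of integers $t,s\ge1$. Here, with $\gamma_{t,s}=(1,\dots,t)(t+1,\dots,t+s)\in S_{t+s}$, $S_{NC}(t,s)$ is the set of $\sigma\in S_{t+s}$ such that $\langle\sigma,\gamma_{t,s}\rangle$ acts transitively on $[t+s]$ and $|\sigma|+|\sigma^{-1}\gamma_{t,s}|=t+s$, $|\cdot|$ counting cycles including fixed points. *)

(* Defs.v *)
From HB Require Import structures.
From mathcomp Require Import all_boot all_order all_algebra all_fingroup.

Set Implicit Arguments.
Unset Strict Implicit.
Unset Printing Implicit Defensive.

Import Order.TTheory GRing.Theory Num.Theory.

Local Open Scope ring_scope.

(** * Set partitions *)

Definition set_partitions (n : nat) : {set {set {set 'I_n}}} :=
  [set P : {set {set 'I_n}} | partition P [set: 'I_n]].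

Definition noncrossing (n : nat) (P : {set {set 'I_n}}) : bool :=
  [forall V in P, forall W in P,
   forall i in V, forall j in W, forall k in V, forall l in W,
     [&& i < j, j < k & k < l]%N ==> (V == W)].

Definition NC (n : nat) : {set {set {set 'I_n}}} :=
  [set P in set_partitions n | noncrossing P].

(** * Free and infinitesimal free cumulants *)

Section Recursion.
Variable R : nmodType.

(* [recseq F] is the sequence u with u_0 = 0 and u_n = F n u for n >= 1, for an
   F such that F n u depends only on u_1, ..., u_(n-1) (see [recseqE]). *)
Fixpoint recseq_upto (F : nat -> (nat -> R) -> R) (n : nat) : nat -> R :=
  if n is n'.+1 then
    let u := recseq_upto F n' in
    fun k => if k == n'.+1 then F n'.+1 u else u k
  else fun=> 0.

Definition recseq (F : nat -> (nat -> R) -> R) : nat -> R :=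
  fun n => recseq_upto F n n.

Lemma recseq_uptoE F n k : (k <= n)%N -> recseq_upto F n k = recseq F k.
Proof.
elim: n => [|n IH]; first by rewrite leqn0 => /eqP ->.
rewrite leq_eqVlt => /orP[/eqP -> //|]; rewrite ltnS => kn /=.
by rewrite ltn_eqF ?ltnS// IH.
Qed.

Lemma recseqE F n : (0 < n)%N ->
  (forall u v, (forall k, (0 < k < n)%N -> u k = v k) -> F n u = F n v) ->
  recseq F n = F n (recseq F).
Proof.
case: n => // n _ Fuv; rewrite {1}/recseq /= eqxx; apply: Fuv => k /andP[_ kn].
exact: recseq_uptoE.
Qed.

End Recursion.

Section FreeCumulants.
Variables (R : comNzRingType) (m m' : nat -> R).

Definition free_cumulant : nat -> R :=
  recseq (fun n r =>
    m n - \sum_(P in NC n | P != [set [set: 'I_n]])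
            \prod_(V in P) r #|V|).

Definition inf_free_cumulant : nat -> R :=
  recseq (fun n r' =>
    m' n - \sum_(P in NC n | P != [set [set: 'I_n]])
             \sum_(V in P) r' #|V| * \prod_(W in P | W != V) free_cumulant #|W|).

Lemma card_NC_block n (P : {set {set 'I_n}}) V :
  P \in NC n -> P != [set [set: 'I_n]] -> V \in P -> (0 < #|V| < n)%N.
Proof.
rewrite !inE => /andP[partP _] P1 VP.
have [_ trivP P0] := and3P partP.
have V0 : V != set0 by apply: contraNneq P0 => <-.
rewrite card_gt0 V0 /= -[X in (_ < X)%N]card_ord -cardsT proper_card// properT.
apply: contraNneq P1 => VT; rewrite VT in VP.
apply/eqP/setP => W; rewrite inE; apply/idP/eqP => [WP|-> //].
apply/eqP; apply: contraT => WT.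
have := trivIsetP trivP _ _ WP VP WT.
rewrite -setI_eq0 setIT => /eqP W0.
by rewrite W0 (negbTE P0) in WP.
Qed.

Lemma NC_full n : (0 < n)%N -> [set [set: 'I_n]] \in NC n.
Proof.
move=> n0; rewrite !inE; apply/andP; split.
  rewrite /partition /cover big_set1 eqxx /=; apply/andP; split.
    by apply/trivIsetP => A B /set1P -> /set1P ->; rewrite eqxx.
  rewrite inE eq_sym -card_gt0 cardsT card_ord; exact: n0.
apply/forall_inP => V /set1P ->; apply/forall_inP => W /set1P ->.
by do 4 apply/forall_inP => ? _; rewrite eqxx implybT.
Qed.

Lemma free_cumulantP n : (0 < n)%N ->
  m n = \sum_(P in NC n) \prod_(V in P) free_cumulant #|V|.
Proof.
move=> n0; rewrite (bigD1 [set [set: 'I_n]]) ?NC_full//= big_set1.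
rewrite cardsT card_ord {1}/free_cumulant recseqE// ?subrK// => u v uv.
congr (_ - _); apply: eq_bigr => P /andP[PNC P1].
by apply: eq_bigr => V VP; apply: uv; apply: card_NC_block VP.
Qed.

Lemma inf_free_cumulantP n : (0 < n)%N ->
  m' n = \sum_(P in NC n) \sum_(V in P)
           inf_free_cumulant #|V| * \prod_(W in P | W != V) free_cumulant #|W|.
Proof.
move=> n0; rewrite (bigD1 [set [set: 'I_n]]) ?NC_full//= big_set1.
rewrite [X in _ * X]big1 ?mulr1; last by move=> W /andP[/set1P -> /eqP].
rewrite cardsT card_ord {1}/inf_free_cumulant recseqE// ?subrK// => u v uv.
congr (_ - _); apply: eq_bigr => P /andP[PNC P1].
by apply: eq_bigr => V VP; rewrite uv//; apply: card_NC_block VP.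
Qed.

End FreeCumulants.

(** * Annular non-crossing permutations *)

Section Annular.
Variables t s : nat.

Definition annular_fun (i : 'I_(t + s)) : 'I_(t + s) :=
  match split i with
  | inl j => lshift s (ordS j)
  | inr k => rshift t (ordS k)
  end.

Lemma annular_fun_inj : injective annular_fun.
Proof.
move=> i j; rewrite /annular_fun.
case: (splitP i) => i' Ei; case: (splitP j) => j' Ej => /eqP;
  rewrite ?eq_lshift ?eq_rshift ?eq_lrshift ?eq_rlshift// => /eqP /ordS_inj E;
  by apply: val_inj; rewrite /= Ei Ej E.
Qed.

(* the permutation (1, ..., t)(t+1, ..., t+s), shifted to {0, ..., t+s-1} *)
Definition annular_perm : {perm 'I_(t + s)} := perm annular_fun_inj.

(* Products of permutations compose from left to right in MathComp; this is
   harmless here since g s^-1 and s^-1 g are conjugate. *)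
Definition SNC : {set {perm 'I_(t + s)}} :=
  [set g : {perm 'I_(t + s)} |
    [transitive <<[set g; annular_perm]>>%g, on [set: 'I_(t + s)] | 'P] &&
    (#|porbits g| + #|porbits (g^-1 * annular_perm)%g| == t + s)%N].

End Annular.

Definition annular_sum (R : fieldType) (r : nat -> R) (n : nat) : R :=
  n%:R / 2 *
  \sum_(1 <= t < n) \sum_(g in SNC t (n - t))
     (\prod_(c in porbits g) r #|c|) / (t * (n - t))%:R.

(* Loaded only here: several notations on finite sets are overridden. *)
From mathcomp Require Import all_classical all_reals all_analysis.

Import numFieldNormedType.Exports.

Local Open Scope classical_set_scope.
Local Open Scope ring_scope.

(** * Real-rooted polynomials and finite free cumulants *)

Section RealRooted.
Variable R : realType.

Definition real_rooted (d : nat) (p : {poly R}) : Prop :=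
  exists lam : d.-tuple R, p = \prod_(x <- lam) ('X - x%:P).

Definition deg (p : {poly R}) : nat := (size p).-1.

Definition poly_moment (p : {poly R}) (n : nat) : R :=
  (deg p)%:R^-1 * \sum_(x \in [set x | root p x]) x ^+ n *+ mup x p.

Definition ecoef (p : {poly R}) (k : nat) : R :=
  (-1) ^+ k * p`_(deg p - k) / 'C(deg p, k)%:R.

(* meaningful for 1 <= n <= deg p *)
Definition ffcumulant (p : {poly R}) (n : nat) : R :=
  (- (deg p)%:R) ^+ n.-1 / (n.-1)`!%:R *
  \sum_(P in set_partitions n)
     (-1) ^+ (#|P|.-1) * (#|P|.-1)`!%:R * \prod_(V in P) ecoef p #|V|.

Definition moment (mu : probability (measurableTypeR R) R) (n : nat) : R :=
  \int[mu]_x (x ^+ n).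

Definition infinitesimal_distribution (p : nat -> {poly R})
    (mu : probability (measurableTypeR R) R) (mu' : {scalar {poly R}}) : Prop :=
  [/\ forall n, mu.-integrable setT (fun x => (x ^+ n)%:E),
      forall n, poly_moment (p d) n @[d --> \oo] --> moment mu n,
      mu' 1 = 0 &
      forall n, (0 < n)%N ->
        d%:R * (poly_moment (p d) n - moment mu n) @[d --> \oo] --> mu' 'X^n].

(* [get] picks an element of a nonempty set; at most one c has this property. *)
Definition cumulant_fluctuation (p : nat -> {poly R})
    (mu : probability (measurableTypeR R) R) (n : nat) : R :=
  get [set c : R |
    (fun d : nat => ffcumulant (p d) n
                    - (free_cumulant (moment mu) n + d%:R^-1 * c))
    =o_\oo (fun d : nat => d%:R^-1 : R)].

End RealRooted.

(** * Formal Laurent series *)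

(* f : int -> R stands for the formal series \sum_k f_k z^k.  It is a Laurent
   series in z when [lbounded f].  The sums over [set: int] below are sums over
   the (finite) support of the summand, which is finite for Laurent series. *)
Section Laurent.
Variable R : realType.
Implicit Types f g : int -> R.

Definition lbounded f : Prop := exists N : int, forall k, k < N -> f k = 0.

Definition lmono (n : int) : int -> R := fun k => (k == n)%:R.

Definition lseries (u : nat -> R) : int -> R :=
  fun k => if k is Posz n then u n else 0.

Definition lmul f g : int -> R :=
  fun k => \sum_(i \in [set: int]) f i * g (k - i).

Definition lderiv f : int -> R := fun k => (k + 1)%:~R * f (k + 1).

(* the inverse of f in the field of formal Laurent series, for f nonzero *)
Definition linv f : int -> R :=
  get [set g | lbounded g /\ lmul f g = lmono 0].

Definition lpow f (k : int) : int -> R :=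
  match k with
  | Posz n => iter n (lmul f) (lmono 0)
  | Negz n => iter n.+1 (lmul (linv f)) (lmono 0)
  end.

(* \sum_j h_j f^j, where h is a series in 1/z: if f has a pole at 0 then, for
   each k, only finitely many f^j with j bounded above contribute to z^k. *)
Definition lcomp h f : int -> R :=
  fun k => \sum_(j \in [set: int]) h j * lpow f j k.

Variable mu : probability (measurableTypeR R) R.

Definition K_series : int -> R :=
  lmono (-1) \+ lseries (fun n => free_cumulant (moment mu) n.+1).

Definition Rinf_series (mu' : {scalar {poly R}}) : int -> R :=
  lseries (fun n =>
    inf_free_cumulant (moment mu) (fun k => mu' 'X^k) n.+1).

Definition Rhat_series (p : nat -> {poly R}) : int -> R :=
  lseries (fun n => cumulant_fluctuation p mu n.+1).

(* [Negz n] is - n - 1 *)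
Definition H_series : int -> R :=
  fun k => if k is Negz n then
             if (2 <= n)%N then annular_sum (free_cumulant (moment mu)) n else 0
           else 0.

End Laurent.

(* Main.v *)
Require Import Defs.
From HB Require Import structures.
From mathcomp Require Import all_boot all_order all_algebra all_fingroup.
From mathcomp Require Import zify ring.

Set Implicit Arguments.
Unset Strict Implicit.
Unset Printing Implicit Defensive.

Import Order.TTheory GRing.Theory Num.Theory.

Local Open Scope ring_scope.

(** Write [W(z) = 1 + r_1 z + r_2 z^2 + ...], so that [K = W / z], and put
    [U = W - z W'].  Then [K' = - U / z^2], and both formulas say that
    [Rinf - Rhat] is the series [T = - z W'' / (2 U) = K'' / (2 K') + 1 / z].

    Cumulants.  Let [p] have degree [d] and finite free cumulants [kappa_n].  By
    definition of its normalized coefficients, [p] is obtained from [x^d] by a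
    series in [D / d] where [D = d/dx], and the cumulants are the coefficients of
    the logarithm of this series.  Commuting it with the multiplication by [x] in
    [x D x^d = d x^d] yields [x p' / d = p + sum_n kappa_n (D / d)^n p].  Divided
    by [p] and written in [w = 1 / x], this is an equation
    [M = sum_n W_n w^n b_n] between the moment series [M] of [p] and the cumulant
    series [W], where [b_n] is [M^n] up to a derivation of size 1/d
    ([moment_series_equation], [moment_fps_equation]).  At order 0 it is the
    relation [M = W(w M)] that defines free cumulants ([nc_series_fixpoint]).  At
    order 1 it is the relation that defines infinitesimal free cumulants
    ([infinitesimal_equation]) plus the contribution of the derivation
    ([first_order_equation]).  With [y = w M] the latter is
    [- w^2 y' W''(y) / 2], and the implicit equation [y = w W(y)] turns it into
    [T] composed with [y] ([first_order_difference]).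

    Annular sums.  Apply the same equation to cumulants [r_n] that do not depend
    on [d].  The coefficients of [p] are then generated by pairs of permutations
    with a weight [- d] on each cycle, so by the exponential formula the moments
    are sums over pairs generating a transitive group ([perm_sum_orbit],
    [genus_series_equation]).  By the Euler inequality
    ([euler_inequality]) the terms of order 1/d come from pairs whose product has
    exactly two cycles, and counting the permutations with two cycles shows that
    they add up to minus the annular sums ([sum_two_cycles],
    [expands_genus_series]).  The equation at order 1 thus computes the series of
    annular sums; substituting [1 / K], the inverse of [y], gives
    [H(K) K' = T] ([annular_sum_inverse]).

    The sums over set partitions and over non-crossing partitions are handled by
    removing the block of the first point ([partition_sum_block],
    [nc_sum_next]). *)

(** * The Euler inequality for transitive pairs of permutations *)

Lemma gen_perm_invariant (T : finType) (U : eqType) (f : T -> U)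
    (A : {set {perm T}}) :
  (forall a, a \in A -> forall x, f (a x) = f x) ->
  forall a, a \in <<A>>%g -> forall x, f (a x) = f x.
Proof.
move=> fA; pose G := [set a : {perm T} | [forall x, f (a x) == f x]].
have gG : group_set G.
  apply/group_setP; split=> [|a b]; rewrite !inE.
    by apply/forallP => x; rewrite perm1.
  move=> /forallP fa /forallP fb; apply/forallP => x.
  by rewrite permM (eqP (fb _)) fa.
have sAG : (<<A>> \subset group gG)%g.
  rewrite gen_subG; apply/subsetP => a /fA fa; rewrite inE.
  by apply/forallP => x; rewrite fa.
by move=> a /(subsetP sAG); rewrite inE => /forallP fa x; apply/eqP.
Qed.

(** Transitivity is used only through the functions that it forces to be
    constant. *)
Lemma transitive_invariant (T : finType) (U : eqType) (f : T -> U)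
    (A : {set {perm T}}) :
  [transitive <<A>>%g, on [set: T] | 'P] ->
  (forall a, a \in A -> forall x, f (a x) = f x) -> forall x y, f x = f y.
Proof.
move=> trA fA x y.
have /orbitP[a aA <-] : y \in orbit 'P <<A>>%g x.
  by rewrite (atransP trA) ?inE.
by rewrite /= apermE (gen_perm_invariant fA).
Qed.

Section Euler.
Variable n : nat.
Implicit Types s t : {perm 'I_n}.

Lemma mul_perm_mxE m (K : 'M[rat]_(m, n)) s i j :
  (K *m perm_mx s) i (s j) = K i j.
Proof. by rewrite -[in perm_mx s](invgK s) -col_permE mxE permK. Qed.

(** The indicator vectors of the cycles are linearly independent and fixed by the
    permutation. *)
Lemma rank_perm_mx s : (\rank (1%:M - perm_mx s : 'M[rat]_n)%R + #|porbits s| <= n)%N.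
Proof.
pose C : 'M[rat]_(#|porbits s|, n) := \matrix_(i < #|porbits s|, j < n) (j \in (enum_val i : {set 'I_n}))%:R.
have porb (i : 'I_#|porbits s|) : {x | (enum_val i : {set 'I_n}) = porbit s x}.
  by apply: sig_eqW; have /imsetP[x _ ->] := enum_valP (i : 'I_#|porbits s|); exists x.
pose D : 'M[rat]_(n, #|porbits s|) := \matrix_(j, i) (j == sval (porb i))%:R.
have rC : \rank C = #|porbits s|.
  apply/eqP/row_freeP; exists D; apply/matrixP => i k; rewrite !mxE.
  rewrite (bigD1 (sval (porb k)))//= big1 ?addr0 => [|j jk]; last first.
    by rewrite !mxE (negbTE jk) mulr0.
  rewrite !mxE eqxx mulr1; congr (_%:R); rewrite -(inj_eq enum_val_inj).
  case: (porb i) (porb k) => x Ex [y Ey] /=.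
  by rewrite Ex Ey eq_sym eq_porbit_mem porbit_sym.
rewrite addnC -rC; apply: mulmx0_rank_max.
rewrite mulmxBr mulmx1; apply/eqP; rewrite subr_eq0; apply/eqP/matrixP => i j.
rewrite -[j](permKV s) mul_perm_mxE !mxE; case: (porb i) => x ->.
by have := porbit_perm s 1 (s^-1%g j); rewrite expg1 ![_ \in porbit s x]porbit_sym => ->.
Qed.

(** The row vectors fixed by both permutations are constant. *)
Lemma rank_invariant m (K : 'M[rat]_(m, n)) s t :
  [transitive <<[set s; t]>>%g, on [set: 'I_n] | 'P] ->
  K *m (1%:M - perm_mx s) = 0 -> K *m (1%:M - perm_mx t) = 0 ->
  (\rank K <= 1)%N.
Proof.
move=> tr Ks Kt.
have inv u : K *m (1%:M - perm_mx u) = 0 -> forall i j, K i (u j) = K i j.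
  rewrite mulmxBr mulmx1 => /eqP; rewrite subr_eq0 => /eqP E i j.
  by rewrite {1}E mul_perm_mxE.
apply: (@leq_trans (\rank (const_mx 1 : 'rV[rat]_n))); last exact: rank_leq_row.
apply: mxrankS; apply/row_subP => i.
case: n s t K tr Ks Kt inv => [|n'] s t K tr Ks Kt inv.
  by rewrite (_ : row i K = 0) ?sub0mx//; apply/matrixP => ? [].
apply/submxP; exists (K i ord0)%:M; apply/matrixP => k j.
rewrite mul_scalar_mx !mxE mulr1.
by apply: (transitive_invariant (f := K i) tr) => a /set2P[] -> x; apply: inv.
Qed.

(** Scott's argument.  The defects [X], [Y], [Z] of the permutation matrices [A],
    [B] and [A *m B] satisfy [X + A *m Y - Z = 0].  This relation factors as
    [beta *m delta = 0] through a space of dimension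
    [\rank X + \rank Y + \rank Z], and transitivity forces both factors to have
    corank at most 1. *)
Lemma euler_inequality s t : [transitive <<[set s; t]>>%g, on [set: 'I_n] | 'P] ->
  (#|porbits s| + #|porbits t| + #|porbits (s * t)%g| <= n + 2)%N.
Proof.
move=> tr.
pose A : 'M[rat]_n := perm_mx s; pose B : 'M[rat]_n := perm_mx t.
pose X := 1%:M - A; pose Y := 1%:M - B; pose Z : 'M[rat]_n := 1%:M - perm_mx (s * t).
pose beta := row_mx (col_base X) (row_mx (A *m col_base Y) (- col_base Z)).
pose delta := col_mx (row_base X) (col_mx (row_base Y) (row_base Z)).
have bd0 : beta *m delta = 0.
  rewrite !mul_row_col mulNmx !mulmx_base -mulmxA mulmx_base /Y /Z perm_mxM -/A -/B.
  by rewrite mulmxBr mulmx1 opprB /X !addrA !subrK subrr.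
have rb : (n <= (\rank beta).+1)%N.
  have kerb m (K : 'M_(m, n)) : K *m beta = 0 -> (\rank K <= 1)%N.
    rewrite mul_mx_row => /eqP; rewrite row_mx_eq0 => /andP[/eqP K1].
    rewrite mul_mx_row row_mx_eq0 => /andP[/eqP K2 _].
    have KX : K *m X = 0 by rewrite -(mulmx_base X) mulmxA K1 mul0mx.
    have KA : K *m A = K.
      by move/eqP: KX; rewrite /X mulmxBr mulmx1 subr_eq0 eq_sym => /eqP.
    apply: (rank_invariant tr KX).
    by rewrite -/B -/Y -(mulmx_base Y) mulmxA -KA -[_ *m A *m _]mulmxA K2 mul0mx.
  by have := kerb _ _ (mulmx_ker beta); rewrite mxrank_ker leq_subLR addn1.
have rd : (n <= (\rank delta).+1)%N.
  have kerd m (K : 'M_(m, n)) : K *m delta^T = 0 -> (\rank K <= 1)%N.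
    rewrite !tr_col_mx !mul_mx_row => /eqP.
    rewrite !row_mx_eq0 => /and3P[/eqP K1 /eqP K2 _].
    have KX : K *m X^T = 0 by rewrite -(mulmx_base X) trmx_mul mulmxA K1 mul0mx.
    have KY : K *m Y^T = 0 by rewrite -(mulmx_base Y) trmx_mul mulmxA K2 mul0mx.
    have trV : [transitive <<[set s^-1; t^-1]>>%g, on [set: 'I_n] | 'P].
      rewrite (_ : <<[set s^-1; t^-1]>>%g = <<[set s; t]>>%g)//.
      apply/eqP; rewrite eqEsubset !gen_subG !subUset !sub1set.
      apply/andP; split; first by rewrite !groupV !mem_gen ?inE ?eqxx ?orbT.
      by rewrite -(groupV _ s) -(groupV _ t) !mem_gen ?inE ?eqxx ?orbT.
    by apply: (rank_invariant trV); rewrite -tr_perm_mx -trmx1 -linearB.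
  by have := kerd _ _ (mulmx_ker _); rewrite mxrank_ker mxrank_tr leq_subLR addn1.
have := mulmx0_rank_max bd0.
have rs := rank_perm_mx s; have rt := rank_perm_mx t; have rst := rank_perm_mx (s * t).
rewrite -/A -/B -/X -/Y -/Z in rs rt rst.
move: rs rt rst rb rd; lia.
Qed.
End Euler.

(** * Cutting a pair of permutations along an orbit *)

Section Subsets.
Variables (R : nmodType) (T : finType).

Lemma sum_subsets (S : {set T}) (x0 : T) (phi : nat -> R) : x0 \in S ->
  \sum_(A : {set T} | (x0 \in A) && (A \subset S)) phi #|A| =
  \sum_(j < #|S|) phi j.+1 *+ 'C(#|S|.-1, j).
Proof.
move=> x0S.
have cS : #|S|.-1 = #|S :\ x0| by rewrite (cardsD1 x0 S) x0S.
rewrite (reindex_onto (fun A : {set T} => x0 |: A) (fun A => A :\ x0)); last first.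
  by move=> A /andP[x0A _]; rewrite setD1K.
transitivity (\sum_(A : {set T} | A \subset S :\ x0) phi #|A|.+1).
  apply: eq_big => A.
    rewrite setU11 /= subUset sub1set x0S /= subsetD1.
    case: (boolP (x0 \in A)) => x0A /=; last by rewrite setU1K// eqxx andbT.
    rewrite andbF; apply/negbTE; rewrite negb_and orbC; apply/orP; left.
    by apply/eqP => E; rewrite -E !inE eqxx in x0A.
  move=> /andP[_ /eqP E]; congr phi; rewrite cardsU1 -{1}E !inE eqxx //.
have -> : #|S| = #|S :\ x0|.+1 by rewrite (cardsD1 x0 S) x0S.
rewrite -cS /= cS.
rewrite (partition_big (fun A : {set T} => inord #|A| : 'I_#|S :\ x0|.+1) predT)//.
apply: eq_bigr => j _.
rewrite -cards_draws -sumr_const big_mkcond [RHS]big_mkcond.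
apply: eq_bigr => A _; rewrite inE.
case: (boolP (A \subset _)) => //= AS.
have cA : (#|A| < #|S :\ x0|.+1)%N by rewrite ltnS subset_leq_card.
rewrite -val_eqE /= inordK//.
by case: eqP => // ->.
Qed.

End Subsets.

Section Pairs.
Variable T : finType.
Implicit Types (s t u v : {perm T}) (A B S : {set T}) (x y : T).

Lemma astabs_permP A s :
  reflect (forall x, (s x \in A) = (x \in A)) (s \in ('N(A | 'P))%g).
Proof. by apply: (iffP astabsP) => h x; have := h x; rewrite /= apermE. Qed.

Definition group2_orbit s t x : {set T} := orbit 'P <<[set s; t]>>%g x.

(** A description of orbits that does not mention the generated group and is
    therefore easy to transfer from one pair of permutations to another. *)
Lemma group2_orbitP s t x A :
  reflect [/\ x \in A, s \in ('N(A | 'P))%g, t \in ('N(A | 'P))%g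
            & forall B, x \in B -> s \in ('N(B | 'P))%g -> t \in ('N(B | 'P))%g ->
              A \subset B]
          (group2_orbit s t x == A).
Proof.
set G := <<[set s; t]>>%g.
have sub B : x \in B -> s \in ('N(B | 'P))%g -> t \in ('N(B | 'P))%g ->
    group2_orbit s t x \subset B.
  move=> xB /astabs_permP sB /astabs_permP tB.
  apply/subsetP => y /orbitP[a aG <-]; rewrite /= apermE.
  rewrite (gen_perm_invariant (f := fun y => y \in B) _ aG)//.
  by move=> b /set2P[] ->.
have st b : b \in [set s; t] -> b \in ('N(group2_orbit s t x | 'P))%g.
  move=> /mem_gen bG; apply/astabs_permP => y.
  apply/orbitP/orbitP => -[a aG E].
    exists (a * b^-1)%g; first by rewrite groupM ?groupV.
    by rewrite actM E /= apermE permK.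
  by exists (a * b)%g; rewrite ?groupM// actM E.
apply: (iffP eqP) => [<-|[xA sA tA minA]].
  split=> //; first exact: orbit_refl.
    by apply: st; rewrite !inE eqxx.
  by apply: st; rewrite !inE eqxx orbT.
apply/eqP; rewrite eqEsubset sub//= minA//; first exact: orbit_refl.
  by apply: st; rewrite !inE eqxx.
by apply: st; rewrite !inE eqxx orbT.
Qed.

(** A head symbol of its own for the product, whose canonical instances depend on
    the way it is elaborated. *)
Definition perm_mul s t : {perm T} := (s * t)%g.

Lemma perm_mulE s t x : perm_mul s t x = t (s x). Proof. exact: permM. Qed.

Lemma perm_mulVK s t : perm_mul s (perm_mul s^-1%g t) = t.
Proof. by apply/permP => x; rewrite !perm_mulE permK. Qed.

Lemma perm_mulKV s t : perm_mul s^-1%g (perm_mul s t) = t.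
Proof. by apply/permP => x; rewrite !perm_mulE permKV. Qed.

Lemma perm_mul_on S s t : perm_on S s -> perm_on S t -> perm_on S (perm_mul s t).
Proof. exact: perm_onM. Qed.

Section Product.
Variables A B : {set T}.
Hypothesis AB : [disjoint A & B].
Variables s1 s2 : {perm T}.
Hypotheses (s1A : perm_on A s1) (s2B : perm_on B s2).

Let notAB x : x \in A -> x \notin B.
Proof. by move=> xA; rewrite (disjointFr AB xA). Qed.

Lemma mul_permA x : x \in A -> perm_mul s1 s2 x = s1 x.
Proof.
by move=> xA; rewrite perm_mulE (out_perm s2B)// notAB// (perm_closed _ s1A).
Qed.

Lemma mul_permB x : x \notin A -> perm_mul s1 s2 x = s2 x.
Proof. by move=> xA; rewrite perm_mulE (out_perm s1A). Qed.

Lemma mul_perm_astabs : perm_mul s1 s2 \in ('N(A | 'P))%g.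
Proof.
apply/astabs_permP => x; case: (boolP (x \in A)) => xA.
  by rewrite mul_permA// (perm_closed _ s1A).
rewrite mul_permB//; apply/negbTE; apply: contra xA => s2x.
have : s2 x \notin B by exact: notAB.
by rewrite (perm_closed _ s2B) => xB; rewrite (out_perm s2B xB) in s2x.
Qed.

Lemma restr_mul_perm : restr_perm A (perm_mul s1 s2) = s1.
Proof.
apply/permP => x; case: (boolP (x \in A)) => xA.
  by rewrite restr_permE ?mul_perm_astabs// mul_permA.
by rewrite (out_perm (restr_perm_on _ _))// (out_perm s1A).
Qed.

End Product.

Lemma perm_on_astabs A s : perm_on A s -> s \in ('N(A | 'P))%g.
Proof. by move=> sA; apply/astabs_permP => x; exact: perm_closed. Qed.

Lemma astabs_setI A B s u : (forall x, x \in A -> u x = s x) ->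
  u \in ('N(A | 'P))%g -> s \in ('N(A | 'P))%g ->
  s \in ('N(B | 'P))%g -> u \in ('N(A :&: B | 'P))%g.
Proof.
move=> us /astabs_permP uA /astabs_permP sA /astabs_permP sB.
apply/astabs_permP => x; rewrite !inE uA.
by case: (boolP (x \in A)) => //= xA; rewrite us// sB.
Qed.

Lemma orbit_eq_on A x s t u v :
  (forall y, y \in A -> u y = s y) -> (forall y, y \in A -> v y = t y) ->
  u \in ('N(A | 'P))%g -> v \in ('N(A | 'P))%g ->
  s \in ('N(A | 'P))%g -> t \in ('N(A | 'P))%g ->
  (group2_orbit s t x == A) = (group2_orbit u v x == A).
Proof.
move=> us vt uA vA sA tA.
have half s' t' u' v' : (forall y, y \in A -> u' y = s' y) ->
   (forall y, y \in A -> v' y = t' y) ->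
  u' \in ('N(A | 'P))%g -> v' \in ('N(A | 'P))%g ->
  s' \in ('N(A | 'P))%g -> t' \in ('N(A | 'P))%g ->
  group2_orbit s' t' x == A -> group2_orbit u' v' x == A.
  move=> us' vt' uA' vA' sA' tA' /group2_orbitP[xA _ _ minA].
  apply/group2_orbitP; split=> // B xB uB vB.
  apply: subset_trans (subsetIr A B); apply: minA; first by rewrite inE xA.
    by apply: (astabs_setI (s := u')) => // y yA; rewrite us'.
  by apply: (astabs_setI (s := v')) => // y yA; rewrite vt'.
by apply/idP/idP; apply: half => // y yA; rewrite ?us ?vt.
Qed.

Lemma porbit_eq_on A x s u : (forall y, y \in A -> u y = s y) ->
  s \in ('N(A | 'P))%g -> x \in A -> porbit u x = porbit s x.
Proof.
move=> us /astabs_permP sA xA.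
have E i : (u ^+ i)%g x = (s ^+ i)%g x /\ (s ^+ i)%g x \in A.
  elim: i => [|i [IH IHA]]; first by rewrite !expg0 perm1.
  by rewrite !expgSr !permM IH us// sA.
by apply/setP => y; apply/porbitP/porbitP => -[i ->]; exists i; case: (E i).
Qed.

Lemma porbit_sub A x s : s \in ('N(A | 'P))%g -> x \in A -> porbit s x \subset A.
Proof.
move=> /astabs_permP sA xA; apply/subsetP => y /porbitP[i ->].
by elim: i => [|i IH]; rewrite ?expg0 ?perm1// expgSr permM sA.
Qed.

Variable R : comNzRingType.
Implicit Types f g : nat -> R.

Definition cycle_weight f S s : R := \prod_(c in porbit s @: S) f #|c|.

Lemma cycle_weight_eq_on f A s u : (forall y, y \in A -> u y = s y) ->
  s \in ('N(A | 'P))%g -> cycle_weight f A u = cycle_weight f A s.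
Proof.
move=> us sA; rewrite /cycle_weight (_ : porbit u @: A = porbit s @: A)//.
by apply: eq_in_imset => x xA; apply: porbit_eq_on sA xA.
Qed.

Lemma cycle_weightU f A B s : [disjoint A & B] ->
  s \in ('N(A | 'P))%g -> s \in ('N(B | 'P))%g ->
  cycle_weight f (A :|: B) s = cycle_weight f A s * cycle_weight f B s.
Proof.
move=> AB sA sB; rewrite /cycle_weight imsetU.
rewrite (eq_bigl [predU (porbit s @: A) & (porbit s @: B)]); last first.
  by move=> c; rewrite !inE.
rewrite bigU//; rewrite -setI_eq0; apply/eqP/setP => c; rewrite !inE.
apply/negbTE/andP => -[/imsetP[x xA ->] /imsetP[y yB E]].
have xB : x \in B.
  by apply: (subsetP (porbit_sub sB yB)); rewrite -E porbit_id.
by rewrite (disjointFr AB xA) in xB.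
Qed.

Definition perm_sum f S : R := \sum_(s | perm_on S s) cycle_weight f S s.

Definition connected_sum f g A : R :=
  \sum_(p : {perm T} * {perm T} | [&& perm_on A p.1, perm_on A p.2 &
            [transitive <<[set p.1; p.2]>>%g, on A | 'P]])
     cycle_weight f A p.1 * cycle_weight g A p.2.

Lemma transitive_orbit A x s t : x \in A ->
  [transitive <<[set s; t]>>%g, on A | 'P] = (group2_orbit s t x == A).
Proof.
move=> xA; apply/idP/eqP => [tr|<-]; first by apply: (atransP tr).
by apply/imsetP; exists x => //; rewrite /group2_orbit orbit_refl.
Qed.

(** The exponential formula: cutting a pair of permutations of [S] along the orbit
    [A] of [x0] leaves a connected pair on [A] and an arbitrary pair on the
    rest. *)
Lemma perm_sum_orbit f g S x0 : x0 \in S ->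
  perm_sum f S * perm_sum g S =
  \sum_(A : {set T} | (x0 \in A) && (A \subset S))
     connected_sum f g A * (perm_sum f (S :\: A) * perm_sum g (S :\: A)).
Proof.
move=> x0S.
have pairE S' : perm_sum f S' * perm_sum g S' =
    \sum_(p : {perm T} * {perm T} | perm_on S' p.1 && perm_on S' p.2)
       cycle_weight f S' p.1 * cycle_weight g S' p.2.
  rewrite /perm_sum big_distrl /=; under eq_bigr do rewrite big_distrr /=.
  by rewrite pair_big.
rewrite pairE (partition_big (fun p => group2_orbit p.1 p.2 x0)
  (fun A => (x0 \in A) && (A \subset S))) /=; last first.
  move=> [s t] /= /andP[sS tS]; rewrite orbit_refl /=.
  have /group2_orbitP[_ _ _] := eqxx (group2_orbit s t x0).
  by apply=> //; exact: perm_on_astabs.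
apply: eq_bigr => A /andP[x0A AS].
rewrite pairE /connected_sum big_distrl /=; under [RHS]eq_bigr do rewrite big_distrr /=.
rewrite pair_big /=.
have dAS : [disjoint A & S :\: A].
  by rewrite -setI_eq0; apply/eqP/setP => x; rewrite !inE; case: (x \in A).
have SE : S = A :|: (S :\: A).
  by apply/setP => x; rewrite !inE; case: (boolP (x \in A)) => //= /(subsetP AS).
pose h (q : ({perm T} * {perm T}) * ({perm T} * {perm T})) :=
  (perm_mul q.1.1 q.2.1, perm_mul q.1.2 q.2.2).
pose h' (p : {perm T} * {perm T}) :=
  ((restr_perm A p.1, restr_perm A p.2),
   (perm_mul (restr_perm A p.1)^-1%g p.1, perm_mul (restr_perm A p.2)^-1%g p.2)).
rewrite (reindex_onto h h'); last by move=> [s t] _; rewrite /h /h' /= !perm_mulVK.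
have restr_compl s : perm_on S s -> s \in ('N(A | 'P))%g ->
    perm_on (S :\: A) (perm_mul (restr_perm A s)^-1%g s).
  move=> sS sA; apply/subsetP => x; rewrite !inE perm_mulE => sx.
  case: (boolP (x \in A)) sx => xA /=.
    have -> : (restr_perm A s)^-1%g x = s^-1%g x.
      apply: (perm_inj (s := restr_perm A s)); rewrite permKV restr_permE ?permKV//.
      by rewrite -[x](permKV s) (astabs_permP _ _ sA) permKV in xA *.
    by rewrite permKV eqxx.
  rewrite (out_perm (perm_onV (restr_perm_on _ _)))//.
  by move=> sx; apply: (subsetP sS); rewrite inE.
apply: eq_big => [[[s1 t1] [s2 t2]]|[[s1 t1] [s2 t2]]]; rewrite /h /h' /=.
  apply/idP/idP.
    move: (perm_mul s1 s2) (perm_mul t1 t2) => s t.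
    move=> /andP[/andP[/andP[sS tS] orbA] /eqP[<- <- <- <-]].
    have /group2_orbitP[_ sA tA _] := orbA.
    rewrite !restr_perm_on !restr_compl// (transitive_orbit _ _ x0A) /= andbT.
    rewrite (orbit_eq_on _ (u := s) (v := t)) ?(eqP orbA)//;
      do ?[exact: perm_on_astabs (restr_perm_on _ _)];
      by move=> y yA; rewrite restr_permE.
  move=> /andP[/and3P[s1A t1A tr] /andP[s2S t2S]].
  have sA := mul_perm_astabs dAS s1A s2S; have tA := mul_perm_astabs dAS t1A t2S.
  have sub u : perm_on A u -> perm_on S u by move=> uA; apply: subset_trans AS.
  have sub' u : perm_on (S :\: A) u -> perm_on S u.
    by move=> uA; apply: subset_trans uA (subsetDl _ _).
  have E1 : restr_perm A (perm_mul s1 s2) = s1 by exact: (restr_mul_perm dAS s1A s2S).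
  have E2 : restr_perm A (perm_mul t1 t2) = t1 by exact: (restr_mul_perm dAS t1A t2S).
  rewrite (perm_mul_on (sub _ s1A) (sub' _ s2S)) (perm_mul_on (sub _ t1A) (sub' _ t2S)) /=.
  rewrite E1 E2 !perm_mulKV eqxx andbT.
  rewrite (transitive_orbit _ _ x0A) in tr.
  rewrite -(@orbit_eq_on A x0 s1 t1 (perm_mul s1 s2) (perm_mul t1 t2))//;
    do ?[exact: perm_on_astabs]; by move=> y yA; apply: (mul_permA dAS).
move=> /andP[/andP[/andP[sS tS] orbA] /eqP[Es1 Et1 Es2 Et2]].
have /group2_orbitP[_ sA tA _] := orbA.
have s1A : perm_on A s1 by rewrite -Es1 restr_perm_on.
have t1A : perm_on A t1 by rewrite -Et1 restr_perm_on.
have s2S : perm_on (S :\: A) s2 by rewrite -Es2 restr_compl.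
have t2S : perm_on (S :\: A) t2 by rewrite -Et2 restr_compl.
have weightE f' u1 u2 : perm_on A u1 -> perm_on (S :\: A) u2 ->
    cycle_weight f' S (perm_mul u1 u2) =
    cycle_weight f' A u1 * cycle_weight f' (S :\: A) u2.
  move=> u1A u2S; have uA := mul_perm_astabs dAS u1A u2S.
  have onSA y : y \in S :\: A -> (perm_mul u1 u2) y = u2 y.
    by rewrite inE => /andP[yA _]; apply: (mul_permB u2 u1A).
  have uSA : (perm_mul u1 u2) \in ('N(S :\: A | 'P))%g.
    apply/astabs_permP => y; case: (boolP (y \in A)) => yA.
      by rewrite !inE (astabs_permP _ _ uA) yA.
    by rewrite (mul_permB u2 u1A yA) (perm_closed _ u2S).
  rewrite {1}SE cycle_weightU//; congr (_ * _); apply: cycle_weight_eq_on => //.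
  - by move=> y; apply: (mul_permA dAS).
  - exact: perm_on_astabs.
  - exact: perm_on_astabs.
by rewrite !weightE//; ring.
Qed.

End Pairs.

(** * Exponential formulas for permutations *)

(** Under this weight only the identity counts, which reduces pairs of
    permutations to single permutations. *)
Definition indicator1 (R : comNzRingType) (n : nat) : R := (n == 1%N)%:R.

Section FullCycles.
Variables (T : finType).
Implicit Types (s : {perm T}) (A S : {set T}) (x : T).

Lemma porbit_perm1 x : porbit (1%g : {perm T}) x = [set x].
Proof.
apply/setP => y; rewrite inE; apply/porbitP/eqP => [[i ->]|->].
  by rewrite expg1n perm1.
by exists 0%N; rewrite perm1.
Qed.

(** The permutations that form a connected pair with the identity. *)
Definition full_cycles A : nat :=
  #|[set s : {perm T} | perm_on A s & [transitive <<[set s; 1%g]>>%g, on A | 'P]]|.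

Lemma transitive_porbit A s x : perm_on A s ->
  [transitive <<[set s; 1%g]>>%g, on A | 'P] -> x \in A -> porbit s x = A.
Proof.
move=> sA tr xA; have sN := perm_on_astabs sA.
apply/eqP; rewrite eqEsubset porbit_sub//=.
rewrite (transitive_orbit _ _ xA) in tr; have /group2_orbitP[_ _ _ minA] := tr.
apply: minA; first exact: porbit_id.
  apply/astabs_permP => y; rewrite ![_ \in porbit s x]porbit_sym.
  by have := porbit_perm s 1 y; rewrite expg1 => ->.
by apply/astabs_permP => y; rewrite perm1.
Qed.

Variable (R : comNzRingType).
Implicit Types f g : nat -> R.

Lemma cycle_weight_delta1 S s : perm_on S s ->
  cycle_weight (indicator1 R) S s = (s == 1%g)%:R.
Proof.
move=> sS; case: (eqVneq s 1%g) => [->|s1].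
  rewrite /cycle_weight big1// => c /imsetP[x _ ->].
  by rewrite porbit_perm1 cards1.
have [x sx] : exists x, s x != x.
  apply/existsP; apply: contraNT s1; rewrite negb_exists => /forallP h.
  by apply/eqP/permP => x; rewrite perm1; apply/eqP; have := h x; rewrite negbK.
have xS : x \in S by apply: (subsetP sS); rewrite inE.
rewrite /cycle_weight (bigD1 (porbit s x)) ?imset_f//= [X in X * _](_ : _ = 0) ?mul0r//.
rewrite /indicator1; case: eqP => // /eqP/cards1P[y E].
have := porbit_id s x; have := mem_porbit s 1 x.
by rewrite expg1 E !inE => /eqP sxy /eqP xy; rewrite sxy -xy eqxx in sx.
Qed.

Lemma perm_sum_delta1 S : perm_sum (indicator1 R) S = 1.
Proof.
rewrite /perm_sum (bigD1 1%g) ?perm_on1//= big1 ?addr0 => [|s /andP[sS s1]].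
  by rewrite cycle_weight_delta1 ?perm_on1// eqxx.
by rewrite cycle_weight_delta1// (negbTE s1).
Qed.

Lemma connected_sum_delta1 f A : A != set0 ->
  connected_sum f (indicator1 R) A = f #|A| *+ full_cycles A.
Proof.
move=> /set0Pn[x xA]; rewrite /full_cycles -sumr_const.
rewrite /connected_sum (bigID (fun p => p.2 == 1%g)) /= [X in _ + X]big1 ?addr0; last first.
  move=> p /andP[/and3P[_ p2A _] p21].
  by rewrite cycle_weight_delta1// (negbTE p21) mulr0.
rewrite (reindex_onto (fun s => (s, 1%g)) fst)/=; last first.
  by move=> [s t] /andP[_ /eqP /= ->].
apply: eq_big => [s|s /andP[/andP[/and3P[sA _ tr] _] _]].
  by rewrite inE perm_on1 !eqxx !andbT.
rewrite cycle_weight_delta1 ?perm_on1// eqxx mulr1 /cycle_weight.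
have -> : porbit s @: A = [set A].
  apply/setP => c; rewrite inE; apply/imsetP/eqP => [[y yA ->]|->].
    exact: transitive_porbit.
  by exists x => //; rewrite (transitive_porbit sA tr).
by rewrite big_set1.
Qed.

Lemma perm_sum_set0 f : perm_sum f (set0 : {set T}) = 1.
Proof.
rewrite /perm_sum (eq_bigr (fun=> 1)) => [|s _].
  by rewrite sumr_const card_perm cards0.
by rewrite /cycle_weight imset0 big_set0.
Qed.

Lemma perm_sum_cycle f S x : x \in S ->
  perm_sum f S = \sum_(A : {set T} | (x \in A) && (A \subset S))
     f #|A| *+ full_cycles A * perm_sum f (S :\: A).
Proof.
move=> xS; rewrite -[LHS]mulr1 -(perm_sum_delta1 S) (perm_sum_orbit _ _ xS).
apply: eq_bigr => A /andP[xA AS]; rewrite perm_sum_delta1 mulr1.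
by rewrite connected_sum_delta1//; apply/set0Pn; exists x.
Qed.

End FullCycles.

Lemma card_setDS (T : finType) (A S : {set T}) : A \subset S -> #|S :\: A| = (#|S| - #|A|)%N.
Proof. by move=> AS; rewrite cardsD (setIidPr AS). Qed.

Lemma perm_sum_ones (R : comNzRingType) (T : finType) (S : {set T}) :
  perm_sum (fun=> 1 : R) S = (#|S|`!)%:R.
Proof.
rewrite /perm_sum (eq_bigr (fun=> 1)) => [|s _]; first by rewrite sumr_const card_perm.
by rewrite /cycle_weight big1.
Qed.

(** With all weights equal to 1 the exponential formula counts the n! permutations,
    and this determines the number of full cycles by induction. *)
Lemma card_full_cycles (T : finType) (A : {set T}) :
  A != set0 -> full_cycles A = (#|A|.-1)`!.
Proof.
have [n] := ubnP #|A|; elim: n => // n IH in A *; rewrite ltnS => An A0.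
have [x xA] := set0Pn _ A0.
have := perm_sum_cycle (fun=> 1 : int) xA; rewrite perm_sum_ones.
pose g k : int := ((k.-1)`! * (#|A| - k)`!)%:R.
have -> : \sum_(B : {set T} | (x \in B) && (B \subset A))
     1 *+ full_cycles B * perm_sum (fun=> 1 : int) (A :\: B) =
   (full_cycles A)%:R - g #|A| + \sum_(B : {set T} | (x \in B) && (B \subset A)) g #|B|.
  rewrite (bigD1 A) ?xA//= [in RHS](bigD1 A) ?xA//= setDv perm_sum_set0 mulr1.
  rewrite addrA subrK; congr (_ + _); apply: eq_bigr => B /andP[/andP[xB BA] BnA].
  have BA' : B \proper A by rewrite properEneq BnA.
  rewrite perm_sum_ones card_setDS// IH; first by rewrite /g natrM.
    by exact: leq_trans (proper_card BA') An.
  by apply/set0Pn; exists x.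
rewrite sum_subsets//.
have An0 : (0 < #|A|)%N by rewrite card_gt0.
have -> : \sum_(j < #|A|) g j.+1 *+ 'C(#|A|.-1, j) = (#|A|`!)%:R.
  rewrite (eq_bigr (fun=> ((#|A|.-1)`!)%:R)) => [|j _].
    by rewrite sumr_const card_ord -mulrnA mulnC -{1}(prednK An0) -factS prednK.
  rewrite /g -mulrnA -[RHS]/(((#|A|.-1)`!)%:R); congr (_%:R).
  have jA : (j <= #|A|.-1)%N by rewrite -ltnS prednK.
  rewrite -(bin_fact jA) mulnC; congr (_ * (_ * _`!))%N; lia.
rewrite /g subnn fact0 muln1 => /eqP; rewrite eq_sym -subr_eq0 addrK subr_eq0.
by rewrite eqr_nat => /eqP.
Qed.

Section Numbers.
Variable R : comNzRingType.
Implicit Types f g : nat -> R.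

Definition perm_total f n : R := perm_sum f [set: 'I_n].
Definition connected_total f g n : R := connected_sum f g [set: 'I_n].

(** Induction along [perm_sum_cycle] dispenses with a transport of permutations
    from one type to another. *)
Lemma perm_sum_card f (T : finType) (S : {set T}) : perm_sum f S = perm_total f #|S|.
Proof.
have [n] := ubnP #|S|; elim: n => // n IH in T S *; rewrite ltnS => Sn.
case: (set_0Vmem S) => [->|[x xS]].
  by rewrite cards0 /perm_total (_ : [set: 'I_0] = set0) ?perm_sum_set0//; apply/setP => -[].
have step (T' : finType) (S' : {set T'}) y : y \in S' -> #|S'| = #|S| ->
    perm_sum f S' = \sum_(j < #|S|)
      (f j.+1 *+ (j`!) * perm_total f (#|S| - j.+1)) *+ 'C(#|S|.-1, j).
  move=> yS' SS'; rewrite (perm_sum_cycle _ yS').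
  rewrite -SS' -(sum_subsets (fun k => f k *+ (k.-1)`! * perm_total f (#|S'| - k)) yS').
  apply: eq_bigr => A /andP[yA AS].
  have A0 : (0 < #|A|)%N by rewrite card_gt0; apply/set0Pn; exists y.
  rewrite card_full_cycles -?card_gt0// IH ?card_setDS//.
  rewrite SS'; apply: leq_trans _ Sn.
  by rewrite ltn_subrL A0 -SS' (leq_trans A0)// subset_leq_card.
have S0 : (0 < #|S|)%N by rewrite card_gt0; apply/set0Pn; exists x.
by rewrite (step _ _ _ xS)// /perm_total (step _ _ (Ordinal S0))// ?inE// cardsT card_ord.
Qed.

Lemma perm_total0 f : perm_total f 0 = 1.
Proof. by rewrite -(cards0 'I_1) -perm_sum_card perm_sum_set0. Qed.

Lemma perm_totalS f n : perm_total f n.+1 =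
  \sum_(j < n.+1) (f j.+1 *+ j`! * perm_total f (n - j)) *+ 'C(n, j).
Proof.
have := sum_subsets (fun k => f k *+ (k.-1)`! * perm_total f (n.+1 - k)) (in_setT (ord0 : 'I_n.+1)).
rewrite cardsT card_ord /= => <-; rewrite /perm_total (perm_sum_cycle _ (in_setT ord0)).
apply: eq_bigr => A /andP[yA AS].
rewrite card_full_cycles ?(perm_sum_card f (_ :\: _)) ?card_setDS ?cardsT ?card_ord//.
by apply/set0Pn; exists ord0.
Qed.

Lemma connected_sum_card f g (T : finType) (S : {set T}) : S != set0 ->
  connected_sum f g S = connected_total f g #|S|.
Proof.
have [n] := ubnP #|S|; elim: n => // n IH in T S *; rewrite ltnS => Sn.
move=> /set0Pn[x xS].
pose G N k := connected_total f g k * (perm_total f (N - k) * perm_total g (N - k)).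
have step (T' : finType) (S' : {set T'}) y : y \in S' -> #|S'| = #|S| ->
    connected_sum f g S' = perm_total f #|S| * perm_total g #|S| -
      \sum_(A : {set T'} | (y \in A) && (A \subset S')) G #|S| #|A| + G #|S| #|S|.
  move=> yS' SS'; rewrite [X in _ - X](bigD1 S') ?yS' ?subxx//=.
  rewrite -{1 2}SS' -!perm_sum_card (perm_sum_orbit _ _ yS') (bigD1 S') ?yS' ?subxx//=.
  rewrite setDv !perm_sum_set0 !mulr1 SS' (eq_bigr (fun A : {set T'} => G #|S| #|A|)); first by ring.
  move=> A /andP[/andP[yA AS] AnS].
  have AS' : A \proper S' by rewrite properEneq AnS.
  rewrite /G -SS' -card_setDS// !perm_sum_card; congr (_ * _); rewrite IH//.
    by apply: leq_trans _ Sn; rewrite -SS'; apply: proper_card.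
  by apply/set0Pn; exists y.
have S0 : (0 < #|S|)%N by rewrite card_gt0; apply/set0Pn; exists x.
rewrite (step _ _ _ xS)// /connected_total (step _ _ (Ordinal S0))// ?inE ?cardsT ?card_ord//.
by rewrite !sum_subsets ?inE// cardsT card_ord.
Qed.

Lemma connected_totalS f g n : perm_total f n.+1 * perm_total g n.+1 =
  \sum_(j < n.+1) (connected_total f g j.+1 * (perm_total f (n - j) * perm_total g (n - j))) *+ 'C(n, j).
Proof.
have := sum_subsets (fun k => connected_total f g k * (perm_total f (n.+1 - k) * perm_total g (n.+1 - k)))
  (in_setT (ord0 : 'I_n.+1)).
rewrite cardsT card_ord /= => <-; rewrite /perm_total (perm_sum_orbit _ _ (in_setT ord0)).
apply: eq_bigr => A /andP[yA AS].
rewrite connected_sum_card ?(perm_sum_card _ (_ :\: _)) ?card_setDS ?cardsT ?card_ord//.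
by apply/set0Pn; exists ord0.
Qed.

End Numbers.

(** * Permutations with two cycles and annular non-crossing permutations *)

Lemma group2_mulV (gT : finGroupType) (a b : gT) :
  (<<[set a; a * b]>> = <<[set a; b]>>)%g.
Proof.
apply/eqP; rewrite eqEsubset !gen_subG !subUset !sub1set.
have aG c : a \in <<[set a; c]>>%g by rewrite mem_gen ?inE ?eqxx.
have bG c : c \in <<[set a; c]>>%g by rewrite mem_gen ?inE ?eqxx ?orbT.
have bab : b \in <<[set a; a * b]>>%g by rewrite -{1}(mulKg a b) groupM ?groupV ?aG ?bG.
by rewrite !aG bab groupM ?aG ?bG.
Qed.

(** For the standard annular permutation [c] this is the sum over [SNC]; stated over
    any finite type, it can be transported along bijections. *)
Definition planar_sum (R : comNzRingType) (r : nat -> R) (T : finType) (c : {perm T}) : R :=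
  \sum_(g : {perm T} | [transitive <<[set g; c]>>%g, on [set: T] | 'P] &&
     (#|porbits g| + #|porbits (g^-1 * c)%g| == #|T|))
   \prod_(b in porbits g) r #|b|.

Section Conjugation.
Variables (T T' : finType) (h : T -> T') (h' : T' -> T).
Hypotheses (hK : cancel h h') (h'K : cancel h' h).
Implicit Types g : {perm T}.

Lemma conj_perm_inj g : injective (fun x => h (g (h' x))).
Proof. by move=> x y /(can_inj hK) /perm_inj /(can_inj h'K). Qed.

Definition conj_perm g : {perm T'} := perm (@conj_perm_inj g).

Lemma conj_permE g x : conj_perm g x = h (g (h' x)).
Proof. by rewrite permE. Qed.

Lemma conj_permEh g x : conj_perm g (h x) = h (g x).
Proof. by rewrite conj_permE hK. Qed.

Lemma conj_permM g k : conj_perm (g * k)%g = (conj_perm g * conj_perm k)%g.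
Proof. by apply/permP => x; rewrite permM !conj_permE hK permM. Qed.

Lemma conj_permV g : conj_perm g^-1%g = (conj_perm g)^-1%g.
Proof.
apply: (mulgI (conj_perm g)); rewrite mulgV -conj_permM mulgV.
by apply/permP => x; rewrite conj_permE !perm1 h'K.
Qed.

Lemma porbit_conj g x : porbit (conj_perm g) (h x) = h @: porbit g x.
Proof.
have E i y : (conj_perm g ^+ i)%g (h y) = h ((g ^+ i)%g y).
  elim: i => [|i IH]; first by rewrite !expg0 !perm1.
  by rewrite !expgSr !permM IH conj_permEh.
apply/setP => y; apply/porbitP/imsetP => [[i ->]|[z /porbitP[i ->] ->]].
  by exists ((g ^+ i)%g x); rewrite ?mem_porbit// E.
by exists i; rewrite E.
Qed.

Lemma porbits_conj g : porbits (conj_perm g) = [set h @: c | c : {set T} in porbits g].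
Proof.
apply/setP => c; apply/imsetP/imsetP => [[x _ ->]|[d /imsetP[x _ ->] ->]].
  exists (porbit g (h' x)); first exact: imset_f.
  by rewrite -porbit_conj h'K.
by exists (h x); rewrite ?porbit_conj.
Qed.

Let hI : injective h := can_inj hK.

Lemma card_porbits_conj g : #|porbits (conj_perm g)| = #|porbits g|.
Proof. by rewrite porbits_conj card_imset//; apply: imset_inj. Qed.

Lemma prod_porbits_conj (R : comNzRingType) (r : nat -> R) g :
  \prod_(c in porbits (conj_perm g)) r #|c| = \prod_(c in porbits g) r #|c|.
Proof.
rewrite porbits_conj big_imset/=; last by move=> ? ? _ _; apply: imset_inj.
by apply: eq_bigr => c _; rewrite card_imset.
Qed.

Lemma transitive_conj g k :
  [transitive <<[set g; k]>>%g, on [set: T] | 'P] ->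
  [transitive <<[set conj_perm g; conj_perm k]>>%g, on [set: T'] | 'P].
Proof.
move=> tr; have /imsetP[x _ _] := tr.
rewrite (transitive_orbit _ _ (in_setT x)) in tr.
have /group2_orbitP[_ _ _ minT] := tr.
rewrite (transitive_orbit _ _ (in_setT (h x))); apply/group2_orbitP; split.
- by [].
- by apply/astabs_permP => y; rewrite !inE.
- by apply/astabs_permP => y; rewrite !inE.
move=> B hxB /astabs_permP gB /astabs_permP kB.
have /subsetP sub : [set: T] \subset h @^-1: B.
  apply: minT; first by rewrite inE.
    by apply/astabs_permP => y; rewrite !inE -conj_permEh gB.
  by apply/astabs_permP => y; rewrite !inE -conj_permEh kB.
by apply/subsetP => y _; have := sub (h' y); rewrite !inE h'K; apply.
Qed.

End Conjugation.

Lemma planar_sum_conj (R : comNzRingType) (r : nat -> R) (T T' : finType)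
    (h : T -> T') (c : {perm T}) (c' : {perm T'}) :
  bijective h -> (forall x, h (c x) = c' (h x)) -> planar_sum r c = planar_sum r c'.
Proof.
move=> [h' hK h'K] hc.
have -> : c' = conj_perm hK h'K c.
  by apply/permP => x; rewrite conj_permE hc h'K.
have conjK g : conj_perm h'K hK (conj_perm hK h'K g) = g.
  by apply/permP => x; rewrite !conj_permE !hK.
have conjK' g : conj_perm hK h'K (conj_perm h'K hK g) = g.
  by apply/permP => x; rewrite !conj_permE !h'K.
rewrite /planar_sum [RHS](reindex_onto (conj_perm hK h'K) (conj_perm h'K hK)) //.
have cT : #|T'| = #|T| by apply: bij_eq_card; exists h.
apply: eq_big => g; last by move=> _; rewrite prod_porbits_conj.
rewrite conjK eqxx andbT -conj_permV -conj_permM !card_porbits_conj cT.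
congr (_ && _); apply/idP/idP; first exact: transitive_conj.
by move/(transitive_conj h'K hK); rewrite !conjK.
Qed.

Section TwoCycles.
Variables (R : numFieldType) (r : nat -> R) (T : finType).
Implicit Types (c : {perm T}).

Lemma sum_inv_porbit c : \sum_x (#|porbit c x|%:R)^-1 = (#|porbits c|%:R : R).
Proof.
rewrite (partition_big (porbit c) (fun b => b \in porbits c)) /=; last first.
  by move=> x _; apply: imset_f.
rewrite -sumr_const; apply: eq_bigr => b /imsetP[x _ ->].
rewrite (eq_bigr (fun=> (#|porbit c x|%:R)^-1)) => [|y /eqP -> //].
rewrite sumr_const (@eq_card _ _ (porbit c x)) => [|y]; last first.
  by rewrite -[LHS]/(porbit c y == porbit c x) eq_porbit_mem.
by rewrite -[LHS]mulr_natl mulfV// pnatr_eq0 card_porbit_neq0.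
Qed.

(** The identifications of the standard annular permutation with [c]. *)
Definition annular_labelings t s c : {set {ffun 'I_(t + s) -> T}} :=
  [set h : {ffun 'I_(t + s) -> T} | injectiveb h &
     [forall i, h (annular_perm t s i) == c (h i)]].

Section Labelings.
Variables (t s : nat).
Hypothesis cardT : #|T| = (t.+1 + s.+1)%N.
Let i0 : 'I_(t.+1 + s.+1) := lshift s.+1 ord0.
Let j0 : 'I_(t.+1 + s.+1) := rshift t.+1 ord0.

Lemma annular_lshift (i : 'I_t.+1) : annular_perm t.+1 s.+1 (lshift s.+1 i) = lshift s.+1 (ordS i).
Proof.
rewrite permE /annular_fun; case: splitP => j E.
  by congr (lshift _ (ordS _)); apply: val_inj; move: E => /= ->.
by have := ltn_ord i; rewrite /= in E; rewrite E ltnNge leq_addr.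
Qed.

Lemma annular_rshift (i : 'I_s.+1) : annular_perm t.+1 s.+1 (rshift t.+1 i) = rshift t.+1 (ordS i).
Proof.
rewrite permE /annular_fun; case: splitP => j E.
  by have := ltn_ord j; rewrite -E /= ltnNge leq_addr.
by congr (rshift _ (ordS _)); apply: val_inj; move: E => /= /addnI.
Qed.

Definition start_labeling c x y : {ffun 'I_(t.+1 + s.+1) -> T} :=
  [ffun i => match split i with
             | inl j => (c ^+ j)%g x
             | inr j => (c ^+ j)%g y
             end].

Lemma start_labeling_lshift c x y j : start_labeling c x y (lshift s.+1 j) = (c ^+ j)%g x.
Proof.
rewrite ffunE; case: splitP => k /= E; first by rewrite -E.
by have := ltn_ord j; rewrite E ltnNge leq_addr.
Qed.

Lemma start_labeling_rshift c x y j : start_labeling c x y (rshift t.+1 j) = (c ^+ j)%g y.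
Proof.
rewrite ffunE; case: splitP => k /= E; last by move/addnI: E => ->.
by have := ltn_ord k; rewrite -E ltnNge leq_addr.
Qed.

Lemma pow_porbit_inj c x i j : (i < #|porbit c x|)%N -> (j < #|porbit c x|)%N ->
  (c ^+ i)%g x = (c ^+ j)%g x -> i = j.
Proof.
move=> ix jx; rewrite !permX => E; apply/eqP.
rewrite -(nth_uniq x _ _ (uniq_traject_porbit c x)) ?size_traject//.
by rewrite !nth_traject// E.
Qed.

Lemma pow_ordS n c x (j : 'I_n) : #|porbit c x| = n ->
  (c ^+ ordS j)%g x = c ((c ^+ j)%g x).
Proof.
move=> cn; rewrite -permM -expgSr /=; have := ltn_ord j; rewrite leq_eqVlt.
case/orP => [/eqP jn|jn]; last by rewrite modn_small.
by rewrite jn modnn expg0 perm1 permX -cn iter_porbit.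
Qed.

Section FromLabeling.
Variables (c : {perm T}) (h : {ffun 'I_(t.+1 + s.+1) -> T}).
Hypothesis hc : h \in annular_labelings t.+1 s.+1 c.

Let hI : injective h. Proof. by move: hc; rewrite inE => /andP[/injectiveP]. Qed.
Let hE i : h (annular_perm t.+1 s.+1 i) = c (h i).
Proof. by move: hc; rewrite inE => /andP[_ /forallP/(_ i)/eqP]. Qed.

Lemma pow_labeling n (f : 'I_n.+1 -> T) : (forall i, f (ordS i) = c (f i)) ->
  forall i : 'I_n.+1, f i = (c ^+ i)%g (f ord0).
Proof.
move=> fS [i]; elim: i => [|i IH] ilt /=.
  by rewrite perm1; congr f; apply: val_inj.
rewrite expgSr permM -(IH (ltnW ilt)) -fS; congr f; apply: val_inj => /=.
by rewrite modn_small.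
Qed.

Lemma porbit_labeling n (f : 'I_n.+1 -> T) : (forall i, f (ordS i) = c (f i)) ->
  porbit c (f ord0) = [set f i | i : 'I_n.+1].
Proof.
move=> fS; apply/setP => z; apply/porbitP/imsetP => [[k ->]|[i _ ->]].
  elim: k => [|k [i _ IH]]; first by exists ord0; rewrite ?perm1.
  by exists (ordS i) => //; rewrite expgSr permM IH fS.
by exists i; apply: pow_labeling.
Qed.

Let f1 (i : 'I_t.+1) := h (lshift s.+1 i).
Let f2 (i : 'I_s.+1) := h (rshift t.+1 i).
Let f1S i : f1 (ordS i) = c (f1 i). Proof. by rewrite /f1 -hE annular_lshift. Qed.
Let f2S i : f2 (ordS i) = c (f2 i). Proof. by rewrite /f2 -hE annular_rshift. Qed.

Lemma labeling_start : h = start_labeling c (h i0) (h j0).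
Proof.
apply/ffunP => i; rewrite -(splitK i); case: (split i) => j.
  by rewrite start_labeling_lshift; apply: (pow_labeling f1S).
by rewrite start_labeling_rshift; apply: (pow_labeling f2S).
Qed.

Lemma labeling_porbit : #|porbit c (h i0)| = t.+1 /\ h j0 \notin porbit c (h i0).
Proof.
rewrite (porbit_labeling f1S); split.
  by rewrite card_imset ?card_ord// => i j /hI /lshift_inj.
apply/imsetP => -[i _ /hI/eqP]; by rewrite eq_rlshift.
Qed.

Lemma labeling_two : #|porbits c| = 2.
Proof.
have [_ yx] := labeling_porbit.
suff -> : porbits c = [set porbit c (h i0); porbit c (h j0)].
  by rewrite cards2 eq_sym eq_porbit_mem yx.
apply/setP => b; rewrite !inE; apply/imsetP/orP => [[z _ ->]|[] /eqP ->]; last 2 first.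
- by exists (h i0).
- by exists (h j0).
rewrite !eq_porbit_mem (porbit_labeling f1S) (porbit_labeling f2S).
have /codomP[i ->] : z \in codom h.
  by rewrite (inj_card_onto hI)// card_ord cardT.
by rewrite -(splitK i); case: (split i) => j; [left|right]; apply: imset_f.
Qed.

End FromLabeling.

Lemma two_porbits_compl c x y : #|porbits c| = 2 -> y \notin porbit c x ->
  porbit c y = ~: porbit c x.
Proof.
move=> c2 yx; apply/setP => z; rewrite inE.
have E : porbits c = [set porbit c x; porbit c y].
  apply/esym/eqP; rewrite eqEcard subUset !sub1set !imset_f//= c2.
  by rewrite cards2 eq_sym eq_porbit_mem yx.
have : porbit c z \in porbits c by apply: imset_f.
rewrite E !inE !eq_porbit_mem => /orP[zx|zy].
  rewrite zx; apply/negbTE; apply: contra yx => zy.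
  by rewrite -eq_porbit_mem -(eqP (_ : porbit c z == porbit c y)) eq_porbit_mem.
rewrite zy; apply/esym; apply: contra yx => zx.
by rewrite -eq_porbit_mem -(eqP (_ : porbit c z == porbit c y)) eq_porbit_mem.
Qed.

Lemma start_labeling_annular c x y : #|porbits c| = 2 -> #|porbit c x| = t.+1 ->
  y \notin porbit c x -> start_labeling c x y \in annular_labelings t.+1 s.+1 c.
Proof.
move=> c2 cx yx; have cy : #|porbit c y| = s.+1.
  by rewrite (two_porbits_compl c2 yx) cardsCs setCK cardT cx addKn.
have neq i j : (c ^+ i)%g x != (c ^+ j)%g y.
  apply: contra yx => /eqP E.
  by rewrite -eq_porbit_mem -(porbit_perm c j) -E porbit_perm.
rewrite inE; apply/andP; split.
  apply/injectiveP => i j; rewrite -(splitK i) -(splitK j).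
  case: (split i) (split j) => i' [] j' /=; rewrite ?start_labeling_lshift ?start_labeling_rshift => E.
  - by congr lshift; apply/val_inj; apply: (pow_porbit_inj (x := x)) E; rewrite cx.
  - by have := neq i' j'; rewrite E eqxx.
  - by have := neq j' i'; rewrite E eqxx.
  - by congr rshift; apply/val_inj; apply: (pow_porbit_inj (x := y)) E; rewrite cy.
apply/forallP => i; rewrite -(splitK i); case: (split i) => j /=.
  by rewrite annular_lshift !start_labeling_lshift pow_ordS.
by rewrite annular_rshift !start_labeling_rshift pow_ordS.
Qed.

(** A labeling amounts to the choice of a starting point on a cycle of length
    [t.+1] and of another one on the other cycle. *)
Lemma card_annular_labelings c : #|annular_labelings t.+1 s.+1 c| =
  if #|porbits c| == 2 then (#|[set x | #|porbit c x| == t.+1]| * s.+1)%N else 0%N.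
Proof.
case: eqP => [c2|c2]; last first.
  apply/eqP; rewrite cards_eq0; apply/eqP/setP => h; rewrite in_set0.
  by apply/negbTE/negP => /labeling_two.
pose D := [set p : T * T | (#|porbit c p.1| == t.+1) && (p.2 \notin porbit c p.1)].
have -> : annular_labelings t.+1 s.+1 c = [set start_labeling c p.1 p.2 | p in D].
  apply/setP => h; apply/idP/imsetP => [hc|[[x y]]].
    have [h1 h2] := labeling_porbit hc.
    by exists (h i0, h j0); rewrite ?inE ?h1 ?eqxx//; apply: labeling_start.
  by rewrite inE /= => /andP[/eqP cx yx] ->; apply: start_labeling_annular.
rewrite card_in_imset; last first.
  move=> [x y] [x' y'] _ _ /ffunP E.
  have := E (lshift s.+1 ord0); have := E (rshift t.+1 ord0).
  by rewrite !start_labeling_lshift !start_labeling_rshift !perm1 /= => -> ->.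
rewrite -sum1_card (eq_bigl (fun p => (p.1 \in [set x | #|porbit c x| == t.+1]) &&
   (p.2 \notin porbit c p.1))); last by move=> p; rewrite !inE.
rewrite -(pair_big_dep (fun x => x \in [set x | #|porbit c x| == t.+1]) (fun x y => y \notin porbit c x) (fun _ _ => 1%N)) /=.
rewrite -sum_nat_const; apply: eq_bigr => x. rewrite inE => /eqP cx.
rewrite sum1_card; have := cardC (mem (porbit c x)).
by rewrite cardT cx => /addnI <-; apply: eq_card.
Qed.

(** Every bijection labels exactly one permutation, a conjugate of the standard
    annular permutation. *)
Lemma sum_annular_labelings :
  \sum_c planar_sum r c *+ #|annular_labelings t.+1 s.+1 c| =
  planar_sum r (annular_perm t.+1 s.+1) *+ #|T|`!.
Proof.
under eq_bigr do rewrite -sumr_const.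
rewrite (exchange_big_dep (fun h : {ffun _} => injectiveb h)) /=; last first.
  by move=> c h _; rewrite inE => /andP[].
transitivity (\sum_(h : {ffun 'I_(t.+1 + s.+1) -> T} | injectiveb h)
    planar_sum r (annular_perm t.+1 s.+1)); last first.
  rewrite sumr_const -ffactnn; congr (_ *+ _).
  have := card_inj_ffuns 'I_(t.+1 + s.+1) T; rewrite card_ord -cardT => <-.
  by apply: eq_card => h; rewrite inE.
apply: eq_bigr => h /injectiveP hI.
have [h' hK h'K] : bijective h by apply: inj_card_bij; rewrite // card_ord cardT.
pose c0 := conj_perm hK h'K (annular_perm t.+1 s.+1).
rewrite (big_pred1 c0) => [|c].
  apply/esym/(@planar_sum_conj R r _ _ h); first by exists h'.
  by move=> x; rewrite conj_permEh.
rewrite inE; have -> : injectiveb h by apply/injectiveP.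
apply/forallP/eqP => [hc|-> x]; last by rewrite conj_permEh.
by apply/permP => x; rewrite conj_permE (eqP (hc _)) h'K.
Qed.

End Labelings.

Lemma planar_sum_annular t s : planar_sum r (annular_perm t s) =
  \sum_(g in SNC t s) \prod_(b in porbits g) r #|b|.
Proof. by apply: eq_bigl => g; rewrite inE card_ord. Qed.

(** Double counting of the labelings.  The starting points of the labelings of a
    given permutation account for the factors [1 / (t * (n - t))] of
    [annular_sum], and the two orders of its cycles for the factor 1/2. *)
Lemma sum_two_cycles : (0 < #|T|)%N ->
  \sum_(c : {perm T} | #|porbits c| == 2) planar_sum r c =
  annular_sum r #|T| *+ (#|T|.-1)`!.
Proof.
set n := #|T| => n0.
have labE t c : (0 < t < n)%N -> #|annular_labelings t (n - t) c| =
    if #|porbits c| == 2 then (#|[set x | #|porbit c x| == t]| * (n - t))%N else 0%N.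
  case: t => // t /= tn; have [s Es] : exists s, (n - t.+1 = s.+1)%N.
    by exists (n - t.+1).-1; rewrite prednK// subn_gt0.
  by rewrite Es card_annular_labelings// -Es -/n; lia.
(* Each of the two cycles contributes 1, summed over its points. *)
pose L t c : R := #|annular_labelings t (n - t) c|%:R / (t * (n - t))%:R.
have L2 c : \sum_(1 <= t < n) L t c = if #|porbits c| == 2 then 2 else 0.
  case: eqP => c2; last first.
    by rewrite big_nat big1// => t tn; rewrite /L labE//; case: eqP => // _; rewrite mul0r.
  have -> : (2 : R) = #|porbits c|%:R by rewrite c2.
  rewrite -sum_inv_porbit.
  transitivity (\sum_(1 <= t < n) \sum_(x | #|porbit c x| == t) (t%:R : R)^-1).
    apply: eq_big_nat => t tn; rewrite /L labE// c2 eqxx sumr_const.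
    have nt : (n - t)%:R != 0 :> R by rewrite pnatr_eq0; lia.
    have t0 : t%:R != 0 :> R by rewrite pnatr_eq0; lia.
    rewrite -[RHS]mulr_natr !natrM (@eq_card _ [set x | _] [pred x | #|porbit c x| == t]).
      by field; rewrite nt t0.
    by move=> x; rewrite !inE.
  rewrite (exchange_big_dep predT) //=; apply: eq_bigr => x _.
  under eq_bigl do rewrite eq_sym.
  rewrite big_nat1_eq lt0n card_porbit_neq0 /=.
  case: ltnP => // cn; have xT : porbit c x = [set: T].
    by apply/eqP; rewrite eqEcard subsetT cardsT.
  have : (#|porbits c| <= #|[set [set: T]]|)%N.
    apply: subset_leq_card; apply/subsetP => b /imsetP[y _ ->]; rewrite inE -xT.
    by rewrite eq_porbit_mem xT inE.
  by rewrite c2 cards1.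
have -> : \sum_(c : {perm T} | #|porbits c| == 2) planar_sum r c =
    2^-1 * \sum_c \sum_(1 <= t < n) planar_sum r c * L t c.
  rewrite mulr_sumr big_mkcond; apply: eq_bigr => c _.
  rewrite -mulr_sumr L2; case: eqP => _; last by rewrite !mulr0.
  by field.
rewrite exchange_big /= /annular_sum -[RHS]mulr_natr mulrAC [n%:R / 2]mulrC -2!mulrA.
congr (_ * _); rewrite mulrA -natrM -{2}(prednK n0) -factS prednK//.
rewrite mulr_sumr; apply: eq_big_nat => t tn.
transitivity ((\sum_c planar_sum r c *+ #|annular_labelings t (n - t) c|) /
    (t * (n - t))%:R).
  by rewrite mulr_suml; apply: eq_bigr => c _; rewrite /L mulrA mulr_natr.
case: t tn => // t /= tn; have [s Es] : exists s, (n - t.+1 = s.+1)%N.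
  by exists (n - t.+1).-1; rewrite prednK// subn_gt0.
rewrite Es sum_annular_labelings -?Es -/n; last by lia.
by rewrite planar_sum_annular -[X in X / _]mulr_natl -mulr_suml mulrA.
Qed.


End TwoCycles.

(** * Transitive pairs with given number of cycles *)

Section Genus.
Variable n : nat.
Implicit Types s t : {perm 'I_n}.

Lemma card_porbits_gt0 s : (0 < n)%N -> (0 < #|porbits s|)%N.
Proof.
move=> n0; rewrite card_gt0; apply/set0Pn; exists (porbit s (Ordinal n0)).
exact: imset_f.
Qed.

Lemma transitive_porbits_le s t : (0 < n)%N ->
  [transitive <<[set s; t]>>%g, on [set: 'I_n] | 'P] ->
  (#|porbits s| + #|porbits t| <= n.+1)%N.
Proof.
by move=> n0 /euler_inequality; have := card_porbits_gt0 (s * t)%g n0; lia.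
Qed.

(** The product has at most two cycles by the Euler inequality, and an even number
    of them by parity. *)
Lemma transitive_two_cycles s t : (0 < n)%N ->
  [transitive <<[set s; t]>>%g, on [set: 'I_n] | 'P] ->
  (#|porbits s| + #|porbits t| = n)%N -> #|porbits (s * t)%g| = 2.
Proof.
move=> n0 /euler_inequality; have := card_porbits_gt0 (s * t)%g n0.
have := odd_permM s t; rewrite /odd_perm card_ord.
move=> odd_st gt0 le2 st; have : (#|porbits (s * t)%g| <= 2)%N by lia.
case E: #|porbits (s * t)%g| gt0 => [|[|[|k]]] //= _ _.
have := congr1 odd st; rewrite oddD => odd_n; move: odd_st; rewrite E -odd_n.
by case: (odd #|porbits s|); case: (odd #|porbits t|).
Qed.

Variables (R : numFieldType) (r : nat -> R).

Lemma sum_transitive_pairs : (0 < n)%N ->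
  \sum_(p : {perm 'I_n} * {perm 'I_n} |
      [transitive <<[set p.1; p.2]>>%g, on [set: 'I_n] | 'P] &&
      (#|porbits p.1| + #|porbits p.2| == n)%N) \prod_(c in porbits p.1) r #|c| =
  annular_sum r n *+ (n.-1)`!.
Proof.
move=> n0; have := @sum_two_cycles _ r 'I_n; rewrite card_ord => <-//.
rewrite /planar_sum -(pair_big_dep xpredT (fun s t =>
  [transitive <<[set s; t]>>%g, on [set: 'I_n] | 'P] &&
      (#|porbits s| + #|porbits t| == n)%N) (fun s _ => \prod_(c in porbits s) r #|c|)) /=.
rewrite [RHS](exchange_big_dep xpredT) //=; apply: eq_bigr => s _.
rewrite [RHS](reindex_inj (mulgI s)) /=; apply: eq_bigl => t.
rewrite mulKg group2_mulV card_ord andbC; case: eqP => //= st; last by rewrite !andbF.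
rewrite andbC; case: (boolP [transitive _, on _ | _]) => //= tr.
by rewrite transitive_two_cycles.
Qed.

(** The additional weight [x] of each cycle records the Euler characteristic. *)
Lemma connected_total_genus (x : R) : connected_total (fun k => x * r k) (fun=> x) n =
  \sum_(p : {perm 'I_n} * {perm 'I_n} |
      [transitive <<[set p.1; p.2]>>%g, on [set: 'I_n] | 'P])
    x ^+ (#|porbits p.1| + #|porbits p.2|) * \prod_(c in porbits p.1) r #|c|.
Proof.
have onT s : perm_on [set: 'I_n] s by apply/subsetP => i; rewrite inE.
have orbE s : porbit s @: [set: 'I_n] = porbits s.
  by apply/setP => c; apply/imsetP/imsetP => -[i _ ->]; exists i.
apply: eq_big => [p|p _]; first by rewrite !onT.
by rewrite /cycle_weight (orbE p.1) (orbE p.2) big_split /= !prodr_const exprD mulrAC.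
Qed.
End Genus.

(** * Sums over set partitions *)

Section SetPartitions.
Variable R : comNzRingType.
Implicit Types (phi u : nat -> R).

Definition partition_sum (T : finType) phi u (A : {set T}) : R :=
  \sum_(P : {set {set T}} | partition P A) phi #|P| * \prod_(V in P) u #|V|.

Lemma partition_sum_set0 (T : finType) phi u : partition_sum phi u (set0 : {set T}) = phi 0%N.
Proof.
rewrite /partition_sum (big_pred1 set0) => [|P]; last by rewrite partition_set0.
by rewrite cards0 big_set0 mulr1.
Qed.

(** The block of [x] is removed; the shifted weight remembers that it was there. *)
Lemma partition_sum_block (T : finType) phi u (A : {set T}) x : x \in A ->
  partition_sum phi u A = \sum_(V : {set T} | (x \in V) && (V \subset A))
     u #|V| * partition_sum (phi \o succn) u (A :\: V).
Proof.
move=> xA; rewrite /partition_sum (partition_big (fun P => pblock P x)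
  (fun V => (x \in V) && (V \subset A))) /=; last first.
  move=> P partP; have xP : x \in cover P by rewrite (cover_partition partP).
  by rewrite mem_pblock xP (partitionS partP)// pblock_mem.
apply: eq_bigr => V /andP[xV VA].
have V0 : V != set0 by apply/set0Pn; exists x.
have dV : [disjoint V & A :\: V].
  by rewrite -setI_eq0; apply/eqP/setP => y; rewrite !inE; case: (y \in V).
have VE : V :|: (A :\: V) = A.
  by apply/setP => y; rewrite !inE; case: (boolP (y \in V)) => //= /(subsetP VA).
have notin P : partition P (A :\: V) -> V \notin P.
  move=> partP; apply/negP => /(partitionS partP)/subsetP/(_ _ xV).
  by rewrite !inE xV.
rewrite mulr_sumr (reindex_onto (fun P => V |: P) (fun P => P :\ V)) /=; last first.
  move=> P /andP[partP /eqP PV]; rewrite setD1K// -PV pblock_mem//.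
  by rewrite (cover_partition partP).
apply: eq_big => [P|P /andP[/andP[partP _] /eqP PE]].
  apply/idP/idP => [/andP[/andP[partP _] /eqP <-]|partP].
    by apply: partitionD1; rewrite ?setU11.
  have partVP : partition (V |: P) A by rewrite -VE; apply: partitionU1.
  rewrite partVP (def_pblock (partition_trivIset partVP) (setU11 _ _) xV) eqxx /=.
  by rewrite setU1K// notin.
have VP : V \notin P by rewrite -PE !inE eqxx.
by rewrite cardsU1 VP big_setU1//= mulrCA.
Qed.

Definition partition_total phi u n : R :=
  \sum_(P in set_partitions n) phi #|P| * \prod_(V in P) u #|V|.

Lemma partition_totalE phi u n : partition_total phi u n = partition_sum phi u [set: 'I_n].
Proof. by apply: eq_bigl => P; rewrite inE. Qed.

Lemma partition_sum_card phi u (T : finType) (A : {set T}) :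
  partition_sum phi u A = partition_total phi u #|A|.
Proof.
have [n] := ubnP #|A|; elim: n => // n IH in T A phi *; rewrite ltnS => An.
case: (set_0Vmem A) => [->|[x xA]].
  by rewrite cards0 partition_totalE (_ : [set: 'I_0] = set0) ?partition_sum_set0//; apply/setP => -[].
have step (T' : finType) (A' : {set T'}) y : y \in A' -> #|A'| = #|A| ->
    partition_sum phi u A' = \sum_(j < #|A|)
      (u j.+1 * partition_total (phi \o succn) u (#|A| - j.+1)) *+ 'C(#|A|.-1, j).
  move=> yA' AA'; rewrite (partition_sum_block _ _ yA').
  rewrite -AA' -(sum_subsets (fun k => u k * partition_total (phi \o succn) u (#|A'| - k)) yA').
  apply: eq_bigr => V /andP[yV VA].
  have V0 : (0 < #|V|)%N by rewrite card_gt0; apply/set0Pn; exists y.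
  rewrite IH ?card_setDS// AA'; apply: leq_trans _ An.
  by rewrite ltn_subrL V0 -AA' (leq_trans V0)// subset_leq_card.
have A0 : (0 < #|A|)%N by rewrite card_gt0; apply/set0Pn; exists x.
by rewrite (step _ _ _ xA)// partition_totalE (step _ _ (Ordinal A0))// ?inE// cardsT card_ord.
Qed.

Lemma partition_total0 phi u : partition_total phi u 0 = phi 0%N.
Proof. by rewrite -[X in partition_total _ _ X](cards0 'I_1) -partition_sum_card partition_sum_set0. Qed.

Lemma partition_totalS phi u n : partition_total phi u n.+1 =
  \sum_(j < n.+1) (u j.+1 * partition_total (phi \o succn) u (n - j)) *+ 'C(n, j).
Proof.
have := sum_subsets (fun k => u k * partition_total (phi \o succn) u (n.+1 - k)) (in_setT (ord0 : 'I_n.+1)).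
rewrite cardsT card_ord /= => <-; rewrite partition_totalE (partition_sum_block _ _ (in_setT ord0)).
apply: eq_bigr => A /andP[yA AS].
by rewrite (partition_sum_card _ _ (_ :\: _)) ?card_setDS ?cardsT ?card_ord.
Qed.

End SetPartitions.

(** * Non-crossing partitions of intervals *)

Lemma partitionU (T : finType) (P Q : {set {set T}}) (A B : {set T}) :
  [disjoint A & B] -> partition P A -> partition Q B -> partition (P :|: Q) (A :|: B).
Proof.
move=> AB /and3P[/eqP cP tP P0] /and3P[/eqP cQ tQ Q0]; apply/and3P; split.
- by rewrite /cover bigcup_setU -!/(cover _) cP cQ.
- by apply: trivIsetU => //; rewrite cP cQ.
- by rewrite inE negb_or P0.
Qed.

Section Restriction.
Variable T : finType.
Implicit Types (P : {set {set T}}) (A B W X : {set T}).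

Definition restr_part P A : {set {set T}} := [set W :&: A | W : {set T} in P] :\ set0.

Lemma restr_partP P A X :
  reflect (X != set0 /\ exists2 W, W \in P & X = W :&: A) (X \in restr_part P A).
Proof.
rewrite !inE; apply: (iffP andP) => -[X0 h]; split=> //; first by apply/imsetP.
by move/imsetP: h.
Qed.

Lemma restr_partition P A B : A \subset B -> partition P B ->
  partition (restr_part P A) A.
Proof.
move=> AB partP; have trivP := partition_trivIset partP; apply/and3P; split.
- apply/eqP/setP => x; apply/bigcupP/idP => [[X /restr_partP[_ [W _ ->]]]|xA].
    by rewrite inE => /andP[].
  have xP : x \in cover P by rewrite (cover_partition partP) (subsetP AB).
  exists (pblock P x :&: A); last by rewrite inE mem_pblock xP.
  apply/restr_partP; split; last by exists (pblock P x); rewrite ?pblock_mem.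
  by apply/set0Pn; exists x; rewrite inE mem_pblock xP.
- apply/trivIsetP => X Y /restr_partP[_ [V VP ->]] /restr_partP[_ [W WP ->]] neq.
  have VW : V != W by apply: contraNneq neq => ->.
  have := trivIsetP trivP _ _ VP WP VW; rewrite -!setI_eq0 => /eqP E.
  by rewrite setIACA E set0I.
- by rewrite !inE eqxx.
Qed.

End Restriction.

Section Intervals.
Variable N : nat.
Implicit Types (P Q : {set {set 'I_N}}) (V W X : {set 'I_N}) (a b f : nat).

Lemma noncrossingP P :
  reflect (forall V W, V \in P -> W \in P -> forall i j k l : 'I_N,
      i \in V -> j \in W -> k \in V -> l \in W -> (i < j)%N -> (j < k)%N -> (k < l)%N ->
      V = W) (noncrossing P).
Proof.
apply: (iffP idP) => [nc V W VP WP i j k l iV jW kV lW ij jk kl|nc].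
  move/forall_inP/(_ _ VP)/forall_inP/(_ _ WP): nc.
  move/forall_inP/(_ _ iV)/forall_inP/(_ _ jW)/forall_inP/(_ _ kV)/forall_inP/(_ _ lW).
  by rewrite ij jk kl /= => /eqP.
apply/forall_inP => V VP; apply/forall_inP => W WP.
apply/forall_inP => i iV; apply/forall_inP => j jW.
apply/forall_inP => k kV; apply/forall_inP => l lW.
by apply/implyP => /and3P[ij jk kl]; apply/eqP; apply: (nc V W VP WP i j k l).
Qed.

Definition ord_itv a b : {set 'I_N} := [set i : 'I_N | (a <= i < b)%N].

Definition NCitv a b : {set {set {set 'I_N}}} :=
  [set P | partition P (ord_itv a b) && noncrossing P].

Lemma restr_NC P (A : {set 'I_N}) a b : A \subset ord_itv a b -> P \in NCitv a b ->
  partition (restr_part P A) A && noncrossing (restr_part P A).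
Proof.
rewrite inE => Aab /andP[partP /noncrossingP nc].
rewrite (restr_partition Aab)//=; apply/noncrossingP => X Y.
move=> /restr_partP[_ [V VP ->]] /restr_partP[_ [W WP ->]] i j k l.
rewrite !inE => /andP[iV _] /andP[jW _] /andP[kV _] /andP[lW _] ij jk kl.
by congr (_ :&: _); apply: (nc V W) ij jk kl.
Qed.

(** The point is a natural number, so that the end point of an interval, which may
    be [N], is allowed; its block is empty. *)
Definition block_at P f : {set 'I_N} :=
  \bigcup_(W in P | [exists i in W, val i == f]) W.

Lemma block_at_eq P W (i : 'I_N) : trivIset P -> W \in P -> i \in W -> block_at P i = W.
Proof.
move=> tP WP iW; apply/setP => x; apply/bigcupP/idP => [[V /andP[VP]]|xW].
  case/existsP => j /andP[jV /eqP/val_inj ji] xV.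
  by rewrite -(def_pblock tP WP iW) (def_pblock tP VP) -?ji.
by exists W => //; rewrite WP; apply/existsP; exists i; rewrite iW /=.
Qed.

Lemma block_at_out P f : (forall W i, W \in P -> i \in W -> val i != f) -> block_at P f = set0.
Proof.
move=> h; rewrite /block_at big1// => W /andP[WP /existsP[i /andP[iW]]].
by rewrite (negbTE (h _ _ WP iW)).
Qed.

Section Glue.
Variables (a b f : nat).
Hypotheses (af : (a < f)%N) (fb : (f <= b)%N) (bN : (b <= N)%N).

Let aN : (a < N)%N. Proof. by apply: leq_trans bN; apply: leq_trans fb. Qed.
Let a0 : 'I_N := Ordinal aN.
Let I1 := ord_itv a.+1 f.
Let I2 := ord_itv f b.

(** The inverse of cutting a non-crossing partition of [a, b) at the successor [f]
    of [a] in its block: the point [a] joins the block of [f]. *)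
Definition glue P1 P2 : {set {set 'I_N}} :=
  (a0 |: block_at P2 f) |: (P1 :|: (P2 :\ block_at P2 f)).

(** [f] is the successor of [a] in its block, [b] standing for the end. *)
Definition is_next P : bool :=
  ((f == b) || [exists i in block_at P a, val i == f]) &&
  [forall i in block_at P a, (val i == a) || (f <= i)%N].

Lemma in_ord_itv1 (i : 'I_N) : (i \in I1) = (a < i < f)%N. Proof. by rewrite inE. Qed.
Lemma in_ord_itv2 (i : 'I_N) : (i \in I2) = (f <= i < b)%N. Proof. by rewrite inE. Qed.

Lemma ord_itv_split : ord_itv a b = a0 |: (I1 :|: I2).
Proof. by apply/setP => i; rewrite !inE -val_eqE /=; lia. Qed.

Section GlueOf.
Variables (P1 P2 : {set {set 'I_N}}).
Hypotheses (hP1 : P1 \in NCitv a.+1 f) (hP2 : P2 \in NCitv f b).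

Let part1 : partition P1 I1. Proof. by move: hP1; rewrite inE => /andP[]. Qed.
Let part2 : partition P2 I2. Proof. by move: hP2; rewrite inE => /andP[]. Qed.
Let nc1 : noncrossing P1. Proof. by move: hP1; rewrite inE => /andP[]. Qed.
Let nc2 : noncrossing P2. Proof. by move: hP2; rewrite inE => /andP[]. Qed.
Let V2 := block_at P2 f.
Let B := a0 |: V2.

Lemma block_at_cases : (f = b /\ V2 = set0) \/
  [/\ (f < b)%N, V2 \in P2 & exists2 f0 : 'I_N, f0 \in V2 & val f0 = f].
Proof.
have [fb'|bf] := ltnP f b; [right|left].
  have fN : (f < N)%N by apply: leq_trans bN.
  have fI2 : Ordinal fN \in cover P2.
    by rewrite (cover_partition part2) inE /= leqnn.
  have E : V2 = pblock P2 (Ordinal fN).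
    apply: (block_at_eq (i := Ordinal fN)); rewrite ?pblock_mem ?mem_pblock//.
    exact: partition_trivIset part2.
  by split=> //; rewrite E ?pblock_mem//; exists (Ordinal fN); rewrite ?mem_pblock.
have E : f = b by apply/eqP; rewrite eqn_leq fb.
split=> //; apply: block_at_out => W i WP iW.
by have /subsetP/(_ _ iW) := partitionS part2 WP; rewrite inE; lia.
Qed.

Lemma block_at_sub i : i \in V2 -> i \in I2.
Proof.
case: block_at_cases => [[_ ->]|[_ VP _]]; first by rewrite in_set0.
by move=> iV; apply: (subsetP (partitionS part2 VP)).
Qed.

Lemma mem_glue W : reflect [\/ W = B, W \in P1 | W \in P2 /\ W != V2] (W \in glue P1 P2).
Proof.
rewrite !inE; apply: (iffP or3P) => -[h|h|h].
- by constructor 1; apply/eqP.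
- by constructor 2.
- by case/andP: h => h1 h2; constructor 3.
- by constructor 1; apply/eqP.
- by constructor 2.
- by case: h => h1 h2; constructor 3; rewrite h1 h2.
Qed.

Let sub1 W i : W \in P1 -> i \in W -> (a < i < f)%N.
Proof. by move=> /(partitionS part1)/subsetP s /s; rewrite inE. Qed.
Let sub2 W i : W \in P2 -> i \in W -> (f <= i < b)%N.
Proof. by move=> /(partitionS part2)/subsetP s /s; rewrite inE. Qed.
Let subB i : i \in B -> (i : nat) = a \/ i \in V2 /\ (f <= i < b)%N.
Proof.
rewrite !inE => /orP[/eqP -> |iV]; [by left|right; split=> //].
by have := block_at_sub iV; rewrite inE.
Qed.

Lemma glue_partition : partition (glue P1 P2) (ord_itv a b).
Proof.
have p2 : partition (P2 :\ V2) (I2 :\: V2).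
  case: block_at_cases => [[_ V0]|[_ VP _]]; last exact: partitionD1.
  rewrite V0 setD0 (_ : P2 :\ set0 = P2)//.
  by apply/setP => X; rewrite !inE; case: eqP => //= ->; rewrite (partition0 part2).
have -> : ord_itv a b = (a0 |: V2) :|: (I1 :|: (I2 :\: V2)).
  rewrite ord_itv_split; apply/setP => i; rewrite !inE.
  by case: (boolP (i \in V2)) => [/block_at_sub|_]; rewrite ?inE ?andbT//;
    move: af fb; clear; lia.
apply: partitionU1.
- apply: partitionU => //; rewrite -setI_eq0; apply/eqP/setP => i.
  by rewrite !inE; lia.
- by apply/set0Pn; exists a0; rewrite setU11.
- rewrite -setI_eq0; apply/eqP/setP => i; rewrite inE in_set0.
  apply/negbTE/andP => -[/subB[E|[iV iI2]]]; rewrite !inE; first by lia.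
  by rewrite iV /=; lia.
Qed.

Lemma glue_noncrossing : noncrossing (glue P1 P2).
Proof.
apply/noncrossingP => V W /mem_glue hV /mem_glue hW i j k l iV jW kV lW ij jk kl.
case: hV => [VB|V1|[VP VV2]]; case: hW => [WB|W1|[WP WV2]].
- by rewrite VB WB.
- rewrite VB in kV; move: (sub1 W1 jW) (sub1 W1 lW) jk kl.
  by case: (subB kV) => [|[_]]; clear; lia.
- rewrite VB in iV kV; have := sub2 WP jW; have := sub2 WP lW.
  move=> ll jj; case: (subB kV) => [ka|[kV2 kk]].
    by move: ka jj jk af; clear; lia.
  case: block_at_cases => [[E _]|[fb' V2P [f0 f0V Ef]]].
    by move: E kk; clear; lia.
  have fj : (f0 < j)%N.
    rewrite ltn_neqAle; apply/andP; split; last by rewrite [(f0 : nat)]Ef; case/andP: jj.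
    apply: contraNneq WV2 => /val_inj E; rewrite -E in jW.
    by rewrite -(block_at_eq (partition_trivIset part2) WP jW) [(f0 : nat)]Ef.
  have E := noncrossingP _ nc2 _ _ V2P WP f0 j k l f0V jW kV2 lW fj jk kl.
  by rewrite -E eqxx in WV2.
- rewrite WB in jW; move: (sub1 V1 iV) (sub1 V1 kV) ij jk.
  by case: (subB jW) => [|[_]]; clear; lia.
- exact: (noncrossingP _ nc1 _ _ V1 W1 i j k l).
- by move: (sub1 V1 kV) (sub2 WP jW) jk; clear; lia.
- rewrite WB in jW lW; have := sub2 VP iV; have := sub2 VP kV => kk ii.
  case: (subB jW) => [ja|[jV2 _]]; first by move: ja ii ij af; clear; lia.
  case: (subB lW) => [la|[lV2 _]]; first by move: la kk kl af; clear; lia.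
  case: block_at_cases => [[_ V0]|[fb' V2P _]].
    by move: jV2; rewrite V0 in_set0.
  have E := noncrossingP _ nc2 _ _ VP V2P i j k l iV jV2 kV lV2 ij jk kl.
  by rewrite E eqxx in VV2.
- by move: (sub2 VP kV) (sub1 W1 lW) kl; clear; lia.
- exact: (noncrossingP _ nc2 _ _ VP WP i j k l).
Qed.

Lemma glue_NC : glue P1 P2 \in NCitv a b.
Proof. by rewrite inE glue_partition glue_noncrossing. Qed.

Lemma block_at_glue : block_at (glue P1 P2) a = B.
Proof.
apply: (block_at_eq (i := a0)).
- exact: partition_trivIset glue_partition.
- by rewrite setU11.
- by rewrite setU11.
Qed.

Lemma glue_next : is_next (glue P1 P2).
Proof.
rewrite /is_next block_at_glue; apply/andP; split.
  case: block_at_cases => [[-> _]|[_ _ [f0 f0V Ef]]]; first by rewrite eqxx.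
  by apply/orP; right; apply/existsP; exists f0; rewrite inE f0V orbT -Ef /=.
apply/forall_inP => i /subB[E|[_ h]].
  by rewrite [(\val i : nat)]E eqxx.
by apply/orP; right; lia.
Qed.

Lemma restr_glue1 : restr_part (glue P1 P2) I1 = P1.
Proof.
apply/setP => X; apply/restr_partP/idP => [[X0 [W /mem_glue hW E]]|XP].
  have [i] := set0Pn _ X0; rewrite E inE in_ord_itv1 => /andP[iW iI].
  case: hW => [WB|W1|[WP _]].
  - by rewrite WB in iW; move: iI; case: (subB iW) => [|[_]]; clear; lia.
  - by rewrite (setIidPl _)// (partitionS part1).
  - by move: (sub2 WP iW) iI; clear; lia.
split; first exact: (partition_neq0 part1).
exists X; first by apply/mem_glue; constructor 2.
by rewrite (setIidPl _)// (partitionS part1).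
Qed.

Lemma restr_glue2 : restr_part (glue P1 P2) I2 = P2.
Proof.
have BI : B :&: I2 = V2.
  apply/setP => i; rewrite !inE -val_eqE /=; case: (boolP (i \in V2)) => [/block_at_sub|_].
    by rewrite inE orbT.
  by rewrite orbF; lia.
apply/setP => X; apply/restr_partP/idP => [[X0 [W /mem_glue hW E]]|XP].
  case: hW => [WB|W1|[WP _]].
  - rewrite WB BI in E; rewrite E; case: block_at_cases => [[_ V0]|[_ //]].
    by rewrite E V0 eqxx in X0.
  - have [i] := set0Pn _ X0; rewrite E inE in_ord_itv2 => /andP[iW iI].
    by move: (sub1 W1 iW) iI; clear; lia.
  - by rewrite E (setIidPl _)// (partitionS part2).
split; first exact: (partition_neq0 part2).
case: (eqVneq X V2) => [->|XV2]; first by exists B; rewrite ?BI ?setU11.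
exists X; first by apply/mem_glue; constructor 3.
by rewrite (setIidPl _)// (partitionS part2).
Qed.

Variables (R : comNzRingType) (r psi : nat -> R).

Lemma glue_weight :
  psi #|block_at (glue P1 P2) a| * \prod_(W in glue P1 P2 | W != block_at (glue P1 P2) a) r #|W| =
  (\prod_(W in P1) r #|W|) *
  (psi #|V2|.+1 * \prod_(W in P2 | W != V2) r #|W|).
Proof.
rewrite block_at_glue; have a0V2 : a0 \notin V2.
  by apply/negP => /block_at_sub; rewrite inE /=; lia.
rewrite cardsU1 a0V2 /= add1n mulrCA; congr (_ * _).
rewrite (eq_bigl [predU P1 & P2 :\ V2]) => [|W]; last first.
  rewrite !inE; case: (eqVneq W B) => [->|_] /=; last by rewrite andbT.
  apply/esym/negbTE; rewrite negb_or negb_and.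
  apply/andP; split; [|apply/orP; right]; apply/negP => BP.
    by have := sub1 BP (setU11 _ _); rewrite /= ltnn.
  by have := sub2 BP (setU11 _ _); rewrite /=; move: af; clear; lia.
rewrite bigU /=; first by congr (_ * _); apply: eq_bigl => W; rewrite !inE andbC.
rewrite -setI_eq0; apply/eqP/setP => W; rewrite !inE; apply/negbTE/and3P => -[W1 _ W2].
have /set0Pn[i iW] := partition_neq0 part1 W1.
by move: (sub1 W1 iW) (sub2 W2 iW); clear; lia.
Qed.

End GlueOf.

(** A block that meets both sides of [f] crosses the arc from [a] to [f], unless it
    is the block of [a]. *)
Lemma glue_restr P : P \in NCitv a b -> is_next P ->
  glue (restr_part P I1) (restr_part P I2) = P.
Proof.
move=> hP /andP[nextb nextV]; have := hP; rewrite inE => /andP[partP ncP].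
have trivP := partition_trivIset partP.
have ab : (a < b)%N by apply: leq_trans fb.
have a0P : a0 \in cover P by rewrite (cover_partition partP) inE /= leqnn.
set V := pblock P a0.
have VP : V \in P by rewrite pblock_mem.
have a0V : a0 \in V by rewrite mem_pblock.
have VE : block_at P a = V by apply: (block_at_eq (i := a0)).
have V_I2 i : i \in V -> i = a0 \/ i \in I2.
  move=> iV; have := forall_inP nextV i; rewrite VE iV => /(_ isT).
  case/orP => [/eqP ia|fi]; [by left; apply: val_inj|right].
  have /subsetP/(_ _ iV) := partitionS partP VP; rewrite !inE.
  by move: fi; clear; lia.
have VW W i : W \in P -> i \in W -> i \in V -> W = V.
  move=> WP iW iV; have := def_pblock trivP WP iW.
  by rewrite (def_pblock trivP VP iV).
have f_V : (f < b)%N -> exists2 f0 : 'I_N, f0 \in V & val f0 = f.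
  move=> fb'; move: nextb; rewrite VE; case: eqP => [E|_ /=]; first by move: fb'; rewrite E ltnn.
  by move=> /existsP[f0 /andP[f0V /eqP E]]; exists f0.
have sep W : W \in P -> W != V -> W \subset I1 \/ W \subset I2.
  move=> WP WV.
  have WI i : i \in W -> (i \in I1) || (i \in I2).
    move=> iW; have ia : i != a0 by apply: contraNneq WV => E; rewrite (VW W i)// E.
    have /subsetP/(_ _ iW) := partitionS partP WP; rewrite !inE.
    by move: ia; rewrite -val_eqE /=; clear; lia.
  case: (boolP (W \subset I1)) => [|/subsetPn[l lW lI1]]; [by left|right].
  have lI2 : l \in I2 by have := WI _ lW; rewrite (negbTE lI1).
  apply/subsetP => i iW; case/orP: (WI _ iW) => // iI1.
  have [f0 f0V Ef] : exists2 f0 : 'I_N, f0 \in V & val f0 = f.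
    by apply: f_V; move: lI2; rewrite inE; clear; lia.
  have fl : f0 != l by apply: contraNneq WV => E; rewrite (VW W l)// -E.
  suff E : V = W by rewrite E eqxx in WV.
  apply: (noncrossingP _ ncP V W VP WP a0 i f0 l) => //.
  - by move: iI1; rewrite inE /=; clear; lia.
  - by rewrite [(f0 : nat)]Ef; move: iI1; rewrite inE /=; clear; lia.
  - by move: fl lI2; rewrite inE -val_eqE /= [(f0 : nat)]Ef; clear; lia.
have part2 := restr_NC (_ : I2 \subset ord_itv a b) hP.
have {}part2 : restr_part P I2 \in NCitv f b.
  by rewrite inE part2//; apply/subsetP => i; rewrite !inE; move: af; clear; lia.
have part1 := restr_NC (_ : I1 \subset ord_itv a b) hP.
have {}part1 : restr_part P I1 \in NCitv a.+1 f.
  by rewrite inE part1//; apply/subsetP => i; rewrite !inE; move: fb; clear; lia.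
have VrE : a0 |: (V :&: I2) = V.
  apply/setP => i; rewrite !inE; apply/orP/idP => [[/eqP ->|/andP[]]//|iV].
  by case: (V_I2 _ iV) => [->|]; [left|rewrite inE => ->; right; rewrite iV].
have blkE : block_at (restr_part P I2) f = V :&: I2.
  case: (block_at_cases part1 part2) => [[E ->]|[fb' _ _]].
    apply/esym/setP => i; rewrite in_set0 in_setI; apply/negbTE/andP => -[_].
    by rewrite inE E; clear; lia.
  have [f0 f0V Ef] := f_V fb'.
  have f0I : f0 \in V :&: I2.
    by rewrite inE f0V inE [(f0 : nat)]Ef leqnn.
  rewrite -Ef; apply: (block_at_eq (i := f0)) => //.
    by move: part2; rewrite inE => /andP[/partition_trivIset].
  by apply/restr_partP; split; [apply/set0Pn; exists f0|exists V].
apply/setP => X; rewrite /glue blkE VrE in_setU1 in_setU [X \in _ :\ (V :&: I2)]in_setD1; apply/or3P/idP.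
  move=> [/eqP -> //|/restr_partP[X0 [W WP E]]|/andP[XV /restr_partP[X0 [W WP E]]]].
    have [i] := set0Pn _ X0; rewrite E inE => /andP[iW iI].
    have WV : W != V.
      apply: contraTneq iI => WV; rewrite WV in iW.
      by case: (V_I2 _ iW) => [->|]; rewrite !inE /=; clear; lia.
    case: (sep W WP WV) => WI; first by rewrite (setIidPl WI).
    by have := subsetP WI _ iW; move: iI; rewrite !inE; clear; lia.
  have WV : W != V by apply: contraNneq XV => WV; rewrite E WV.
  have [i] := set0Pn _ X0; rewrite E inE => /andP[iW iI].
  case: (sep W WP WV) => WI; last by rewrite (setIidPl WI).
  by have := subsetP WI _ iW; move: iI; rewrite !inE; clear; lia.
move=> XP; case: (eqVneq X V) => [->|XV]; first by constructor 1.
have X0 := partition_neq0 partP XP.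
case: (sep X XP XV) => XI.
  by constructor 2; apply/restr_partP; split=> //; exists X; rewrite // (setIidPl XI).
constructor 3; apply/andP; split; last first.
  by apply/restr_partP; split=> //; exists X; rewrite // (setIidPl XI).
have [i iX] := set0Pn _ X0.
apply: contraNneq XV => E; rewrite (VW X i)//.
by move: iX; rewrite E inE => /andP[].
Qed.

End Glue.

Lemma next_unique P a b : (a < b)%N -> (b <= N)%N -> P \in NCitv a b ->
  exists f0 : 'I_N.+1, forall f : 'I_N.+1, (a < f <= b)%N && is_next a b f P = (f == f0).
Proof.
move=> ab bN; rewrite inE => /andP[partP _].
have blkI i : i \in block_at P a -> (a <= i < b)%N.
  move=> /bigcupP[W /andP[WP _] iW].
  by have /subsetP/(_ _ iW) := partitionS partP WP; rewrite inE.
pose p f := (a < f <= b)%N && ((f == b) || [exists i in block_at P a, val i == f]).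
have exp : exists f, p f by exists b; rewrite /p ab leqnn eqxx.
case: (ex_minnP exp) => f0 /andP[/andP[af0 f0b] nf0] minf0.
have f0N : (f0 < N.+1)%N by rewrite ltnS (leq_trans f0b).
exists (Ordinal f0N) => f; apply/idP/eqP => [|->].
  move=> /andP[/andP[af fb] /andP[nf /forall_inP allf]].
  have : (f0 <= f)%N by apply: minf0; rewrite /p af fb nf.
  rewrite leq_eqVlt => /orP[/eqP E|f0f]; first by apply: val_inj => /=; rewrite E.
  case/orP: nf0 => [/eqP E|/existsP[i /andP[iB /eqP E]]].
    by move: fb; rewrite leqNgt -E f0f.
  have := allf i iB; rewrite [\val i]E [(i : nat)]E => /orP[/eqP E'|].
    by rewrite E' ltnn in af0.
  by rewrite leqNgt f0f.
rewrite /= af0 f0b /=; apply/andP; split=> //; apply/forall_inP => i iB.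
have := blkI _ iB; rewrite leq_eqVlt => /andP[/orP[/eqP ai _|ai ib]].
  by apply/orP; left; apply/eqP.
apply/orP; right; apply: minf0; rewrite /p ai (ltnW ib) /=.
by apply/orP; right; apply/existsP; exists i; rewrite iB /=.
Qed.

Variables (R : comNzRingType) (r : nat -> R).
Implicit Types psi : nat -> R.

(** Sum over noncrossing partitions, where the block of the first point has the
    weight [psi] instead of [r]. *)
Definition nc_sum a b psi : R :=
  \sum_(P in NCitv a b) psi #|block_at P a| * \prod_(W in P | W != block_at P a) r #|W|.

(** The value 1 at 0 is the weight of the missing first block of an empty
    interval. *)
Definition extend1 psi n : R := if n is 0 then 1 else psi n.

Lemma nc_sum_empty b psi : nc_sum b b psi = psi 0%N.
Proof.
have E : ord_itv b b = set0 by apply/setP => i; rewrite !inE; lia.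
rewrite /nc_sum (big_pred1 set0) => [|P].
  rewrite (_ : block_at set0 b = set0) ?cards0 ?big_pred0 ?mulr1// => [W|].
    by rewrite in_set0.
  by apply: block_at_out => W i; rewrite in_set0.
rewrite inE E partition_set0 /=; case: eqP => //= ->.
by apply/noncrossingP => V W; rewrite in_set0.
Qed.

Lemma nc_sum_extend1 a b : (a <= b)%N -> (b <= N)%N ->
  nc_sum a b (extend1 r) = \sum_(P in NCitv a b) \prod_(W in P) r #|W|.
Proof.
rewrite leq_eqVlt => /orP[/eqP <- bN|ab bN].
  rewrite nc_sum_empty /=; have E : ord_itv a a = set0 by apply/setP => i; rewrite !inE; lia.
  rewrite (big_pred1 set0) ?big_set0// => P; rewrite inE E partition_set0 /=.
  case: eqP => //= ->; by apply/noncrossingP => V W; rewrite in_set0.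
apply: eq_bigr => P; rewrite inE => /andP[partP _].
have aN : (a < N)%N by apply: leq_trans bN.
have aP : Ordinal aN \in cover P by rewrite (cover_partition partP) inE /= leqnn.
rewrite (@block_at_eq P (pblock P (Ordinal aN)) (Ordinal aN)) ?pblock_mem ?mem_pblock//;
  last exact: partition_trivIset partP.
rewrite [RHS](bigD1 (pblock P (Ordinal aN))) ?pblock_mem//=; congr (_ * _).
rewrite /extend1; case E: #|_| => //; move/eqP: E.
by rewrite cards_eq0 => /eqP E; rewrite -mem_pblock E in_set0 in aP.
Qed.

(** Cutting at the successor of the first point in its block. *)
Lemma nc_sum_next a b psi : (a < b)%N -> (b <= N)%N ->
  nc_sum a b psi = \sum_(f < N.+1 | (a < f <= b)%N)
     nc_sum a.+1 f (extend1 r) * nc_sum f b (psi \o succn).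
Proof.
move=> ab bN; rewrite /nc_sum.
transitivity (\sum_(P in NCitv a b) \sum_(f < N.+1 | (a < f <= b)%N && is_next a b f P)
   psi #|block_at P a| * \prod_(W in P | W != block_at P a) r #|W|).
  apply: eq_bigr => P hP; have [f0 E] := next_unique ab bN hP.
  by rewrite (big_pred1 f0).
rewrite (exchange_big_dep (fun f : 'I_N.+1 => (a < f <= b)%N)) /=; last first.
  by move=> P f _ /andP[].
apply: eq_bigr => f /andP[af fb].
rewrite -/(nc_sum _ _ _) nc_sum_extend1 ?(leq_trans fb)// big_distrl /=.
under [RHS]eq_bigr do rewrite big_distrr /=.
rewrite pair_big /=.
rewrite (reindex_onto (fun q => glue af fb bN q.1 q.2)
   (fun P => (restr_part P (ord_itv a.+1 f), restr_part P (ord_itv f b)))) /=; last first.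
  by move=> P /andP[hP /andP[_ nP]]; apply: glue_restr.
apply: eq_big => [[P1 P2]|[P1 P2] /andP[/andP[hP /andP[_ nP]] /eqP[E1 E2]]] /=.
  apply/idP/idP => [|/andP[hP1 hP2]].
    move: (glue af fb bN P1 P2) => P /andP[/andP[hP /andP[_ nP]] /eqP[<- <-]].
    rewrite [_ \in NCitv a.+1 f]in_set [_ \in NCitv f b]in_set.
    by rewrite !(restr_NC _ hP)//; apply/subsetP => i; rewrite !inE;
      move: af fb; clear; lia.
  rewrite glue_NC// glue_next// restr_glue1// restr_glue2// eqxx.
  by rewrite ?af ?fb.
have hP1 : P1 \in NCitv a.+1 f.
  rewrite -E1 in_set (restr_NC _ hP)//; apply/subsetP => i; rewrite !inE.
  by have := fb; clear; lia.
have hP2 : P2 \in NCitv f b.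
  rewrite -E2 in_set (restr_NC _ hP)//; apply/subsetP => i; rewrite !inE.
  by have := af; clear; lia.
by rewrite (glue_weight af fb bN hP1 hP2).
Qed.

End Intervals.

Section Recursion.
Variables (R : comNzRingType) (r : nat -> R).
Implicit Types psi : nat -> R.

Definition nc_total n psi : R := @nc_sum n R r 0 n psi.

Lemma nc_sum_rec N n a psi : (a + n.+1 <= N)%N ->
  @nc_sum N R r a (a + n.+1) psi = \sum_(i < n.+1)
     @nc_sum N R r a.+1 (a.+1 + i) (extend1 r) *
     @nc_sum N R r (a.+1 + i) (a + n.+1) (psi \o succn).
Proof.
move=> bN; rewrite nc_sum_next//; last by rewrite -addSnnS leq_addr.
pose F f := @nc_sum N R r a.+1 f (extend1 r) * @nc_sum N R r f (a + n.+1) (psi \o succn).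
transitivity (\sum_(a.+1 <= f < (a + n.+1).+1) F f).
  by rewrite big_geq_mkord /= (big_ord_widen_cond N.+1 (fun f => a < f)%N)//.
rewrite -[X in \sum_(X <= _ < _) _]add0n big_addn big_mkord.
have -> : ((a + n.+1).+1 - a.+1 = n.+1)%N by lia.
by apply: eq_bigr => i _; rewrite addnC.
Qed.

Lemma nc_sumE N n a psi : (a + n <= N)%N -> @nc_sum N R r a (a + n) psi = nc_total n psi.
Proof.
elim/ltn_ind: n => n IH in N a psi *; case: n IH => [|n] IH anN.
  by rewrite addn0 /nc_total !nc_sum_empty.
rewrite nc_sum_rec// /nc_total -[X in nc_sum _ r 0 X _]add0n nc_sum_rec//.
apply: eq_bigr => i _; have ni := ltn_ord i.
have E x : (x + n.+1 = x.+1 + i + (n - i))%N by lia.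
congr (_ * _); first by rewrite !IH//; lia.
by rewrite (E a) [in RHS](E 0%N) !IH//; lia.
Qed.

Lemma nc_totalS n psi :
  nc_total n.+1 psi = \sum_(i < n.+1) nc_total i (extend1 r) * nc_total (n - i) (psi \o succn).
Proof.
rewrite /nc_total -[X in nc_sum _ r 0 X _]add0n nc_sum_rec//.
apply: eq_bigr => i _; have ni := ltn_ord i.
have E x : (x + n.+1 = x.+1 + i + (n - i))%N by lia.
by rewrite (E 0%N) !nc_sumE//; lia.
Qed.

Lemma nc_total0 psi : nc_total 0 psi = psi 0%N. Proof. exact: nc_sum_empty. Qed.

Lemma sum_NC n : \sum_(P in NC n) \prod_(V in P) r #|V| = nc_total n (extend1 r).
Proof.
rewrite /nc_total nc_sum_extend1//; apply: eq_bigl => P; rewrite !inE.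
by congr (partition _ _ && _); apply/setP => i; rewrite !inE /= ltn_ord.
Qed.

End Recursion.

(* Imported only here, since several notations on finite sets are overridden. *)
From mathcomp Require Import all_classical all_reals all_analysis.

Import numFieldNormedType.Exports.

Local Open Scope classical_set_scope.
Local Open Scope ring_scope.

(** * Formal power series *)

(** A record rather than a bare function type, which already has a pointwise ring
    structure. *)
Record fps (R : Type) := Fps { fcoef :> nat -> R }.

Lemma fpsP (R : Type) (f g : fps R) : (forall n, f n = g n) -> f = g.
Proof. by case: f g => [f] [g] /= fg; congr Fps; apply: funext. Qed.

HB.instance Definition _ (R : Type) := gen_eqMixin (fps R).
HB.instance Definition _ (R : Type) := gen_choiceMixin (fps R).

Section FpsRing.
Variable R : comNzRingType.
Implicit Types f g h : fps R.

Definition fps_const (c : R) : fps R := Fps (fun n => if n is 0 then c else 0).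
Definition fps_add f g : fps R := Fps (fun n => f n + g n).
Definition fps_opp f : fps R := Fps (fun n => - f n).
Definition fps_mul f g : fps R :=
  Fps (fun n => \sum_(i < n.+1) f i * g (n - i)%N).

Lemma fps_addA : associative fps_add.
Proof. by move=> f g h; apply: fpsP => n /=; rewrite addrA. Qed.
Lemma fps_addC : commutative fps_add.
Proof. by move=> f g; apply: fpsP => n /=; rewrite addrC. Qed.
Lemma fps_add0 : left_id (fps_const 0) fps_add.
Proof. by move=> f; apply: fpsP => -[|n] /=; rewrite add0r. Qed.
Lemma fps_addN : left_inverse (fps_const 0) fps_opp fps_add.
Proof. by move=> f; apply: fpsP => -[|n] /=; rewrite addNr. Qed.

HB.instance Definition _ :=
  GRing.isZmodule.Build (fps R) fps_addA fps_addC fps_add0 fps_addN.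

(** The ring laws, and later the laws of composition and derivation, are
    inherited from polynomials: an identity between coefficients of index below
    [n] only involves coefficients of index below [n]. *)
Definition agree n (p : {poly R}) f := forall k, (k < n)%N -> p`_k = f k.

Definition trunc n f : {poly R} := \poly_(i < n) f i.

Lemma agree_trunc n f : agree n (trunc n f) f.
Proof. by move=> k kn; rewrite coef_poly kn. Qed.

Lemma agreeW m n p f : (m <= n)%N -> agree n p f -> agree m p f.
Proof. by move=> mn pf k km; apply: pf; apply: leq_trans km mn. Qed.

Lemma agree_ext f g : (forall n, exists2 p, agree n p f & agree n p g) -> f = g.
Proof.
by move=> fg; apply: fpsP => k; have [p pf pg] := fg k.+1; rewrite -pf ?pg.
Qed.

Lemma agree_mul n p q f g :
  agree n p f -> agree n q g -> agree n (p * q) (fps_mul f g).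
Proof.
move=> pf qg k kn; rewrite coefM; apply: eq_bigr => i _.
by rewrite pf ?qg ?(leq_ltn_trans _ kn) ?leq_subr// -ltnS.
Qed.

Lemma agree_const n c : agree n c%:P (fps_const c).
Proof. by case=> [|k] _; rewrite coefC. Qed.

Lemma agree_add n p q f g :
  agree n p f -> agree n q g -> agree n (p + q) (f + g).
Proof. by move=> pf qg k kn; rewrite coefD pf ?qg. Qed.

Lemma fps_mulA : associative fps_mul.
Proof.
move=> f g h; apply: agree_ext => n.
exists (trunc n f * trunc n g * trunc n h).
  by rewrite -mulrA; do !apply: agree_mul; apply: agree_trunc.
by do !apply: agree_mul; apply: agree_trunc.
Qed.

Lemma fps_mulC : commutative fps_mul.
Proof.
move=> f g; apply: agree_ext => n; exists (trunc n f * trunc n g).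
  by apply: agree_mul; apply: agree_trunc.
by rewrite mulrC; apply: agree_mul; apply: agree_trunc.
Qed.

Lemma fps_mul1 : left_id (fps_const 1) fps_mul.
Proof.
move=> f; apply: agree_ext => n; exists (1 * trunc n f); last first.
  by rewrite mul1r; apply: agree_trunc.
by apply: agree_mul; [apply: agree_const|apply: agree_trunc].
Qed.

Lemma fps_mulDl : left_distributive fps_mul fps_add.
Proof.
move=> f g h; apply: fpsP => n /=.
by rewrite -big_split; apply: eq_bigr => i _; rewrite mulrDl.
Qed.

Lemma fcoef_eq f g n : f = g -> f n = g n. Proof. by move->. Qed.

Lemma fps_oner_neq0 : fps_const 1 != 0 :> fps R.
Proof.
apply/eqP => /(congr1 (fun f : fps R => f 0%N)) /= /eqP.
by rewrite oner_eq0.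
Qed.

HB.instance Definition _ := GRing.Zmodule_isComNzRing.Build (fps R)
  fps_mulA fps_mulC fps_mul1 fps_mulDl fps_oner_neq0.

Lemma fcoefD f g n : (f + g) n = f n + g n. Proof. by []. Qed.
Lemma fcoefN f n : (- f) n = - f n. Proof. by []. Qed.
Lemma fcoefB f g n : (f - g) n = f n - g n. Proof. by []. Qed.
Lemma fcoefM f g n : (f * g) n = \sum_(i < n.+1) f i * g (n - i)%N.
Proof. by []. Qed.
Lemma fcoef0 n : (0 : fps R) n = 0. Proof. by case: n. Qed.
Lemma fcoef1 n : (1 : fps R) n = (n == 0%N)%:R. Proof. by case: n. Qed.
Lemma fcoefC c n : fps_const c n = c *+ (n == 0%N). Proof. by case: n. Qed.

Lemma fcoef_sum (I : Type) (s : seq I) (P : pred I) (F : I -> fps R) n :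
  (\sum_(i <- s | P i) F i) n = \sum_(i <- s | P i) F i n.
Proof.
elim/big_rec2: _ => [|i x y _ <-]; [exact: fcoef0|exact: fcoefD].
Qed.

Lemma fcoefCM c f n : (fps_const c * f) n = c * f n.
Proof.
rewrite fcoefM big_ord_recl /= subn0 big1 ?addr0// => i _.
by rewrite mul0r.
Qed.

Lemma fcoefMn f m n : (f *+ m) n = f n *+ m.
Proof. by elim: m => [|m IH]; rewrite ?mulr0n ?fcoef0// !mulrS fcoefD IH. Qed.

Lemma fcoef0M f g : (f * g) 0%N = f 0%N * g 0%N.
Proof. by rewrite fcoefM big_ord1. Qed.

Lemma fcoef0X f n : (f ^+ n) 0%N = f 0%N ^+ n.
Proof. by elim: n => [|n IH]; rewrite ?expr0// !exprS fcoef0M IH. Qed.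

Lemma agree1 n : agree n 1 (1 : fps R). Proof. exact: agree_const. Qed.

Lemma agreeM n p q f g : agree n p f -> agree n q g -> agree n (p * q) (f * g).
Proof. exact: agree_mul. Qed.

Lemma agreeXn n p f m : agree n p f -> agree n (p ^+ m) (f ^+ m).
Proof.
by move=> pf; elim: m => [|m IH]; rewrite ?expr0 ?exprS;
  [apply: agree1|apply: agreeM].
Qed.

Definition fX : fps R := Fps (fun n => (n == 1%N)%:R).

Lemma agreeX n : agree n 'X fX.
Proof. by move=> k _; rewrite coefX. Qed.

Lemma fcoefXM f n : (fX * f) n = if n is m.+1 then f m else 0.
Proof.
have /(_ n (leqnn _)) <- : agree n.+1 ('X * trunc n.+1 f) (fX * f).
  by apply: agreeM; [apply: agreeX|apply: agree_trunc].
rewrite coefXM; case: n => //= n.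
by rewrite (@agree_trunc _ f).
Qed.

Lemma fcoefXnM f m n : (fX ^+ m * f) n = if (m <= n)%N then f (n - m)%N else 0.
Proof.
elim: m n => [|m IH] n; first by rewrite mul1r subn0.
by rewrite exprS -mulrA fcoefXM; case: n => // n; rewrite IH.
Qed.

Definition fderiv f : fps R := Fps (fun n => f n.+1 *+ n.+1).

Lemma agree_deriv n p f : agree n.+1 p f -> agree n p^`() (fderiv f).
Proof. by move=> pf k kn; rewrite coef_deriv pf. Qed.

Lemma fderivD f g : fderiv (f + g) = fderiv f + fderiv g.
Proof. by apply: fpsP => n; rewrite /= mulrnDl. Qed.

Lemma fderivN f : fderiv (- f) = - fderiv f.
Proof. by apply: fpsP => n; rewrite /= mulNrn. Qed.

Lemma fderivC c : fderiv (fps_const c) = 0.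
Proof. by apply: fpsP => n; rewrite fcoef0 /= mul0rn. Qed.

Lemma fderiv1 : fderiv 1 = 0. Proof. exact: fderivC. Qed.

Lemma fderivX : fderiv fX = 1.
Proof. by apply: fpsP => -[|n]; rewrite /= ?mul0rn. Qed.

Lemma fderivM f g : fderiv (f * g) = fderiv f * g + f * fderiv g.
Proof.
apply: agree_ext => n; exists (trunc n.+1 f * trunc n.+1 g)^`().
  by apply: agree_deriv; apply: agreeM; apply: agree_trunc.
rewrite derivM; apply: agree_add; apply: agreeM;
  do ?[by apply: agree_deriv; apply: agree_trunc];
  exact: agreeW (leqnSn n) (@agree_trunc _ _).
Qed.

(** A composition when [g] has no constant term, as [g ^+ k] then starts in degree
    [k]. *)
Definition fcomp f g : fps R := Fps (fun n => \sum_(k < n.+1) f k * (g ^+ k) n).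

Lemma fcoef_exp_small g k n : g 0%N = 0 -> (n < k)%N -> (g ^+ k) n = 0.
Proof.
move=> g0; elim: k n => // k IH n nk; rewrite exprS fcoefM big1// => -[[|i] /= ni] _.
  by rewrite g0 mul0r.
rewrite IH ?mulr0//; rewrite ltnS in nk; apply: leq_trans nk.
by rewrite -subn_gt0 subnA ?subnn ?add0n.
Qed.

Lemma fcompE f g n N : g 0%N = 0 -> (n < N)%N ->
  fcomp f g n = \sum_(k < N) f k * (g ^+ k) n.
Proof.
move=> g0 nN; rewrite /= (big_ord_widen N (fun k => f k * (g ^+ k) n)) //.
rewrite big_mkcond; apply: eq_bigr => k _; case: ltnP => // nk.
by rewrite fcoef_exp_small ?mulr0.
Qed.

Lemma agree_comp n p (q : {poly R}) f g : g 0%N = 0 -> q`_0 = 0 ->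
  agree n p f -> agree n q g -> agree n (p \Po q) (fcomp f g).
Proof.
move=> g0 q0 pf qg k kn.
have q_small j : (k < j)%N -> (q ^+ j)`_k = 0.
  elim: j k {kn} => // j IH k kj; rewrite exprS coefM big1// => -[[|i] /= ki] _.
    by rewrite q0 mul0r.
  rewrite IH ?mulr0//; rewrite ltnS in kj; apply: leq_trans kj.
  by rewrite -subn_gt0 subnA ?subnn ?add0n.
set N := maxn n (size p).
rewrite (@fcompE _ _ _ N)//; last by rewrite leq_max kn.
rewrite comp_polyE coef_sum.
transitivity (\sum_(i < N) (p`_i *: q ^+ i)`_k).
  rewrite (big_ord_widen N (fun i => (p`_i *: q ^+ i)`_k)) ?leq_maxr//.
  rewrite [LHS]big_mkcond; apply: eq_bigr => i _; case: ltnP => // pi.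
  by rewrite coefZ [p`_i]nth_default// mul0r.
apply: eq_bigr => i _; rewrite coefZ; case: (leqP i k) => ik; last first.
  by rewrite q_small// fcoef_exp_small// !mulr0.
rewrite pf ?(leq_ltn_trans ik)//.
by rewrite (@agreeXn n q g).
Qed.

Lemma trunc0 n f : f 0%N = 0 -> (trunc n f)`_0 = 0.
Proof. by move=> f0; rewrite coef_poly f0 if_same. Qed.

Section Comp.
Variables (g : fps R) (g0 : g 0%N = 0).

Lemma agree_comp_trunc n f :
  agree n (trunc n f \Po trunc n g) (fcomp f g).
Proof.
by apply: agree_comp => //; [exact: trunc0|exact: agree_trunc|exact: agree_trunc].
Qed.

Lemma fcomp_coef0 f : fcomp f g 0%N = f 0%N.
Proof. by rewrite /= big_ord1 expr0 mulr1. Qed.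

Lemma fcompD f h : fcomp (f + h) g = fcomp f g + fcomp h g.
Proof.
by apply: fpsP => n /=; rewrite -big_split; apply: eq_bigr => i _; rewrite mulrDl.
Qed.

Lemma fcompN f : fcomp (- f) g = - fcomp f g.
Proof.
by apply: fpsP => n /=; rewrite -sumrN; apply: eq_bigr => i _; rewrite mulNr.
Qed.

Lemma fcompC c : fcomp (fps_const c) g = fps_const c.
Proof.
apply: fpsP => n /=; rewrite big_ord_recl /= big1 ?addr0; last first.
  by move=> i _; rewrite mul0r.
by case: n => [|n] /=; rewrite ?mulr1 ?mulr0.
Qed.

Lemma fcomp1 : fcomp 1 g = 1. Proof. exact: fcompC. Qed.

Lemma fcompX : fcomp fX g = g.
Proof.
apply: fpsP => -[|n] /=; first by rewrite big_ord1 mul0r g0.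
by rewrite 2!big_ord_recl /= mul0r add0r mul1r big1 ?addr0// => i _; rewrite mul0r.
Qed.

Lemma fcompM f h : fcomp (f * h) g = fcomp f g * fcomp h g.
Proof.
apply: agree_ext => n; exists ((trunc n f * trunc n h) \Po trunc n g).
  apply: agree_comp => //; [exact: trunc0| |exact: agree_trunc].
  by apply: agreeM; exact: agree_trunc.
by rewrite comp_polyM; apply: agreeM; exact: agree_comp_trunc.
Qed.

Lemma fcompXn f n : fcomp (f ^+ n) g = fcomp f g ^+ n.
Proof. by elim: n => [|n IH]; rewrite ?fcomp1// !exprS fcompM IH. Qed.

Lemma fcompA f h : h 0%N = 0 -> fcomp (fcomp f h) g = fcomp f (fcomp h g).
Proof.
move=> h0; apply: agree_ext => n.
have hg0 : (fcomp h g) 0%N = 0 by rewrite fcomp_coef0.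
exists ((trunc n f \Po trunc n h) \Po trunc n g).
  apply: agree_comp => //; [exact: trunc0| |exact: agree_trunc].
  by apply: agree_comp => //; [exact: trunc0|exact: agree_trunc|exact: agree_trunc].
rewrite -comp_polyA; apply: agree_comp => //.
- by rewrite -horner_coef0 horner_comp !horner_coef0 trunc0// horner_coef0 trunc0.
- exact: agree_trunc.
- exact: agree_comp_trunc.
Qed.

Lemma fderiv_comp f : fderiv (fcomp f g) = fcomp (fderiv f) g * fderiv g.
Proof.
apply: agree_ext => n; exists (trunc n.+1 f \Po trunc n.+1 g)^`().
  by apply: agree_deriv; exact: agree_comp_trunc.
rewrite deriv_comp; apply: agreeM; last by apply: agree_deriv; exact: agree_trunc.
apply: agree_comp => //; [exact: trunc0| |].
- by apply: agree_deriv; exact: agree_trunc.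
- exact: agreeW (leqnSn n) (@agree_trunc _ _).
Qed.

(** The coefficients of [f] are determined one after the other, [g ^+ n] having
    coefficient 1 in degree [n]. *)
Lemma fcomp_inj : g 1%N = 1 -> injective (fun f => fcomp f g).
Proof.
move=> g1 f h /= E; apply: fpsP => n.
have [u gu] : exists u, g = fX * u.
  exists (Fps (fun n => g n.+1)); apply: fpsP => -[|k]; rewrite fcoefXM //.
have u1 : u 0%N = 1 by rewrite -g1 gu fcoefXM.
have diag k : (g ^+ k) k = 1.
  by rewrite gu exprMn fcoefXnM leqnn subnn fcoef0X u1 expr1n.
elim/ltn_ind: n => n IH.
have := congr1 (fun h : fps R => h n) E.
rewrite /= !big_ord_recr /= !diag !mulr1.
rewrite (eq_bigr (fun i : 'I_n => h i * (g ^+ i) n)) => [/addrI//|i _].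
by rewrite IH.
Qed.

End Comp.

Definition fgeom : fps R := Fps (fun _ => 1).

Lemma fgeomE : (1 - fX) * fgeom = 1.
Proof.
apply: fpsP => n; rewrite mulrBl mul1r fcoefB fcoefXM.
by case: n => [|n] /=; rewrite ?subr0 ?subrr.
Qed.

(** The geometric series in [1 - f]. *)
Definition fps_inv f : fps R := fcomp fgeom (1 - f).

Lemma mul_fps_inv f : f 0%N = 1 -> f * fps_inv f = 1.
Proof.
move=> f0; have g0 : (1 - f) 0%N = 0 by rewrite fcoefB f0 subrr.
have := congr1 (fun h => fcomp h (1 - f)) fgeomE; rewrite /= fcompM// fcomp1//.
by rewrite fcompD fcompN fcomp1// fcompX// opprB addrC subrK.
Qed.

Lemma fps_lregl f : f 0%N = 1 -> injective (fun g => f * g).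
Proof.
move=> f0 g h /= E; rewrite -[g]mul1r -[h]mul1r -(mul_fps_inv f0).
by rewrite [f * _]mulrC -!mulrA E.
Qed.

End FpsRing.

(** * The moment equation *)

Section Wsum.
Variable R : comNzRingType.
Implicit Types (f g h : fps R) (b : nat -> fps R).

(** The series [\sum_n W_n z^n b_n]. *)
Definition graded_sum (W : fps R) b : fps R :=
  Fps (fun k => \sum_(n < k.+1) W n * b n (k - n)%N).

Lemma fcoef_mul_ext f g h n : (forall k, (k <= n)%N -> g k = h k) ->
  (f * g) n = (f * h) n.
Proof.
move=> gh; rewrite !fcoefM; apply: eq_bigr => i _; rewrite gh//.
exact: leq_subr.
Qed.

Lemma graded_sumE W b k N : (k < N)%N ->
  graded_sum W b k = (\sum_(n < N) fps_const (W n) * (fX R ^+ n * b n)) k.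
Proof.
move=> kN; rewrite fcoef_sum.
under eq_bigr do rewrite fcoefCM fcoefXnM.
rewrite /graded_sum /= (big_ord_widen N (fun n => W n * b n (k - n)%N))//.
rewrite big_mkcond; apply: eq_bigr => i _; rewrite ltnS.
by case: ifP; rewrite ?mulr0.
Qed.

Lemma mul_graded_sum f W b : f * graded_sum W b = graded_sum W (fun n => f * b n).
Proof.
apply: fpsP => k; rewrite (@graded_sumE _ _ _ k.+1)//.
rewrite (@fcoef_mul_ext _ _ (\sum_(n < k.+1) fps_const (W n) * (fX R ^+ n * b n))).
  rewrite mulr_sumr !fcoef_sum; apply: eq_bigr => i _.
  by apply: fcoef_eq; ring.
by move=> j jk; rewrite -graded_sumE.
Qed.

Lemma graded_sum_comp W f : graded_sum W (fun n => f ^+ n) = fcomp W (fX R * f).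
Proof.
apply: fpsP => k /=; apply: eq_bigr => i _; congr (_ * _).
by rewrite exprMn fcoefXnM -ltnS ltn_ord.
Qed.

(** Let [e = 1 / d], [w = 1 / x] and [w M = p' / (d p)].  Then [w ^ n] times the
    n-th of these series is [(D / d)^n p / p] with [D = d/dx]. *)
Fixpoint deformed_pow (e : R) (M : fps R) (n : nat) : fps R :=
  if n is n'.+1 then
    let b := deformed_pow e M n' in
    M * b - fps_const e * (b *+ n' + fX R * fderiv b)
  else 1.

Lemma deformed_powS e M n :
  deformed_pow e M n.+1 = M * deformed_pow e M n -
    fps_const e * (deformed_pow e M n *+ n + fX R * fderiv (deformed_pow e M n)).
Proof. by []. Qed.

End Wsum.

Section Ode.
Variables (F : fieldType) (d : F) (d0 : d != 0) (kappa : nat -> F) (E : fps F).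

(** The falling factorial of [d], divided by [d ^ k]. *)
Definition falling_product (k : nat) : F := \prod_(j < k) (1 - j%:R / d).

(** [z K(z)], for the cumulants [u]. *)
Definition cumulant_series (u : nat -> F) : fps F := Fps (fun n => if n is 0 then 1 else u n).
Definition R_series (u : nat -> F) : fps F := Fps (fun n => u n.+1).

Lemma cumulant_seriesE u : cumulant_series u = 1 + fX F * R_series u.
Proof.
by apply: fpsP => -[|n]; rewrite fcoefD fcoef1 fcoefXM /= ?addr0 ?add0r.
Qed.

Hypothesis hE : fderiv E = fps_const (- d) * (R_series kappa * E).

Let P : fps F := Fps (fun k => falling_product k * E k).

Variable M : fps F.
Hypothesis E0 : E 0%N = 1.
Hypothesis hM : fps_const d * ((M - 1) * P) = - (fX F * fderiv P).

Let b := deformed_pow d^-1 M.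

Lemma coef_XD (f : fps F) k : (fX F * fderiv f) k = f k *+ k.
Proof. by rewrite fcoefXM; case: k. Qed.

(** Multiplying by [P] turns the recursion of the deformed powers into a linear
    one, namely the differentiation of [p]. *)
Lemma mul_deformed_pow n k : (P * b n) k = E k * falling_product (n + k).
Proof.
elim: n k => [|n IH] k; first by rewrite mulr1 mulrC.
have PM : P * M = P - fps_const d^-1 * (fX F * fderiv P).
  rewrite -[_ * fderiv P]opprK -hM mulrN opprK [fps_const d^-1 * _]mulrA.
  have -> : fps_const d^-1 * fps_const d = 1.
    by apply: fpsP => i; rewrite fcoefCM fcoefC fcoef1 mulrnAr mulVf.
  by ring.
have -> : P * b n.+1 = P * b n - fps_const d^-1 * (P * b n *+ n + fX F * fderiv (P * b n)).
  rewrite /b deformed_powS -/b mulrBr mulrA PM fderivM; ring.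
rewrite fcoefB fcoefCM fcoefD fcoefMn coef_XD !IH addSn /falling_product big_ord_recr /=.
rewrite natrD; set x := \prod_(_ < _) _; ring.
Qed.

(** Let [p] be the polynomial with reversed coefficients [P].  It is
    [E (D / d) x^d], and the logarithmic derivative of [E] is given by [kappa], so
    that [x p' / d = p + sum_n kappa_n (D / d)^n p]; the claim is the quotient of
    this equation by [p]. *)
Lemma moment_series_equation : M = graded_sum (cumulant_series kappa) b.
Proof.
have P0 : P 0%N = 1 by rewrite /= /falling_product big_ord0 mul1r.
apply: (fps_lregl P0); apply: fpsP => k.
rewrite -[RHS]/((P * graded_sum _ b) k) mul_graded_sum -[LHS]/((P * M) k).
have -> : (P * M) k = P k - d^-1 * (P k *+ k).
  have := fcoef_eq k hM; rewrite fcoefCM mulrBl mul1r fcoefB [M * P]mulrC fcoefN coef_XD.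
  move=> h; rewrite -[X in _ - X]opprK -mulrN -h mulKf// opprK; ring.
rewrite -[RHS]/(\sum_(n < k.+1) cumulant_series kappa n * (P * b n) (k - n)%N).
have -> : \sum_(n < k.+1) cumulant_series kappa n * (P * b n) (k - n)%N =
    falling_product k * \sum_(n < k.+1) cumulant_series kappa n * E (k - n)%N.
  rewrite mulr_sumr; apply: eq_bigr => i _; rewrite mul_deformed_pow subnKC -1?ltnS//; ring.
have -> : \sum_(n < k.+1) cumulant_series kappa n * E (k - n)%N =
    E k - d^-1 * (E k *+ k).
  rewrite -fcoefM cumulant_seriesE mulrDl mul1r fcoefD; congr (_ + _).
  rewrite -mulrA fcoefXM; case: k => [|k]; first by rewrite mulr0n mulr0 oppr0.
  have := fcoef_eq k hE; rewrite fcoefCM /= => ->.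
  by rewrite mulNr mulrN opprK mulKf.
by rewrite /P /=; ring.
Qed.

End Ode.

(** * Expansions to the first order in 1/d *)

Section Ex1.
Variable R : realType.
Implicit Types (u v : nat -> R) (a b : R).

(** [u d = a0 + a1 / d + o(1 / d)]. *)
Definition expands u a0 a1 : Prop := d%:R * (u d - a0) @[d --> \oo] --> a1.

Lemma natr_invK : \forall d \near \oo, (d%:R : R)^-1 * d%:R = 1.
Proof. by exists 1%N => // d /= d1; rewrite mulVf// pnatr_eq0 -lt0n. Qed.

Lemma cvg_invn : (d%:R : R)^-1 @[d --> \oo] --> (0 : R).
Proof.
by rewrite -(cvg_shiftS (fun d => (d%:R : R)^-1)); exact: cvg_harmonic.
Qed.

Lemma expands_ext u v a0 a1 : (\forall d \near \oo, u d = v d) ->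
  expands u a0 a1 -> expands v a0 a1.
Proof.
move=> uv; apply: cvg_trans; apply: near_eq_cvg; near=> d.
by congr (_ * (_ - _)); near: d.
Unshelve. all: by end_near. Qed.

Lemma expands_cvg u a0 a1 : expands u a0 a1 -> u d @[d --> \oo] --> a0.
Proof.
move=> h.
have h0 : (d%:R : R)^-1 * (d%:R * (u d - a0)) + a0 @[d --> \oo] --> 0 * a1 + a0.
  by apply: cvgD; [exact: cvgM cvg_invn h|exact: cvg_cst].
rewrite mul0r add0r in h0; apply: cvg_trans h0.
apply: near_eq_cvg; near=> d; rewrite mulrA.
have -> : (d%:R : R)^-1 * d%:R = 1 by near: d; exact: natr_invK.
by rewrite mul1r subrK.
Unshelve. all: by end_near. Qed.

Lemma expands_uniq u a0 a1 b0 b1 :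
  expands u a0 a1 -> expands u b0 b1 -> a0 = b0 /\ a1 = b1.
Proof.
move=> ha hb; have E : a0 = b0.
  exact: (cvg_unique _ (expands_cvg ha) (expands_cvg hb)).
by split=> //; rewrite -E in hb; exact: (cvg_unique _ ha hb).
Qed.

Lemma expands_cst a : expands (fun=> a) a 0.
Proof.
rewrite /expands; under eq_fun do rewrite subrr mulr0.
exact: cvg_cst.
Qed.

Lemma expands_invn : expands (fun d => d%:R^-1) 0 1.
Proof.
apply: (@cvg_trans _ (nbhs (1 : R))) => //.
have : (fun=> 1 : R) @ \oo --> (1 : R) by exact: cvg_cst.
apply: cvg_trans; apply: near_eq_cvg; near=> d.
rewrite subr0 mulrC; apply/esym; near: d; exact: natr_invK.
Unshelve. all: by end_near. Qed.

Lemma expandsD u v a0 a1 b0 b1 : expands u a0 a1 -> expands v b0 b1 ->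
  expands (fun d => u d + v d) (a0 + b0) (a1 + b1).
Proof.
move=> ha hb; rewrite /expands.
rewrite (_ : (fun d => _) = fun d => d%:R * (u d - a0) + d%:R * (v d - b0)).
  exact: cvgD ha hb.
by apply/funext => d; ring.
Qed.

Lemma expandsN u a0 a1 : expands u a0 a1 -> expands (fun d => - u d) (- a0) (- a1).
Proof.
move=> ha; rewrite /expands.
rewrite (_ : (fun d => _) = fun d => - (d%:R * (u d - a0))); first exact: cvgN ha.
by apply/funext => d; ring.
Qed.

Lemma expandsM u v a0 a1 b0 b1 : expands u a0 a1 -> expands v b0 b1 ->
  expands (fun d => u d * v d) (a0 * b0) (a0 * b1 + a1 * b0).
Proof.
move=> ha hb; rewrite /expands addrC.
rewrite (_ : (fun d => _) =
  fun d => (d%:R * (u d - a0)) * v d + a0 * (d%:R * (v d - b0))).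
  by apply: cvgD; apply: cvgM => //; [exact: expands_cvg hb|exact: cvg_cst].
by apply/funext => d; ring.
Qed.

Lemma expandsMn u a0 a1 n : expands u a0 a1 ->
  expands (fun d => u d *+ n) (a0 *+ n) (a1 *+ n).
Proof.
move=> ha; elim: n => [|n IH].
  by rewrite !mulr0n; exact: expands_cst.
by under eq_fun do rewrite mulrS; rewrite !mulrS; exact: expandsD.
Qed.

Lemma expandsV u a0 a1 : a0 != 0 -> expands u a0 a1 ->
  expands (fun d => (u d)^-1) a0^-1 (- a1 * a0^-1 * a0^-1).
Proof.
move=> a00 ha; rewrite /expands.
have hu := expands_cvg ha.
have h : - (d%:R * (u d - a0)) * (u d)^-1 * a0^-1 @[d --> \oo] -->
    - a1 * a0^-1 * a0^-1.
  apply: cvgM; last exact: cvg_cst.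
  by apply: cvgM; [exact: cvgN|exact: cvgV].
apply: cvg_trans h; apply: near_eq_cvg; near=> d.
have ud : u d != 0.
  near: d; apply: (cvgr_neq0 a0) => //.
by field; rewrite ?ud ?a00.
Unshelve. all: by end_near. Qed.

Lemma expands_sum (I : Type) (s : seq I) (P : pred I) (u : I -> nat -> R) (a0 a1 : I -> R) :
  (forall i, P i -> expands (u i) (a0 i) (a1 i)) ->
  expands (fun d => \sum_(i <- s | P i) u i d)
    (\sum_(i <- s | P i) a0 i) (\sum_(i <- s | P i) a1 i).
Proof.
move=> h; elim: s => [|i s IH].
  under eq_fun do rewrite big_nil.
  by rewrite !big_nil; exact: expands_cst.
under eq_fun do rewrite big_cons; rewrite !big_cons.
by case: ifP => // Pi; apply: expandsD => //; exact: h.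
Qed.

Definition expandsF (f : nat -> fps R) (f0 f1 : fps R) : Prop :=
  forall n, expands (fun d => f d n) (f0 n) (f1 n).

Lemma expandsF_uniq f f0 f1 g0 g1 :
  expandsF f f0 f1 -> expandsF f g0 g1 -> f0 = g0 /\ f1 = g1.
Proof.
move=> hf hg; split; apply: fpsP => n;
  by have [] := expands_uniq (hf n) (hg n).
Qed.

Lemma expandsF_cst f : expandsF (fun=> f) f 0.
Proof. by move=> n; rewrite fcoef0; exact: expands_cst. Qed.

Lemma expandsFD f g f0 f1 g0 g1 : expandsF f f0 f1 -> expandsF g g0 g1 ->
  expandsF (fun d => f d + g d) (f0 + g0) (f1 + g1).
Proof. by move=> hf hg n; exact: expandsD. Qed.

Lemma expandsFN f f0 f1 : expandsF f f0 f1 ->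
  expandsF (fun d => - f d) (- f0) (- f1).
Proof. by move=> hf n; exact: expandsN. Qed.

Lemma expandsFMn f f0 f1 m : expandsF f f0 f1 ->
  expandsF (fun d => f d *+ m) (f0 *+ m) (f1 *+ m).
Proof.
move=> hf n; rewrite !fcoefMn; under eq_fun do rewrite fcoefMn.
exact: expandsMn.
Qed.

Lemma expandsFM f g f0 f1 g0 g1 : expandsF f f0 f1 -> expandsF g g0 g1 ->
  expandsF (fun d => f d * g d) (f0 * g0) (f0 * g1 + f1 * g0).
Proof.
move=> hf hg n; rewrite fcoefD !fcoefM -big_split /=.
by apply: expands_sum => i _; exact: expandsM.
Qed.

Lemma expandsF_deriv f f0 f1 : expandsF f f0 f1 ->
  expandsF (fun d => fderiv (f d)) (fderiv f0) (fderiv f1).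
Proof. by move=> hf n; exact: expandsMn. Qed.

Lemma expandsF_const u a0 a1 : expands u a0 a1 ->
  expandsF (fun d => fps_const (u d)) (fps_const a0) (fps_const a1).
Proof. by move=> h [|n] //=; exact: expands_cst. Qed.

Lemma expandsF_graded_sum (W : nat -> fps R) (b : nat -> nat -> fps R)
    (W0 W1 : fps R) (b0 b1 : nat -> fps R) :
  expandsF W W0 W1 -> (forall n, expandsF (b n) (b0 n) (b1 n)) ->
  expandsF (fun d => graded_sum (W d) (fun n => b n d)) (graded_sum W0 b0)
    (graded_sum W0 b1 + graded_sum W1 b0).
Proof.
move=> hW hb k; rewrite fcoefD /= -big_split /=.
by apply: expands_sum => i _; apply: expandsM; [exact: hW|exact: hb].
Qed.

(** The derivation produces one term for each pair of factors of [M0 ^+ n], whence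
    the binomial coefficient. *)
Lemma expands_deformed_pow (e : nat -> R) theta M M0 M1 n :
  expands e 0 theta -> expandsF M M0 M1 ->
  expandsF (fun d => deformed_pow (e d) (M d) n) (M0 ^+ n)
    (M0 ^+ n.-1 * M1 *+ n -
     fps_const theta * (M0 ^+ n.-2 * (M0 + fX R * fderiv M0) *+ 'C(n, 2))).
Proof.
move=> he hM; elim: n => [|n IH].
  rewrite !mulr0n mulr0 subr0 expr0; exact: expandsF_cst.
have hc := expandsF_const he.
have hX := expandsF_cst (fX R).
have := expandsFD (expandsFM hM IH)
  (expandsFN (expandsFM hc (expandsFD (@expandsFMn _ _ _ n IH) (expandsFM hX (expandsF_deriv IH))))).
have fderivXn (f : fps R) m : fderiv (f ^+ m) = f ^+ m.-1 * fderiv f *+ m.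
  elim: m => [|m IHm]; first by rewrite fderiv1 mulr0n.
  rewrite exprS fderivM IHm; case: m {IHm} => [|m] /=; first by rewrite !expr0 mulr0n mulr0 addr0 mulrC mulr1n.
  rewrite exprS; ring.
have -> : fps_const (0 : R) = 0 by apply: fpsP => -[].
rewrite !mul0r oppr0 addr0 -exprS.
under eq_fun do rewrite -deformed_powS.
congr expandsF; rewrite fderivXn.
case: n {IH} => [|[|n]].
- by rewrite !bin_small//= !expr0 !mulr0n; ring.
- by rewrite binn bin_small//= !expr0 !expr1; ring.
- rewrite [in RHS]binS bin1; move: 'C(n.+2, 2) => c /=.
  by rewrite !exprS mulrnDr; ring.
Qed.
End Ex1.

(** * The moment equation to the first order *)

Section Alg.
Variable R : comNzRingType.
Implicit Types (f g W : fps R) (b : nat -> fps R).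

Definition half_deriv2 W : fps R := Fps (fun n => W n.+2 *+ 'C(n.+2, 2)).

Lemma fcoef_graded_sum W b k : graded_sum W b k = \sum_(n < k.+1) W n * b n (k - n)%N.
Proof. by []. Qed.

Lemma graded_sumD W b b' : graded_sum W (fun n => b n + b' n) = graded_sum W b + graded_sum W b'.
Proof.
by apply: fpsP => k; rewrite fcoefD /= -big_split; apply: eq_bigr => i _; rewrite mulrDr.
Qed.

Lemma graded_sum_mulr W b f : graded_sum W (fun n => b n * f) = graded_sum W b * f.
Proof.
rewrite mulrC mul_graded_sum; congr graded_sum; apply/funext => n; exact: mulrC.
Qed.

Lemma graded_sum_deriv W b :
  graded_sum W (fun n => b n.-1 *+ n) = fX R * graded_sum (fderiv W) b.
Proof.
apply: fpsP => k; rewrite fcoefXM fcoef_graded_sum big_ord_recl mulr0n fcoef0 mulr0 add0r.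
case: k => [|k]; first by rewrite big_ord0.
rewrite fcoef_graded_sum.
by apply: eq_bigr => i _; rewrite fcoefMn /= mulrnAl mulrnAr.
Qed.

Lemma graded_sum_half_deriv2 W b :
  graded_sum W (fun n => b n.-2 *+ 'C(n, 2)) = fX R ^+ 2 * graded_sum (half_deriv2 W) b.
Proof.
apply: fpsP => k; rewrite fcoefXnM !fcoef_graded_sum.
case: k => [|[|k]].
- by rewrite big_ord1 bin_small// mulr0n fcoef0 mulr0.
- by rewrite 2!big_ord_recl big_ord0 !bin_small// !mulr0n !fcoef0 !mulr0 !addr0.
rewrite [LHS]big_ord_recl [X in _ + X]big_ord_recl !bin_small// !mulr0n !fcoef0.
rewrite !mulr0 !add0r /= subn2; apply: eq_bigr => i _.
by rewrite fcoefMn mulrnAl mulrnAr.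
Qed.

Section FixedPoint.
Variables (M W : fps R).
Let X := fX R.
Let y := X * M.
Hypothesis hM : M = fcomp W y.
Hypothesis W0 : W 0%N = 1.

(** This is [- z ^ 2 K'(z)] for [K = W / z]. *)
Definition neg_K_deriv : fps R := W - X * fderiv W.

Let y0 : y 0%N = 0. Proof. by rewrite fcoefXM. Qed.
Let M0 : M 0%N = 1. Proof. by rewrite hM fcomp_coef0. Qed.
Let y1 : y 1%N = 1. Proof. by rewrite fcoefXM. Qed.

Lemma fixpoint_inj : injective (fun f => fcomp f y).
Proof. exact: fcomp_inj. Qed.

Lemma neg_K_deriv_comp : fcomp neg_K_deriv y = M * (1 - X * fcomp (fderiv W) y).
Proof.
by rewrite fcompD fcompN fcompM// fcompX// -hM /y; ring.
Qed.

Lemma neg_K_deriv0 : neg_K_deriv 0%N = 1.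
Proof. by rewrite fcoefB fcoefXM subr0. Qed.

(** Implicit differentiation of [y = z W(y)]. *)
Lemma deriv_fixpoint : fderiv y * (1 - X * fcomp (fderiv W) y) = M.
Proof.
have dM : fderiv M = fcomp (fderiv W) y * fderiv y by rewrite {1}hM fderiv_comp.
have E : fderiv y = M + X * (fcomp (fderiv W) y * fderiv y).
  by rewrite -dM fderivM fderivX mul1r.
by rewrite mulrBr mulr1 {1}E; ring.
Qed.

(** The series [y] is the inverse of [1 / K] under composition. *)
Lemma fixpoint_inverse : fcomp (X * fps_inv W) y = X.
Proof.
have iM : M * fcomp (fps_inv W) y = 1.
  by rewrite {1}hM -fcompM// mul_fps_inv// fcomp1.
by rewrite fcompM// fcompX// /y -mulrA iM mulr1.
Qed.

(** Only the second derivative survives in the difference of the two expressions of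
    [M1]; it is expressed through [y] by [deriv_fixpoint], and [y] is then
    removed by [fixpoint_inj]. *)
Lemma first_order_difference M1 R1 W1 :
  M1 = fcomp R1 y + X * M1 * fcomp (fderiv W) y ->
  M1 = fcomp W1 y + X * M1 * fcomp (fderiv W) y
     - X ^+ 2 * fcomp (half_deriv2 W) y * fderiv y ->
  neg_K_deriv * (R1 - W1) = - (X ^+ 2 * half_deriv2 W).
Proof.
move=> hR hW; apply: fixpoint_inj => /=.
rewrite fcompN (fcompM y0 neg_K_deriv) (fcompM y0 (X ^+ 2)) fcompD fcompN fcompXn// fcompX//.
have -> : fcomp R1 y - fcomp W1 y = - (X ^+ 2 * fcomp (half_deriv2 W) y * fderiv y).
  have -> : fcomp R1 y = M1 - X * M1 * fcomp (fderiv W) y.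
    by rewrite {1}hR; ring.
  by rewrite {1}hW; ring.
rewrite neg_K_deriv_comp mulrN; congr (- _).
transitivity (M * X ^+ 2 * fcomp (half_deriv2 W) y *
  (fderiv y * (1 - X * fcomp (fderiv W) y))); first ring.
by rewrite deriv_fixpoint /y; ring.
Qed.

(** The hypothesis is the first-order equation for constant cumulants and
    [M1 = - h]; the composition with [1 / K] undoes that with [y]. *)
Lemma first_order_inverse h :
  h * (1 - X * fcomp (fderiv W) y) = X ^+ 2 * fcomp (half_deriv2 W) y * fderiv y ->
  neg_K_deriv ^+ 2 * fcomp (X * h) (X * fps_inv W) = X ^+ 3 * half_deriv2 W.
Proof.
move=> hh; apply: fixpoint_inj => /=.
rewrite (fcompM y0 (neg_K_deriv ^+ 2)) (fcompM y0 (X ^+ 3)) !fcompXn// fcompX// fcompA//; last by rewrite fcoefXM.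
rewrite fixpoint_inverse fcompM; last by [].
have -> : fcomp h X = h.
  apply: fpsP => n; rewrite /= big_ord_recr /= big1 ?add0r.
    by rewrite -[X ^+ n]mulr1 fcoefXnM leqnn subnn mulr1.
  move=> i _; rewrite -[X ^+ i]mulr1 fcoefXnM fcoef1.
  by rewrite subn_eq0 [(n <= i)%N]leqNgt ltn_ord if_same mulr0.
rewrite fcompX// neg_K_deriv_comp.
transitivity (M ^+ 2 * (1 - X * fcomp (fderiv W) y) * X *
   (h * (1 - X * fcomp (fderiv W) y))); first ring.
rewrite hh.
transitivity (M ^+ 2 * X ^+ 3 * fcomp (half_deriv2 W) y *
  (fderiv y * (1 - X * fcomp (fderiv W) y))); first ring.
by rewrite deriv_fixpoint /y; ring.
Qed.

End FixedPoint.
End Alg.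

Section FirstOrder.
Variable R : realType.

(** The terms of order 0 and 1 in 1/d of the moment equation, [theta] being the
    strength of the derivation in the deformed powers. *)
Lemma first_order_equation (e : nat -> R) theta (M W : nat -> fps R) M0 M1 W0 W1 :
  expands e 0 theta -> expandsF M M0 M1 -> expandsF W W0 W1 ->
  (forall d, (0 < d)%N -> M d = graded_sum (W d) (deformed_pow (e d) (M d))) ->
  let y := fX R * M0 in
  M0 = fcomp W0 y /\
  M1 = fcomp W1 y + fX R * M1 * fcomp (fderiv W0) y
       - fps_const theta * (fX R ^+ 2 * fcomp (half_deriv2 W0) y * fderiv y).
Proof.
move=> he hM hW ME /=.
have hS := expandsF_graded_sum hW (fun n => @expands_deformed_pow R _ _ _ _ _ n he hM).
have hM' : expandsF (fun d => graded_sum (W d) (deformed_pow (e d) (M d))) M0 M1.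
  move=> n; apply: expands_ext (hM n).
  by exists 1%N => // d d0; apply: fcoef_eq; exact: ME.
have [E0 E1] := expandsF_uniq hM' hS.
split; first by rewrite {1}E0 graded_sum_comp.
rewrite {1}E1 graded_sum_comp addrC -addrA; congr (_ + _).
under [in LHS]eq_fun do rewrite -mulrN.
rewrite graded_sumD (graded_sum_deriv W0 (fun n => M0 ^+ n * M1)) graded_sum_mulr graded_sum_comp.
congr (_ + _); first by ring.
transitivity (graded_sum W0 (fun n => (M0 ^+ n.-2 * (- fps_const theta *
    (M0 + fX R * fderiv M0))) *+ 'C(n, 2))).
  by congr graded_sum; apply/funext => n; ring.
rewrite (graded_sum_half_deriv2 W0 (fun n => M0 ^+ n * _)) graded_sum_mulr graded_sum_comp.
by rewrite fderivM fderivX mul1r; ring.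
Qed.

End FirstOrder.

(** * Generating series *)

Section NCSeries.
Variable R : comNzRingType.
Implicit Types (r psi : nat -> R).

Definition nc_series r : fps R := Fps (fun n => \sum_(P in NC n) \prod_(V in P) r #|V|).

(** The cut at the successor of the first point is repeated along the first block;
    a block of size k leaves k independent intervals. *)
Lemma nc_series_fixpoint r :
  nc_series r = fcomp (Fps (extend1 r)) (fX R * nc_series r).
Proof.
set M := nc_series r; have ME n : M n = nc_total r n (extend1 r) by rewrite /M /= sum_NC.
suff E n psi : nc_total r n psi = fcomp (Fps psi) (fX R * M) n.
  by apply: fpsP => n; rewrite -E ME.
have y0 : (fX R * M) 0%N = 0 by rewrite fcoefXM.
elim/ltn_ind: n psi => -[|n] IH psi; first by rewrite nc_total0 fcomp_coef0.
have -> : Fps psi = fps_const (psi 0%N) + fX R * Fps (psi \o succn).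
  by apply: fpsP => -[|k]; rewrite fcoefD fcoefXM /= ?addr0 ?add0r.
rewrite fcompD fcompC fcompM// fcompX// fcoefD -mulrA fcoefXM fcoefC mulr0n add0r.
rewrite nc_totalS fcoefM; apply: eq_bigr => i _.
by rewrite -ME IH// ltnS leq_subr.
Qed.
End NCSeries.

Section Egf.
Variable F : numFieldType.
Implicit Types (f g u phi : nat -> F) (a b : fps F).

Definition egf u : fps F := Fps (fun n => u n / (n`!)%:R).

Lemma fact_neq0 n : (n`!)%:R != 0 :> F.
Proof. by rewrite pnatr_eq0 -lt0n fact_gt0. Qed.

Lemma fderiv_egf u : fderiv (egf u) = egf (u \o succn).
Proof.
apply: fpsP => n /=; rewrite -[LHS]mulr_natr factS natrM invfM mulrA mulrAC.
by rewrite mulfVK// pnatr_eq0.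
Qed.

Lemma egfM u g f : (forall n, f n = \sum_(j < n.+1) (u j * g (n - j)%N) *+ 'C(n, j)) ->
  egf f = egf u * egf g.
Proof.
move=> fE; apply: fpsP => n; rewrite fcoefM /= fE mulr_suml.
apply: eq_bigr => j _; have jn : (j <= n)%N by rewrite -ltnS.
rewrite -(bin_fact jn) !natrM -[u j * _ *+ _]mulr_natr.
have C0 : 'C(n, j)%:R != 0 :> F by rewrite pnatr_eq0 -lt0n bin_gt0.
by field; rewrite ?fact_neq0 ?C0.
Qed.

Lemma fderiv_perm_total f : fderiv (egf (perm_total f)) = R_series f * egf (perm_total f).
Proof.
rewrite fderiv_egf -[R_series f](_ : egf (fun j => f j.+1 *+ j`!) = _); last first.
  by apply: fpsP => n /=; rewrite -[f _ *+ _]mulr_natr mulfK// fact_neq0.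
by apply: egfM => n; exact: perm_totalS.
Qed.

Lemma fderiv_connected_total f g :
  fderiv (egf (fun n => perm_total f n * perm_total g n)) =
  egf (connected_total f g \o succn) * egf (fun n => perm_total f n * perm_total g n).
Proof. by rewrite fderiv_egf; apply: egfM => n; exact: connected_totalS. Qed.

Lemma perm_total_const (x : F) n : perm_total (fun=> x) n = \prod_(i < n) (x + i%:R).
Proof.
have E := fderiv_perm_total (fun=> x); set e := egf _ in E.
have E' : fderiv e - fX F * fderiv e = fps_const x * e.
  have sE : R_series (fun=> x) = fps_const x * fgeom F.
    by apply: fpsP => k; rewrite fcoefCM /= mulr1.
  transitivity (fps_const x * ((1 - fX F) * fgeom F) * e); first by rewrite E sE; ring.
  by rewrite fgeomE mulr1.
elim: n => [|n IH]; first by rewrite big_ord0 perm_total0.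
rewrite big_ord_recr /= -IH; have := fcoef_eq n E'.
rewrite fcoefB coef_XD fcoefCM /e fderiv_egf /= -mulrnAl -mulrBl mulrA.
move/(mulIf (_ : _ != 0)); rewrite invr_eq0 fact_neq0 => /(_ isT) h.
by rewrite -[LHS](subrK (perm_total (fun=> x) n *+ n)) h -mulr_natr; ring.
Qed.

(** Both sides have the same derivative, up to a shift of [phi]: differentiating
    removes the block of the first point. *)
Lemma egf_partition_total phi u :
  egf (partition_total phi u) = fcomp (egf phi) (egf (fun n => if n is 0 then 0 else u n)).
Proof.
set U := egf (fun n => if n is 0 then 0 else u n); have U0 : U 0%N = 0 by rewrite /U /= mul0r.
apply: fpsP => n; elim/ltn_ind: n phi => -[|n] IH phi.
  by rewrite fcomp_coef0 //= partition_total0.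
have n1 : n.+1%:R != 0 :> F by rewrite pnatr_eq0.
apply: (mulIf n1); rewrite !mulr_natr -![_ *+ n.+1]/(fderiv _ n).
rewrite fderiv_comp// !fderiv_egf mulrC.
have -> : egf (partition_total phi u \o succn) = fderiv U * egf (partition_total (phi \o succn) u).
  by rewrite /U fderiv_egf; apply: egfM => k; exact: partition_totalS.
rewrite -fderiv_egf !fcoefM; apply: eq_bigr => i _.
by rewrite IH ?fderiv_egf// ltnS leq_subr.
Qed.

(** The Moebius function of the partition lattice, between a partition with k blocks
    and the coarsest one. *)
Definition log_weight (k : nat) : F := (-1) ^+ k.-1 * (k.-1)`!%:R.

(** The weights are the coefficients of the exponential series of [log (1 + z)]. *)
Lemma fderiv_log e : e 0%N = 1 ->
  fderiv (egf e) = egf (partition_total log_weight e \o succn) * egf e.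
Proof.
move=> e0; set U := egf (fun n => if n is 0 then 0 else e n).
have U0 : U 0%N = 0 by rewrite /U /= mul0r.
have eU : egf e = 1 + U.
  apply: fpsP => -[|n]; rewrite fcoefD fcoef1 /= ?add0r//.
  by rewrite e0 mul0r addr0 fact0 divr1.
have L : egf (partition_total log_weight e \o succn) = fcomp (Fps (fun n => (-1) ^+ n)) U * fderiv U.
  rewrite -fderiv_egf egf_partition_total fderiv_comp// (fderiv_egf log_weight).
  congr (fcomp _ _ * _); apply: fpsP => n /=.
  by rewrite /log_weight /= mulfK// fact_neq0.
have G : (1 + fX F) * Fps (fun n => (-1) ^+ n) = 1.
  apply: fpsP => n; rewrite mulrDl mul1r fcoefD fcoefXM fcoef1.
  by case: n => [|n] /=; rewrite ?addr0// exprS; ring.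
have G' : egf e * fcomp (Fps (fun n => (-1) ^+ n)) U = 1.
  have UE : fcomp (1 + fX F) U = 1 + U by rewrite fcompD fcomp1 fcompX.
  by rewrite eU -UE -fcompM// G fcomp1.
rewrite L mulrAC [fcomp _ _ * _]mulrC G' mul1r eU fderivD fderiv1 add0r.
by [].
Qed.

Definition rescale c a : fps F := Fps (fun n => c ^+ n * a n).

Lemma rescaleM c a b : rescale c (a * b) = rescale c a * rescale c b.
Proof.
apply: fpsP => n; rewrite /= mulr_sumr; apply: eq_bigr => i _.
by rewrite mulrACA -exprD subnKC// -ltnS.
Qed.

Lemma fderiv_rescale c a : fderiv (rescale c a) = fps_const c * rescale c (fderiv a).
Proof. by apply: fpsP => n; rewrite fcoefCM /= exprS -mulrA !mulrnAr. Qed.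

End Egf.

(** * The series of annular sums *)

Lemma fps_constM (R : comNzRingType) (a b : R) :
  fps_const (a * b) = fps_const a * fps_const b.
Proof. by apply: fpsP => n; rewrite fcoefCM !fcoefC mulrnAr. Qed.

Lemma fps_constN (R : comNzRingType) (a : R) : fps_const (- a) = - fps_const a.
Proof. by apply: fpsP => n; rewrite fcoefN !fcoefC mulNrn. Qed.

Section Annular.
Variables (R : realType) (r : nat -> R).

Section FixedDegree.
Variables (d : R) (d0 : d != 0).
Let c := (- d)^-1.
Let f k := - d * r k.
Let g (k : nat) := - d.

(** The moment series with cumulants [r] in degree [d], as a sum over the transitive
    pairs of permutations. *)
Definition genus_series : fps R :=
  1 + fX R * (fps_const (c ^+ 2) * rescale c (egf (connected_total f g \o succn))).

Lemma perm_total_falling n : perm_total g n = (- d) ^+ n * falling_product d n.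
Proof.
rewrite perm_total_const /falling_product.
elim: n => [|n IH]; first by rewrite !big_ord0 mulr1.
by rewrite !big_ord_recr /= IH exprSr; field.
Qed.

Lemma genus_series_equation : genus_series = graded_sum (cumulant_series r) (deformed_pow d^-1 genus_series).
Proof.
pose E := egf (perm_total f); pose A := egf (fun n => perm_total f n * perm_total g n).
have E0 : E 0%N = 1 by rewrite /E /= perm_total0 fact0 divr1.
have hE : fderiv E = fps_const (- d) * (R_series r * E).
  rewrite /E fderiv_perm_total mulrA; congr (_ * _).
  by apply: fpsP => n; rewrite fcoefCM.
have c0 : c * - d = 1 by rewrite /c mulVf ?oppr_eq0.
have PE : Fps (fun k => falling_product d k * E k) = rescale c A.
  apply: fpsP => n; rewrite /E /A /= perm_total_falling.
  transitivity ((c * - d) ^+ n * (falling_product d n * (perm_total f n / n`!%:R))).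
    by rewrite c0 expr1n mul1r.
  by rewrite exprMn; ring.
apply: (moment_series_equation d0 hE E0); rewrite PE fderiv_rescale fderiv_connected_total rescaleM -/A.
rewrite /genus_series addrC addKr.
have cd : fps_const d * fps_const (c ^+ 2) = - fps_const c.
  rewrite -fps_constM -fps_constN; congr fps_const.
  by rewrite expr2 mulrA -[d * c]opprK -mulNr [- d * c]mulrC c0 mulN1r.
transitivity (fps_const d * fps_const (c ^+ 2) * (fX R * (rescale c (egf (connected_total f g \o succn)) *
  rescale c A))); first by ring.
by rewrite cd; ring.
Qed.

End FixedDegree.

Lemma expands_negpow j :
  expands (fun d => ((- d%:R)^-1 : R) ^+ j) (j == 0%N)%:R (- (j == 1%N)%:R).
Proof.
elim: j => [|j IH]; first by rewrite oppr0; exact: expands_cst.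
have h : expands (fun d => (- d%:R)^-1 : R) 0 (-1).
  rewrite (_ : (fun d => _) = fun d => - (d%:R)^-1); last first.
    by apply/funext => d; rewrite invrN.
  by rewrite -[0]oppr0; exact: expandsN (@expands_invn R).
rewrite (_ : (fun d => _) = fun d => (- d%:R)^-1 * (- d%:R)^-1 ^+ j); last first.
  by apply/funext => d; rewrite exprS.
have := expandsM h IH; rewrite !mul0r add0r mulN1r eqSS.
by [].
Qed.

(** A transitive pair of permutations of n points contributes to the order n + 1
    minus its number of cycles in 1/d, which is nonnegative by the Euler
    inequality; the order 1 is the annular case. *)
Lemma expands_genus_series : exists M0,
  expandsF (fun d => genus_series d%:R) M0 (- Fps (annular_sum r)).
Proof.
pose T (n : nat) (p : {perm 'I_n.+1} * {perm 'I_n.+1}) :=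
   [transitive <<[set p.1; p.2]%SET>>%g, on [set: 'I_n.+1]%SET | 'P].
pose k n (p : {perm 'I_n} * {perm 'I_n}) := (#|porbits p.1| + #|porbits p.2|)%N.
pose w n (p : {perm 'I_n} * {perm 'I_n}) := \prod_(b in porbits p.1) r #|b|.
exists (Fps (fun n => if n is n'.+1 then
  \sum_(p | T n' p) ((n'.+2 - k _ p == 0)%N%:R * w _ p) / n'`!%:R else 1)).
case=> [|n].
  rewrite fcoefN (_ : Fps (annular_sum r) 0%N = 0) ?oppr0; last first.
    by rewrite /= /annular_sum big_geq// mulr0.
  rewrite (_ : (fun d => _) = fun=> 1); last first.
    by apply/funext => d; rewrite /genus_series fcoefD fcoefXM addr0.
  exact: expands_cst.
have E d : (0 < d)%N -> genus_series d%:R n.+1 =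
    \sum_(p | T n p) ((- d%:R)^-1 ^+ (n.+2 - k _ p) * w _ p) / n`!%:R.
  move=> dp; have d0 : (d%:R : R) != 0 by rewrite pnatr_eq0 -lt0n.
  rewrite /genus_series fcoefD fcoef1 add0r fcoefXM fcoefCM /=.
  rewrite connected_total_genus !mulr_suml !mulr_sumr; apply: eq_bigr => p tr.
  rewrite -/(w _ p) -/(k _ p) !mulrA; congr (_ * _ * _).
  have kn : (k _ p <= n.+2)%N by exact: transitive_porbits_le.
  rewrite -exprD !addSn add0n -{1}(subnK kn) exprD -mulrA -exprMn mulVf ?oppr_eq0//.
  by rewrite expr1n mulr1.
apply: (@expands_ext R (fun d => \sum_(p | T n p)
    ((- d%:R)^-1 ^+ (n.+2 - k _ p) * w _ p) / n`!%:R)).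
  by exists 1%N => // d d1; apply/esym; exact: E.
have := @expands_sum R _ (index_enum _) (T n) (fun p d =>
  ((- d%:R)^-1 ^+ (n.+2 - k _ p) * w _ p) / n`!%:R)
  (fun p => ((n.+2 - k _ p == 0)%N%:R * w _ p) / n`!%:R)
  (fun p => (- (n.+2 - k _ p == 1)%N%:R * w _ p) / n`!%:R).
have -> : (- Fps (annular_sum r)) n.+1 =
    \sum_(p | T n p) (- (n.+2 - k _ p == 1)%N%:R * w _ p) / n`!%:R.
  rewrite fcoefN /=; have := sum_transitive_pairs r (ltn0Sn n).
  rewrite big_mkcondr /= => H.
  apply: (mulIf (fact_neq0 R n)); rewrite mulNr mulr_natr -H mulr_suml -sumrN.
  apply: eq_bigr => p tr; rewrite mulfVK ?fact_neq0// mulNr; congr (- _).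
  have kn : (k _ p <= n.+2)%N by exact: transitive_porbits_le.
  rewrite -/(k _ p) -/(w _ p).
  have -> : ((n.+2 - k _ p == 1) = (k _ p == n.+1))%N by lia.
  by case: eqP => _; rewrite ?mul1r ?mul0r.
apply=> p tr.
have := expandsM (expandsM (@expands_negpow (n.+2 - k _ p)%N) (@expands_cst R (w _ p)))
  (@expands_cst R (n`!%:R^-1)).
by rewrite !mulr0 !add0r.
Qed.

(** The term of order 1 of the moments is known from the permutations on the one
    hand and from the moment equation on the other. *)
Lemma annular_sum_inverse :
  let W := cumulant_series r in
  neg_K_deriv W ^+ 2 * fcomp (fX R * Fps (annular_sum r)) (fX R * fps_inv W) =
  fX R ^+ 3 * half_deriv2 W.
Proof.
move=> W; have [M0 hM] := expands_genus_series; set h := Fps _ in hM *.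
have Md d : (0 < d)%N -> genus_series d%:R = graded_sum W (deformed_pow d%:R^-1 (genus_series d%:R)).
  by move=> d0; apply: genus_series_equation; rewrite pnatr_eq0 -lt0n.
have [hM0] := first_order_equation (@expands_invn R) hM (expandsF_cst W) Md.
have -> : fps_const (1 : R) = 1 by [].
set y := fX R * M0; have -> : fcomp 0 y = 0 by exact: fcompC.
move=> hh; apply: (first_order_inverse hM0) => //.
rewrite -/y mulrBr mulr1 -[in LHS](opprK h) {1}hh; ring.
Qed.
End Annular.

(** * Moments and cumulants of real-rooted polynomials *)

Section RealRooted.
Variable R : realType.
Implicit Types (s : seq R) (x : R).

Definition root_poly s : {poly R} := \prod_(x <- s) ('X - x%:P).
Definition rev_root_series s : fps R := \prod_(x <- s) (1 - fps_const x * fX R).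
Definition geometric_series x : fps R := Fps (fun n => x ^+ n).

Lemma geometric_seriesE x : (1 - fps_const x * fX R) * geometric_series x = 1.
Proof.
apply: fpsP => n; rewrite mulrBl mul1r -mulrA fcoefB fcoefCM fcoefXM fcoef1.
by case: n => [|n] /=; rewrite ?mulr0 ?subr0// exprS subrr.
Qed.

Lemma rev_root_seriesE s k : rev_root_series s k =
  if (k <= size s)%N then (root_poly s)`_(size s - k) else 0.
Proof.
elim: s k => [|x s IH] k.
  rewrite /rev_root_series /root_poly !big_nil fcoef1 /= leqn0.
  by case: eqP => // ->; rewrite coef1.
rewrite /rev_root_series /root_poly !big_cons -/(root_poly s) -/(rev_root_series s).
rewrite mulrBl mul1r -mulrA fcoefB fcoefCM fcoefXM [size _]/= mulrBl coefB coefXM coefCM.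
have top : (root_poly s)`_(size s).+1 = 0.
  by rewrite nth_default// size_prod_XsubC.
case: k => [|k].
  by rewrite IH /= !subn0 mulr0 !subr0 top mulr0 subr0.
rewrite !IH subSS ltnS; case: ltngtP => [ks|ks|->].
- by have -> : (size s - k = (size s - k.+1).+1)%N by lia.
- by rewrite mulr0 subr0.
- by rewrite subnn sub0r.
Qed.

Lemma rev_root_series_deriv s :
  (\sum_(x <- s) (geometric_series x - 1)) * rev_root_series s =
  - (fX R * fderiv (rev_root_series s)).
Proof.
elim: s => [|x s IH].
  by rewrite /rev_root_series !big_nil fderiv1 mul0r mulr0 oppr0.
rewrite /rev_root_series !big_cons -/(rev_root_series s).
set a := 1 - _; set P := rev_root_series s; rewrite fderivM.
have da : fderiv a = - fps_const x.
  rewrite /a fderivD fderivN fderiv1 fderivM fderivC fderivX; ring.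
rewrite mulrDl [(geometric_series x - 1) * _]mulrA mulrBl [geometric_series x * a]mulrC.
rewrite geometric_seriesE mul1r mulrCA IH da /a; ring.
Qed.

Lemma mup_root_poly s x : mup x (root_poly s) = count_mem x s.
Proof.
elim: s => [|y s IH]; rewrite /root_poly ?big_nil ?big_cons /=.
  by rewrite mupNroot// rootC oner_eq0.
rewrite mupM ?polyXsubC_eq0// -?size_poly_eq0 ?size_prod_XsubC// -/(root_poly s) IH.
by rewrite -['X - _]expr1 mup_XsubCX; case: eqP.
Qed.

Lemma falling_ffact d k : (k <= d)%N -> (0 < d)%N ->
  falling_product (d%:R : R) k * d%:R ^+ k = (d ^_ k)%:R.
Proof.
move=> + d0; have dR : (d%:R : R) != 0 by rewrite pnatr_eq0 -lt0n.
elim: k => [|k IH] kd; first by rewrite /falling_product big_ord0 mulr1.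
rewrite ffactnSr natrM -IH 1?ltnW// natrB 1?ltnW// /falling_product big_ord_recr /= exprSr.
by field.
Qed.

Section Poly.
Variables (d : nat) (lam : d.-tuple R) (p : {poly R}).
Hypotheses (d0 : (0 < d)%N) (pE : p = \prod_(x <- lam) ('X - x%:P)).

Lemma deg_root : deg p = d.
Proof. by rewrite /deg pE size_prod_XsubC size_tuple. Qed.

Lemma poly_moment_sum n : poly_moment p n = (d%:R)^-1 * \sum_(x <- lam) x ^+ n.
Proof.
rewrite /poly_moment deg_root; congr (_ * _).
have rootE x : root p x = (x \in lam) by rewrite pE root_prod_XsubC.
have -> : [set x | root p x] = [set` undup lam].
  by apply/seteqP; split => x /=; rewrite rootE mem_undup.
rewrite -fsbig_seq ?undup_uniq//.
rewrite -(big_undup_iterop_count _ (tval lam) predT) /=; apply: eq_bigr => x _.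
by rewrite pE mup_root_poly.
Qed.

Definition moment_fps : fps R := Fps (poly_moment p).

(** The series [E] of the normalized coefficients has the cumulants in its logarithm
    and, multiplied by [falling_product], the coefficients of [p]. *)
Lemma moment_fps_equation :
  moment_fps = graded_sum (cumulant_series (ffcumulant p)) (deformed_pow d%:R^-1 moment_fps).
Proof.
have dR : (d%:R : R) != 0 by rewrite pnatr_eq0 -lt0n.
pose E := rescale (- d%:R) (egf (ecoef p)).
have e0 : ecoef p 0 = 1.
  rewrite /ecoef deg_root subn0 bin0 divr1 mul1r pE.
  have := monic_prod_XsubC (tval lam) predT id; rewrite monicE /lead_coef size_prod_XsubC.
  by rewrite size_tuple /= => /eqP.
have E0 : E 0%N = 1 by rewrite /E /= e0 fact0 divr1 mulr1.
have hE : fderiv E = fps_const (- d%:R) * (R_series (ffcumulant p) * E).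
  rewrite /E fderiv_rescale fderiv_log// rescaleM; congr (_ * (_ * _)).
  apply: fpsP => n; rewrite /= /ffcumulant deg_root /= mulrA mulrAC; congr (_ * _).
have PE : Fps (fun k => falling_product d%:R k * E k) = rev_root_series lam.
  apply: fpsP => k; rewrite rev_root_seriesE size_tuple /=.
  case: leqP => kd; last first.
    rewrite /falling_product (bigD1 (Ordinal kd))//= divff// subrr !mul0r//.
  rewrite /E /= /ecoef deg_root -(pE : p = root_poly lam) [(- d%:R) ^+ k]exprNn.
  have C0 : 'C(d, k)%:R != 0 :> R by rewrite pnatr_eq0 -lt0n bin_gt0.
  have := falling_ffact kd d0; rewrite -bin_ffact natrM => H.
  transitivity ((-1) ^+ k * (-1) ^+ k * (falling_product d%:R k * d%:R ^+ k) *
     (p`_(d - k) / 'C(d, k)%:R / k`!%:R)); first by ring.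
  rewrite H -exprMn mulrNN mulr1 expr1n; field.
  by rewrite fact_neq0 C0.
apply: (moment_series_equation dR hE E0); rewrite PE -rev_root_series_deriv mulrA; congr (_ * _).
apply: fpsP => n; rewrite fcoefCM fcoef_sum fcoefB fcoef1 -[moment_fps n]/(poly_moment p n) poly_moment_sum.
rewrite mulrBr mulrA mulfV// mul1r.
under [RHS]eq_bigr do rewrite fcoefB fcoef1.
rewrite sumrB; congr (_ - _).
by rewrite big_const_seq count_predT size_tuple iter_addr_0 mulr_natl.
Qed.

End Poly.
End RealRooted.

(** * Cumulants of sequences with an infinitesimal distribution *)

Section Limits.
Variable R : realType.

Lemma expands_prod (I : finType) (A : {set I}) (u : I -> nat -> R) (a0 a1 : I -> R) :
  (forall i, i \in A -> expands (u i) (a0 i) (a1 i)) ->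
  expands (fun d => \prod_(i in A) u i d) (\prod_(i in A) a0 i)
    (\sum_(i in A) a1 i * \prod_(j in A | j != i) a0 j).
Proof.
have [n] := ubnP #|A|; elim: n => // n IH in A *; rewrite ltnS => An h.
case: (set_0Vmem A) => [->|[x xA]].
  rewrite !big_set0 (_ : (fun d => _) = fun=> 1); first exact: expands_cst.
  by apply/funext => d; rewrite big_set0.
have AE : A = (x |: (A :\ x))%SET by rewrite finset.setD1K.
have xD : x \notin (A :\ x)%SET by rewrite !inE eqxx.
rewrite (_ : (fun d => _) = fun d => u x d * \prod_(i in (A :\ x)%SET) u i d); last first.
  by apply/funext => d; rewrite {1}AE big_setU1.
have -> : \sum_(i in A) a1 i * \prod_(j in A | j != i) a0 j =
    a0 x * (\sum_(i in (A :\ x)%SET) a1 i * \prod_(j in (A :\ x)%SET | j != i) a0 j) +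
    a1 x * \prod_(i in (A :\ x)%SET) a0 i.
  rewrite (bigD1 x)//= addrC; congr (_ + _); last first.
    by congr (_ * _); apply: eq_bigl => j; rewrite !inE andbC.
  rewrite mulr_sumr; apply: eq_big => [i|i /andP[iA ix]]; first by rewrite !inE andbC.
  rewrite (bigD1 x) /=; last by rewrite xA eq_sym.
  rewrite mulrCA; congr (_ * (_ * _)); apply: eq_bigl => j.
  by rewrite !inE -andbA andbC -andbA andbC -andbA.
have -> : \prod_(i in A) a0 i = a0 x * \prod_(i in (A :\ x)%SET) a0 i.
  by rewrite {1}AE big_setU1.
apply: expandsM; first exact: h.
apply: IH => [|i]; first by rewrite (leq_trans _ An)// [X in (_ < X)%N](cardsD1 x) xA.
by rewrite !inE => /andP[_ iA]; apply: h.
Qed.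

Lemma deformed_pow0 (M : fps R) n : deformed_pow 0 M n = M ^+ n.
Proof.
elim: n => [|n IH]; first by rewrite expr0.
by rewrite deformed_powS IH exprS (_ : fps_const 0 = 0) ?mul0r ?subr0.
Qed.

Lemma extend1E (u : nat -> R) : Fps (extend1 u) = cumulant_series u.
Proof. by []. Qed.

(** Infinitesimal free cumulants are the first-order variation of the free
    cumulants along [r + r' / d]. *)
Lemma infinitesimal_equation (r r' : nat -> R) :
  let M0 := nc_series r in
  let M1 := Fps (fun n => \sum_(P in NC n) \sum_(V in P)
       r' #|V| * \prod_(W in P | W != V) r #|W|) in
  let y := fX R * M0 in
  M0 = fcomp (cumulant_series r) y /\
  M1 = fcomp (Fps (fun n => if n is 0 then 0 else r' n)) y
     + fX R * M1 * fcomp (fderiv (cumulant_series r)) y.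
Proof.
move=> M0 M1 y.
pose u (d : nat) k := r k + r' k * d%:R^-1.
have hu k : expands (u^~ k) (r k) (r' k).
  have := expandsD (@expands_cst R (r k)) (expandsM (@expands_cst R (r' k)) (@expands_invn R)).
  by rewrite mulr0 mulr1 mul0r !addr0 add0r.
have hM : expandsF (fun d => nc_series (u d)) M0 M1.
  move=> n; apply: expands_sum => P _.
  by apply: expands_prod => V _; exact: hu.
have hW : expandsF (fun d => cumulant_series (u d)) (cumulant_series r)
    (Fps (fun n => if n is 0 then 0 else r' n)).
  by case=> [|n]; [exact: expands_cst|exact: hu].
have E (d : nat) : (0 < d)%N -> nc_series (u d) = graded_sum (cumulant_series (u d)) (deformed_pow 0 (nc_series (u d))).
  move=> _; rewrite {1}nc_series_fixpoint -graded_sum_comp extend1E.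
  by congr graded_sum; apply/funext => n; rewrite deformed_pow0.
have [E0 E1] := first_order_equation (@expands_cst R 0) hM hW E.
split; first exact: E0.
by rewrite {1}E1 (_ : fps_const (0 : R) = 0) ?mul0r ?subr0.
Qed.

(** The moment equation is triangular in the cumulants, with diagonal coefficients
    that tend to 1. *)
Lemma cumulants_expand (M : nat -> fps R) (kappa : nat -> nat -> R) M0 M1 :
  expandsF M M0 M1 -> M0 0%N = 1 ->
  (forall d, (0 < d)%N -> M d = graded_sum (cumulant_series (kappa d)) (deformed_pow d%:R^-1 (M d))) ->
  exists W0 W1, expandsF (fun d => cumulant_series (kappa d)) W0 W1.
Proof.
move=> hM M00 ME.
suff H n : exists a : R * R, expands (fun d => cumulant_series (kappa d) n) a.1 a.2.
  exists (Fps (fun n => (sval (cid (H n))).1)), (Fps (fun n => (sval (cid (H n))).2)).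
  by move=> n /=; case: cid.
elim/ltn_ind: n => n IH.
have hb k : expandsF (fun d => deformed_pow d%:R^-1 (M d) k) _ _ :=
  @expands_deformed_pow R _ _ _ _ _ k (@expands_invn R) hM.
pose S d := \sum_(k < n) cumulant_series (kappa d) k * deformed_pow d%:R^-1 (M d) k (n - k)%N.
have [[s0 s1] hS] : exists a : R * R, expands S a.1 a.2.
  pose a (k : 'I_n) := sval (cid (IH k (ltn_ord k))).
  have ha (k : 'I_n) : expands (fun d => cumulant_series (kappa d) k) (a k).1 (a k).2.
    by rewrite /a; case: cid.
  eexists (_, _) => /=; apply: expands_sum => k _.
  by apply: expandsM; [exact: ha|exact: hb].
have hbn := hb n 0%N.
rewrite fcoef0X M00 expr1n in hbn.
have := expandsM (expandsD (hM n) (expandsN hS)) (expandsV (oner_neq0 R) hbn).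
set a0 := (X in expands _ X _); set a1 := (X in expands _ _ X) => h.
exists (a0, a1); apply: expands_ext h => /=.
have b0 : \forall d \near \oo, deformed_pow d%:R^-1 (M d) n 0%N != 0.
  by apply: (cvgr_neq0 (1 : R)); [exact: expands_cvg hbn|exact: oner_neq0].
near=> d.
have bd : deformed_pow d%:R^-1 (M d) n 0%N != 0 by near: d.
have d0 : (0 < d)%N by near: d; exists 1%N.
rewrite {1}ME// fcoef_graded_sum big_ord_recr /= -/(S d) subnn addrAC subrr add0r.
by rewrite mulfK.
Unshelve. all: by end_near. Qed.

Section Distribution.
Variables (p : nat -> {poly R}) (mu : probability (measurableTypeR R) R)
  (mu' : {scalar {poly R}}).
Hypothesis hp : forall d : nat, (1 <= d)%N -> real_rooted d (p d).
Hypothesis hdist : infinitesimal_distribution p mu mu'.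

Let m := moment mu.
Let m' n := mu' 'X^n.
Let r := free_cumulant m.
Let r' := inf_free_cumulant m m'.

Lemma poly_moment0 d : (0 < d)%N -> poly_moment (p d) 0 = 1.
Proof.
move=> d0; have [lam pE] := hp d0; rewrite (poly_moment_sum pE).
rewrite big_const_seq count_predT size_tuple iter_addr_0 -[_ *+ d]mulr_natr mul1r.
by rewrite mulVf// pnatr_eq0 -lt0n.
Qed.

Lemma moment0 : m 0%N = 1.
Proof.
have [_ hm _ _] := hdist; have h := hm 0%N.
have h1 : poly_moment (p d) 0 @[d --> \oo] --> (1 : R).
  apply: (@cvg_trans _ ((fun=> 1 : R) @ \oo)); last exact: cvg_cst.
  by apply: near_eq_cvg; exists 1%N => // d /= d0; rewrite poly_moment0.
exact: (cvg_unique _ h h1).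
Qed.

Lemma moments_expand : expandsF (fun d => moment_fps (p d)) (Fps m) (Fps m').
Proof.
have [_ _ mu1 hm] := hdist; case=> [|n]; last exact: hm.
rewrite /= moment0 /m' expr0 mu1; apply: (@expands_ext R (fun=> 1)).
  by exists 1%N => // d d1; rewrite /= poly_moment0.
exact: expands_cst.
Qed.

Lemma NC0 (F : {set {set 'I_0}} -> R) : \sum_(P in NC 0) F P = F finset.set0.
Proof.
have E : [set: 'I_0]%SET = finset.set0 by apply/setP => -[].
rewrite (big_pred1 finset.set0)// => P; rewrite !inE E partition_set0.
by case: eqP => //= ->; apply/noncrossingP => V W; rewrite finset.in_set0.
Qed.

Lemma moment_nc_series : Fps m = nc_series r.
Proof.
apply: fpsP => -[|n] /=; last exact: free_cumulantP.
by rewrite NC0 big_set0 moment0.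
Qed.

Lemma inf_moment_series : Fps m' = Fps (fun n => \sum_(P in NC n) \sum_(V in P)
       r' #|V| * \prod_(W in P | W != V) r #|W|).
Proof.
apply: fpsP => -[|n] /=; last exact: inf_free_cumulantP.
by have [_ _ mu1 _] := hdist; rewrite NC0 big_set0 /m' expr0 mu1.
Qed.

(** The limits of the cumulants are the free cumulants since both solve the equation
    of order 0; the equation of order 1 then compares their variations. *)
Lemma finite_cumulants_expand : exists W1 : fps R,
  [/\ W1 0%N = 0,
      expandsF (fun d => cumulant_series (ffcumulant (p d))) (cumulant_series r) W1 &
      neg_K_deriv (cumulant_series r) * (Fps (fun n => if n is 0 then 0 else r' n) - W1) =
      - (fX R ^+ 2 * half_deriv2 (cumulant_series r))].
Proof.
have ME d : (0 < d)%N -> moment_fps (p d) =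
    graded_sum (cumulant_series (ffcumulant (p d))) (deformed_pow d%:R^-1 (moment_fps (p d))).
  by move=> d0; have [lam pE] := hp d0; exact: moment_fps_equation d0 pE.
have [W0 [W1 hW]] := cumulants_expand moments_expand moment0 ME.
have [E0 E1] := first_order_equation (@expands_invn R) moments_expand hW ME.
have [F0 F1] := infinitesimal_equation r r'.
rewrite -inf_moment_series -moment_nc_series in F0 F1.
have WE : W0 = cumulant_series r.
  apply: (@fcomp_inj _ (fX R * Fps m)); rewrite ?fcoefXM//; first exact: moment0.
  exact: (etrans (esym E0) F0).
rewrite WE in hW E1; exists W1; split=> //.
  have h := hW 0%N; have := @expands_cst R 1 => h1.
  by have [_ ->] := expands_uniq h h1.
have E1' : Fps m' = fcomp W1 (fX R * Fps m) + fX R * Fps m' *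
    fcomp (fderiv (cumulant_series r)) (fX R * Fps m)
   - fX R ^+ 2 * fcomp (half_deriv2 (cumulant_series r)) (fX R * Fps m) * fderiv (fX R * Fps m).
  by rewrite {1}E1 mul1r.
exact: (first_order_difference F0 _ F1 E1').
Qed.

Lemma cumulant_fluctuationE n c :
  expands (fun d => ffcumulant (p d) n) (r n) c -> cumulant_fluctuation p mu n = c.
Proof.
move=> hc.
have littleoE c' : ((fun d : nat => ffcumulant (p d) n - (r n + d%:R^-1 * c'))
    =o_\oo (fun d : nat => d%:R^-1 : R)) <-> expands (fun d => ffcumulant (p d) n) (r n) c'.
  have K (d : nat) (x e : R) : (0 < d)%N ->
      (`|x - (r n + d%:R^-1 * c')| <= e * `|d%:R^-1|) =
      (`|c' - d%:R * (x - r n)| <= e).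
    move=> d0; have dR : (0 < d%:R :> R) by rewrite ltr0n.
    rewrite normfV [`|d%:R|]gtr0_norm// ler_pdivlMr// -[X in _ * X](gtr0_norm dR) -normrM.
    by rewrite -[in RHS]normrN; congr (`|_| <= _); field; rewrite gt_eqF.
  split=> [/eqoP h|/cvgrPdist_le h].
    apply/cvgrPdist_le => e e0; have h' := h e e0.
    near=> d; rewrite -K; first by near: d; exact: h'.
    by near: d; exists 1%N.
  apply/eqoP => e e0; have h' := h e e0.
  near=> d; rewrite K; first by near: d; exact: h'.
  by near: d; exists 1%N.
rewrite /cumulant_fluctuation; apply: get_unique => /=; first by apply/littleoE.
by move=> c' /littleoE h; have [_] := expands_uniq h hc.
Unshelve. all: by end_near. Qed.

End Distribution.
End Limits.

(** * Formal Laurent series *)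

Section Laurent.
Variable R : realType.
Implicit Types (f g h : fps R) (a b k : int).

(** The Laurent series [z ^ a * f]. *)
Definition laurent a f : int -> R := fun k => if k - a is Posz n then f n else 0.

Lemma laurentE a f n : laurent a f (a + Posz n) = f n.
Proof. by rewrite /laurent addrC addKr. Qed.

Lemma laurent_lt a f k : k < a -> laurent a f k = 0.
Proof. by rewrite /laurent; case E: (k - a) => [n|n] //; lia. Qed.

Lemma laurent_ext a f (u : int -> R) : (forall k, k < a -> u k = 0) ->
  (forall n : nat, u (a + Posz n) = f n) -> u = laurent a f.
Proof.
move=> u0 uE; apply/funext => k; case: (ltrP k a) => ka.
  by rewrite u0// laurent_lt.
have -> : k = a + Posz `|k - a|%N by lia.
by rewrite uE laurentE.
Qed.

Lemma laurent_lbounded a f : lbounded (laurent a f).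
Proof. by exists a => k; apply: laurent_lt. Qed.

Lemma lboundedE (u : int -> R) : lbounded u -> exists a f, u = laurent a f.
Proof.
move=> [a ua]; exists a, (Fps (fun n => u (a + Posz n))).
by apply: laurent_ext.
Qed.

Lemma lmono_laurent a : lmono R a = laurent a 1.
Proof.
apply: laurent_ext => [k ka|n]; rewrite /lmono; first by rewrite lt_eqF.
by rewrite fcoef1; congr (_%:R); lia.
Qed.

Lemma laurentX a f : laurent a (fX R * f) = laurent (a + 1) f.
Proof.
apply: laurent_ext => [k ka|n]; last first.
  have -> : a + 1 + Posz n = a + Posz n.+1 by lia.
  by rewrite laurentE fcoefXM.
case: (ltrP k a) => ka'; first by rewrite laurent_lt.
have -> : k = a + Posz 0 by lia.
by rewrite laurentE fcoefXM.
Qed.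

Lemma fsum_int (F : int -> R) (a : int) (n : nat) :
  (forall i, F i != 0 -> (a <= i < a + Posz n)%R) ->
  \sum_(i \in [set: int]) F i = \sum_(i < n) F (a + Posz i).
Proof.
move=> hF; pose s := [seq a + Posz i | i <- iota 0 n].
rewrite (fsbigE s) //; first last.
- move=> i _; apply: contraNeq => /hF ian; apply/mapP; exists `|i - a|%N; last by lia.
  by rewrite mem_iota; lia.
- by rewrite map_inj_uniq ?iota_uniq// => i j; lia.
rewrite big_map -[in RHS](big_mkord predT (fun i => F (a + Posz i))) /index_iota subn0.
by apply: eq_bigl => i; rewrite in_setT.
Qed.

Lemma lmul_laurent a b f g : lmul (laurent a f) (laurent b g) = laurent (a + b) (f * g).
Proof.
apply: laurent_ext => [k kab|n]; rewrite /lmul.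
  rewrite fsbig1// => i _; case: (ltrP i a) => ia.
    by rewrite laurent_lt ?mul0r.
  by rewrite (@laurent_lt b) ?mulr0//; lia.
rewrite (@fsum_int _ a n.+1) => [|i]; last first.
  apply: contraNT; case: (ltrP i a) => ia ian; first by rewrite laurent_lt ?mul0r.
  by rewrite (@laurent_lt b) ?mulr0//; move: ian; lia.
rewrite fcoefM; apply: eq_bigr => i _; rewrite laurentE; congr (_ * _).
have -> : a + b + Posz n - (a + Posz i) = b + Posz (n - i)%N.
  by have := ltn_ord i; lia.
by rewrite laurentE.
Qed.

Lemma linv_laurent a f g : f * g = 1 -> linv (laurent a f) = laurent (- a) g.
Proof.
move=> fg; apply: get_unique => [|u [/lboundedE[b [h ->]]]].
  split; first exact: laurent_lbounded.
  by rewrite lmul_laurent fg subrr lmono_laurent.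
rewrite lmul_laurent lmono_laurent => E.
have := congr1 (lmul (laurent (- a) g)) E; rewrite !lmul_laurent mulr1 addr0 mulrA.
by rewrite [g * f]mulrC fg mul1r addKr.
Qed.

Lemma lderiv_laurent a f :
  lderiv (laurent a f) = laurent (a - 1) (Fps (fun n => (a + Posz n)%:~R * f n)).
Proof.
apply: laurent_ext => [k ka|n]; rewrite /lderiv.
  by rewrite laurent_lt ?mulr0//; lia.
have -> : a - 1 + Posz n + 1 = a + Posz n by lia.
by rewrite laurentE.
Qed.

Lemma laurentD a f g : laurent a (f + g) = laurent a f \+ laurent a g.
Proof. by apply/funext => k; rewrite /laurent /=; case: (k - a) => // n; rewrite addr0. Qed.

Lemma laurentB a f g : laurent a (f - g) = laurent a f \- laurent a g.
Proof. by apply/funext => k; rewrite /laurent /=; case: (k - a) => // n; rewrite subr0. Qed.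

Lemma laurentZ a (c : R) f : laurent a (fps_const c * f) = c \*o laurent a f.
Proof.
apply/funext => k; rewrite -[RHS]/(c * laurent a f k) /laurent.
case: (k - a) => n; last by rewrite mulr0.
by rewrite fcoefCM.
Qed.

Lemma lseries_laurent f : f 0%N = 0 -> lseries (fun n => f n.+1) = laurent (- 1) f.
Proof.
move=> f0; apply: laurent_ext => [[k|k] ka|[|n]]; [by exfalso; lia|by []| |].
  by rewrite /= f0.
by have -> : - 1 + Posz n.+1 = Posz n by lia.
Qed.

Lemma lpow_laurent f n : f 0%N = 1 ->
  lpow (laurent (- 1) f) (Negz n) = laurent (Posz n.+1) (fps_inv f ^+ n.+1).
Proof.
move=> f0; rewrite /lpow (linv_laurent _ (mul_fps_inv f0)) opprK.
elim: n.+1 => [|m IH]; first by rewrite /= lmono_laurent.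
by rewrite iterS IH lmul_laurent exprS; congr laurent; lia.
Qed.

(** Composing a series in 1/z with a series [K] with a simple pole amounts to
    composing a power series with [1 / K]. *)
Lemma lcomp_laurent f h (H : int -> R) : f 0%N = 1 ->
  (forall n, H (Negz n) = h n) -> (forall n : nat, H (Posz n) = 0) ->
  lcomp H (laurent (- 1) f) = laurent 0 (fcomp (fX R * h) (fX R * fps_inv f)).
Proof.
move=> f0 HN HP.
have shift n g : laurent 0 (fX R ^+ n * g) = laurent (Posz n) g.
  elim: n g => [|n IH] g; first by rewrite mul1r.
  by rewrite exprSr -mulrA IH laurentX; congr laurent; lia.
have term n k : H (Negz n) * lpow (laurent (- 1) f) (Negz n) k =
    h n * laurent 0 ((fX R * fps_inv f) ^+ n.+1) k.
  rewrite HN (lpow_laurent _ f0).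
  rewrite (exprMn n.+1 (fX R) (fps_inv f)).
  by rewrite shift.
apply: laurent_ext => [k k0|m]; rewrite /lcomp.
  rewrite fsbig1// => -[n|n] _; first by rewrite HP mul0r.
  by rewrite term laurent_lt ?mulr0.
rewrite add0r (@fsum_int _ (- Posz m) m) => [|[n|n]]; last first.
- apply: contraNT => nm; rewrite term -[Posz m]add0r laurentE.
  by rewrite fcoef_exp_small ?mulr0 ?fcoefXM//; move: nm; lia.
- by rewrite HP mul0r eqxx.
rewrite [RHS]big_ord_recl fcoefXM mul0r add0r.
rewrite (reindex_inj rev_ord_inj); apply: eq_bigr => i _.
have -> : - Posz m + Posz (rev_ord i) = Negz i.
  by rewrite NegzE /=; have := ltn_ord i; lia.
by rewrite term -[Posz m]add0r laurentE lift0 fcoefXM.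
Qed.

End Laurent.

(** * The two formulas *)

Theorem lemma4p5 (R : realType) (p : nat -> {poly R})
    (mu : probability (measurableTypeR R) R) (mu' : {scalar {poly R}})
    (hp : forall d : nat, (1 <= d)%N -> real_rooted d (p d))
    (hdist : infinitesimal_distribution p mu mu') :
  let K := K_series mu in
  let K' := lderiv K in
  let K'' := lderiv K' in
  Rhat_series mu p = Rinf_series mu mu' \- lmul (lcomp (H_series mu) K) K' /\
  Rhat_series mu p =
    Rinf_series mu mu' \- lmul K'' (linv (2 \*o K')) \- lmono R (-1).
Proof.
have [W1 [W10 hW UD]] := finite_cumulants_expand hp hdist.
set r := free_cumulant (moment mu) in hW UD *.
set W := cumulant_series r in hW UD *; set U := neg_K_deriv W in UD *.
set R1 := Fps _ in UD.
have U0 : U 0%N = 1 by apply: neg_K_deriv0.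
have RhatE : Rhat_series mu p = laurent (- 1) W1.
  rewrite -lseries_laurent//; congr lseries; apply/funext => n.
  by apply: cumulant_fluctuationE; exact: hW n.+1.
have RinfE : Rinf_series mu mu' = laurent (- 1) R1 by rewrite -lseries_laurent.
move=> K K' K''.
have KE : K = laurent (- 1) W.
  rewrite /K /K_series /W cumulant_seriesE laurentD -lmono_laurent laurentX.
  by congr (_ \+ _); apply/funext => k; rewrite /laurent addNr subr0; case: k.
have K'E : K' = laurent (- 2) (- U).
  rewrite /K' KE lderiv_laurent; congr laurent; apply: fpsP => n.
  rewrite fcoefN fcoefB coef_XD /= intrD -mulr_natr; ring.
have K''E : K'' = laurent (- 3) ((U + fX R ^+ 2 * half_deriv2 W) *+ 2).
  rewrite /K'' K'E lderiv_laurent; congr laurent; apply: fpsP => n.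
  rewrite fcoefMn fcoefD fcoefXnM.
  rewrite -[LHS]/((- 2 + Posz n)%:~R * (- U) n) fcoefN fcoefB coef_XD intrD.
  case: n => [|[|n]].
  - by rewrite /= addr0; ring.
  - by rewrite /= addr0; ring.
  have C2 : ('C(n.+2, 2) * 2 = n.+2 * n.+1)%N.
    by rewrite -[X in (_ * X)%N]/(2`!) bin_ffact ffactnS ffactn1.
  rewrite subn2 [n.+2.-2]/= -[half_deriv2 W n]/(W n.+2 *+ 'C(n.+2, 2)) mulrnDl -mulrnA C2.
  by rewrite /= mulrnA; ring.
split.
  have HE n : H_series mu (Negz n) = Fps (annular_sum r) n.
    rewrite /H_series /=; case: ltnP => // n2.
    by rewrite /annular_sum big_geq ?mulr0.
  pose A := fcomp (fX R * Fps (annular_sum r)) (fX R * fps_inv W).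
  have inv : U ^+ 2 * A = fX R ^+ 3 * half_deriv2 W := annular_sum_inverse r.
  have lcompE : lcomp (H_series mu) K = laurent 0 A.
    by rewrite KE; apply: lcomp_laurent HE _.
  rewrite lcompE K'E lmul_laurent.
  have UA : U * A = fX R * (W1 - R1).
    apply: (fps_lregl U0) => /=; rewrite mulrA -expr2 inv.
    rewrite mulrCA -opprB mulrN UD; ring.
  have -> : A * - U = fX R * (R1 - W1) by rewrite mulrN mulrC UA; ring.
  rewrite laurentX RinfE RhatE -[laurent (0 - 2 + 1) _]/(laurent (- 1) _) -laurentB.
  by congr laurent; ring.
have half : fps_const (- 2^-1) *+ 2 = -1 :> fps R.
  apply: fpsP => n; rewrite fcoefMn fcoefC fcoefN fcoef1; case: n => [|n] /=.
    by rewrite ?mulr1n; field.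
  by rewrite !mulr0n mul0rn oppr0.
rewrite [X in 2 \*o X]K'E -laurentZ (@linv_laurent _ _ _ (fps_const (- 2^-1) * fps_inv U)); last first.
  transitivity (- (fps_const (- 2^-1) * fps_const 2) * (U * fps_inv U)); first by ring.
  have -> : fps_const (- 2^-1) * fps_const 2 = -1 :> fps R.
    by rewrite -fps_constM mulNr mulVf ?pnatr_eq0// fps_constN.
  by rewrite mul_fps_inv// opprK mulr1.
rewrite K''E lmul_laurent RinfE RhatE lmono_laurent.
have -> : - 3 - - 2 = - 1 :> int by [].
rewrite -!laurentB; congr laurent; apply: (fps_lregl U0) => /=.
rewrite !mulrBr mulr1.
have -> : U * ((U + fX R ^+ 2 * half_deriv2 W) *+ 2 * (fps_const (- 2^-1) * fps_inv U)) =
    (fps_const (- 2^-1) *+ 2) * (U * fps_inv U) * (U + fX R ^+ 2 * half_deriv2 W) by ring.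
rewrite half mul_fps_inv//.
have -> : fX R ^+ 2 * half_deriv2 W = - (U * (R1 - W1)) by rewrite UD opprK.
ring.
Qed.
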